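(* Let $p,p'\ge 1$ be integers, let $q$ be an integer coprime to $p$ and $q'$ an integer coprime to $p'$. Then the $U(1)$ homotopy Dijkgraaf--Witten invariants distinguish homotopy equivalence classes of lens spaces: the lens spaces $L(p,q)$ and $L(p',q')$ are (orientation-preservingly) homotopy equivalent if and only if $$Z^k(L(p,q)) = Z^k(L(p',q'))\quad\text{for all integers } k\ge 0 .$$
   Context: Lens spaces: for coprime integers $p,q$ with $p\geq 1$, $L(p,q)$ is the closed oriented $3$-manifold obtained by surgery on $S^3$ along the unknot with surgery coefficient $-p/q$, with the orientation induced from the standard right-handed orientation of $S^3$. ''Homotopy equivalent'' for lens spaces always means orientation-preservingly homotopy equivalent; by Whitehead's classification (which may be used) $L(p,q)$ and $L(p',q')$ are homotopy equivalent in this sense if and only if $p=p'$ and $qq'\equiv a^2 \pmod p$ for some integer $a$. Cocycle: let $K=K(U(1),1)$ be the Eilenberg--Mac Lane space of $U(1)$ regarded as a discrete group, so $H^3(K;U(1))$ is the group cohomology of the discrete group $U(1)$ with trivial coefficients $U(1)$. For an integer $k$ let $\omega_k\colon U(1)^3\to U(1)$ be the group $3$-cocycle $$\omega_k(e^{2\pi i a},e^{2\pi i b},e^{2\pi i c}) = e^{2\pi i k a(b+c-[b+c])},\qquad 0\le a,b,c<1,$$ where $[b+c]\in[0,1)$ is $b+c$ reduced modulo $1$; $[\omega_k]\in H^3(K;U(1))$ denotes its class. Invariants: for a closed oriented $3$-manifold $W$, let $\mathcal F_W=H^1(W;U(1))\cong \mathrm{Hom}(H_1(W;\mathbb Z),U(1))$,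 a compact abelian Lie group (topology of pointwise convergence on $\mathrm{Hom}$), with normalized Haar measure $\mu_W$. An element $\nu\in\mathcal F_W$ is identified with the homotopy class of maps $W\to K$ it classifies. Define $$Z^k(W)=\int_{\nu\in\mathcal F_W}\langle \nu^*([\omega_k]),[W]\rangle\, d\mu_W\in\mathbb C,$$ where $[W]\in H_3(W;\mathbb Z)$ is the fundamental class and $\langle-,-\rangle\colon H^3(W;U(1))\otimes H_3(W;\mathbb Z)\to U(1)\subset\mathbb C$ is evaluation. The $U(1)$ homotopy Dijkgraaf--Witten invariants of $W$ are the collection $\{Z^k(W)\}_{k\ge0}$. (For lens spaces with $p\geq 1$ the group $\mathcal F_W$ is finite and the integral is a normalized finite sum.) *)

(* Defs.v *)
From HB Require Import structures.
From mathcomp Require Import all_boot all_order all_algebra.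
From mathcomp Require Import generic_quotient finmap complex freeg.
From mathcomp Require Import all_classical all_reals all_analysis.

Set Implicit Arguments.
Unset Strict Implicit.
Unset Printing Implicit Defensive.

Import Order.TTheory GRing.Theory Num.Theory.
Import numFieldNormedType.Exports.

Local Open Scope classical_set_scope.
Local Open Scope ring_scope.
Local Open Scope complex_scope.
Local Open Scope quotient_scope.

Section StandardSimplex.
Context {R : realType}.

Definition std_simplex (n : nat) : set 'rV[R]_n.+1 :=
  [set t | (forall i, 0 <= t 0 i) /\ \sum_i t 0 i = 1].
Arguments std_simplex : clear implicits.

(* barycentric coordinates of the image of [t] under the affine map extending
   the map [f] of vertices *)
Definition affine_coords m n (f : 'I_m.+1 -> 'I_n.+1) (t : 'rV[R]_m.+1) :
    'rV[R]_n.+1 := \row_j \sum_(i | f i == j) t 0 i.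

Lemma affine_coordsP m n (f : 'I_m.+1 -> 'I_n.+1) (t : std_simplex m) :
  affine_coords f (val t) \in std_simplex n.
Proof.
have [t0 t1] := set_mem (valP t); apply/mem_set; split=> [j|].
  by rewrite mxE; apply: sumr_ge0 => i _; exact: t0.
under eq_bigr do rewrite mxE.
by rewrite -t1 [RHS](partition_big f xpredT).
Qed.

Definition affine_map m n (f : 'I_m.+1 -> 'I_n.+1) (t : std_simplex m) :
    std_simplex n :=
  exist (fun x => x \in std_simplex n) _ (affine_coordsP f t).

Lemma affine_coords_continuous m n (f : 'I_m.+1 -> 'I_n.+1) :
  continuous (affine_coords f).
Proof.
move=> t U [P /= tP PU].
have FF : Filter (nbhs t) := @nbhs_filter 'rV[R]_m.+1 t.
have cvg_sum (r : seq 'I_m.+1) (B : pred 'I_m.+1) :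
    (fun s : 'rV[R]_m.+1 => \sum_(i <- r | B i) s 0 i) @ t -->
    \sum_(i <- r | B i) t 0 i.
  elim: r => [|i r IHr].
    rewrite big_nil; under eq_fun do rewrite big_nil.
    exact: cvg_cst.
  rewrite big_cons; under eq_fun do rewrite big_cons.
  by case: (B i) => //; apply: cvgD IHr; exact: coord_continuous.
have cvg_coord j : (fun s => affine_coords f s 0 j) @ t -->
    affine_coords f t 0 j.
  rewrite [X in _ --> X]mxE; under eq_fun do rewrite mxE; exact: cvg_sum.
have near_coord j : \forall s \near t, P 0 j (affine_coords f s 0 j).
  exact: (cvg_coord j _ (tP 0 j)).
have /filter_forall := near_coord; apply: filterS => s sP.
by apply: PU => i j; rewrite ord1; exact: sP.
Qed.

Lemma affine_map_continuous m n (f : 'I_m.+1 -> 'I_n.+1) :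
  continuous (affine_map f).
Proof.
apply: continuous_comp_initial => t.
apply: (@continuous_comp _ _ _ (val : std_simplex m -> _) (affine_coords f)).
  exact: initial_continuous.
exact: affine_coords_continuous.
Qed.

HB.instance Definition _ m n (f : 'I_m.+1 -> 'I_n.+1) :=
  isContinuous.Build (std_simplex m) (std_simplex n) (affine_map f)
    (@affine_map_continuous m n f).
End StandardSimplex.
Arguments std_simplex R n : clear implicits.

Definition simplex (R : realType) (n : nat) (X : topologicalType) :=
  continuousType (std_simplex R n) X.
Definition chain (R : realType) (n : nat) (X : topologicalType) :=
  {freeg (simplex R n X)}.

Section SingularChains.
Context {R : realType}.
Implicit Types X Y : topologicalType.

Definition restrict X m n (f : 'I_m.+1 -> 'I_n.+1) (s : simplex R n X) :
  simplex R m X := s \o affine_map f.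

Definition face X n (i : 'I_n.+2) (s : simplex R n.+1 X) : simplex R n X :=
  restrict (fintype.lift i) s.

Definition boundary X n (z : chain R n.+1 X) : chain R n X :=
  fglift (fun s : simplex R n.+1 X =>
    \sum_(i < n.+2) (-1) ^+ i *: << face i s >>) z.

Definition push X Y (f : continuousType X Y) n (z : chain R n X) :
  chain R n Y :=
  fglift (fun s : simplex R n X => << (f \o s : simplex R n Y) >>) z.

Definition supported X n (A : set X) (z : chain R n X) : Prop :=
  forall s, s \in dom z -> range s `<=` A.

Definition homologous X n (z z' : chain R n X) : Prop :=
  exists b : chain R n.+1 X, z - z' = boundary b.

(* [z] and [z'] represent the same class in [H_n(X, A)] *)
Definition rel_homologous X n (A : set X) (z z' : chain R n X) : Prop :=
  exists2 a : chain R n X, supported A a & homologous z (z' + a).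

(* [z] represents a fundamental class of the closed n-manifold [X]: a cycle
   whose image generates the local homology [H_n(X, X \ {x})] at each [x]. *)
Definition is_fundamental_cycle X n (z : chain R n.+1 X) : Prop :=
  boundary z = 0 /\
  forall (x : X) (y : chain R n.+1 X), supported (~` [set x]) (boundary y) ->
    exists m : int, rel_homologous (~` [set x]) y (m *: z).

Definition homotopic X Y (f g : X -> Y) : Prop :=
  exists H : X * R -> Y,
    [/\ {within [set: X] `*` `[0, 1], continuous H},
        forall x, H (x, 0) = f x & forall x, H (x, 1) = g x].

(* orientation preserving for the orientations of [X] and [Y] whose fundamental
   classes are represented by [z] and [z'] *)
Definition oriented_homotopy_equivalent X Y n
    (z : chain R n X) (z' : chain R n Y) : Prop :=
  exists (f : continuousType X Y) (g : continuousType Y X),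
    [/\ homotopic (g \o f) idfun, homotopic (f \o g) idfun &
        homologous (push f z) z'].

End SingularChains.

Section DijkgraafWitten.
Context {R : realType}.
Implicit Types X : topologicalType.

Definition e2pi (a : R) : R[i] := cos (2 * pi * a) +i* sin (2 * pi * a).

(* the [a] in [0, 1) with [x = e^(2 pi i a)], for [x] in U(1) *)
Definition turn (x : R[i]) : R := xget 0 [set a | 0 <= a < 1 /\ e2pi a = x].

Definition frac (a : R) : R := a - (Num.floor a)%:~R.

Definition omega (k : int) (x y z : R[i]) : R[i] :=
  let a := turn x in let b := turn y in let c := turn z in
  e2pi (k%:~R * a * (b + c - frac (b + c))).

Definition vertex X n (i : 'I_n.+1) (s : simplex R n X) : simplex R 0 X :=
  restrict (fun=> i) s.

Definition edge X n (i j : 'I_n.+1) (s : simplex R n X) : simplex R 1 X :=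
  restrict (fun l : 'I_2 => if l == 0 then i else j) s.

(* U(1)-valued singular 1-cocycles of X; these are exactly the simplicial maps
   from the singular set of X to the nerve of the discrete group U(1). *)
Definition cocycle1 X : set (simplex R 1 X -> R[i]) :=
  [set c | (forall s, `|c s| = 1) /\
    forall s : simplex R 2 X,
      c (edge 0 1 s) * c (edge 1 (inord 2) s) = c (edge 0 (inord 2) s)].
Arguments cocycle1 : clear implicits.

Definition cohomologous X (c c' : cocycle1 X) : bool :=
  `[< exists2 b : simplex R 0 X -> R[i], forall v, `|b v| = 1 &
      forall s, val c' s = val c s * b (vertex 1 s) / b (vertex 0 s) >].

Lemma cohomologous_refl X : reflexive (@cohomologous X).
Proof.
move=> c; apply/asboolP; exists (fun=> 1) => [_|s]; first exact: normr1.
by rewrite mulr1 divr1.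
Qed.

Lemma normr1_neq0 (x : R[i]) : `|x| = 1 -> x != 0.
Proof. by move=> x1; rewrite -normr_eq0 x1 oner_eq0. Qed.

Lemma cohomologous_sym X : symmetric (@cohomologous X).
Proof.
suff H c c' : @cohomologous X c c' -> cohomologous c' c.
  by move=> c c'; apply/idP/idP; exact: H.
move=> /asboolP[b b1 cE]; apply/asboolP; exists (fun v => (b v)^-1) => [v|s].
  by rewrite normfV b1 invr1.
have b0 v := normr1_neq0 (b1 v).
by rewrite cE invrK (mulrAC _ _ (b (vertex 1 s))^-1) mulfK // divfK.
Qed.

Lemma cohomologous_trans X : transitive (@cohomologous X).
Proof.
move=> c2 c1 c3 /asboolP[b b1 bE] /asboolP[d d1 dE]; apply/asboolP.
exists (fun v => b v * d v) => [v|s]; first by rewrite normrM b1 d1 mulr1.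
by rewrite dE bE invfM !mulrA; congr (_ * _); rewrite mulrAC.
Qed.

Definition cohomologous_rel X := EquivRel (@cohomologous X)
  (@cohomologous_refl X) (@cohomologous_sym X) (@cohomologous_trans X).

Definition H1_U1 X := {eq_quot (cohomologous_rel X)}.
Arguments H1_U1 : clear implicits.

HB.instance Definition _ X := Choice.on (H1_U1 X).
HB.instance Definition _ X := Quotient.on (H1_U1 X).

(* the pullback of [omega k] along the map from the singular set of [X] to the
   nerve of U(1) given by [c] *)
Definition pull_omega X (k : int) (c : cocycle1 X) (s : simplex R 3 X) :
    R[i] :=
  omega k (val c (edge 0 1 s)) (val c (edge 1 (inord 2) s))
          (val c (edge (inord 2) (inord 3) s)).

Definition evaluate X n (u : simplex R n X -> R[i]) (z : chain R n X) : R[i] :=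
  \prod_(s <- dom z) u s ^ coeff s z.

(* [z] is a cycle representing the fundamental class of the 3-manifold [W].
   This is the invariant when [H^1(W; U(1))] is finite, as for lens spaces:
   its normalized Haar measure is then the uniform one. *)
Definition Zdw (k : int) (W : topologicalType) (z : chain R 3 W) : R[i] :=
  (#|` fset_set [set: H1_U1 W]|%:R)^-1 *
  \sum_(nu \in [set: H1_U1 W]) evaluate (pull_omega k (repr nu)) z.

End DijkgraafWitten.

Section LensSpaces.
Context {R : realType}.

Definition C2 : topologicalType := (R[i]^o * R[i]^o)%type.

(* The 3-sphere is taken of radius sqrt 2 in [C^2], with coordinates (z, w). The
   surgery is on the unknot [w = 0], with tubular neighbourhood [|w| <= |z|],
   whose exterior [|z| <= |w|] meets it in the torus [|z| = |w| = 1]. *)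
Definition sphere3 : set C2 := [set x | `|x.1| ^+ 2 + `|x.2| ^+ 2 = 2].
Definition exterior : set C2 := sphere3 `&` [set x | `|x.1| <= `|x.2|].
Definition solid_torus : set C2 := [set x | `|x.1| <= 1 /\ `|x.2| = 1].

(* On the torus [|z| = |w| = 1] the preferred longitude of the unknot is the
   z-circle and its meridian, linking the unknot +1 times, is the w-circle.
   As [r * q + s * p = 1], the map below is a homeomorphism of that torus. It
   sends the meridian [t |-> (t, 1)] of the solid torus glued in to -p meridians
   plus q longitudes, so the surgery coefficient is -p/q. *)
Definition surgery_gluing (p q : int) (x : C2) : C2 :=
  let: (r, s) := egcdz q p in
  (x.1 ^ q * x.2 ^ s, x.1 ^ (- p) * x.2 ^ r).

(* [true] is the exterior and [false] the solid torus glued to it *)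
Definition piece (b : bool) : set C2 := if b then exterior else solid_torus.

Definition pieces : topologicalType := {b : bool & piece b}.

(* two points of [pieces] are identified when they have the same value *)
Definition glue (p q : int) (x : pieces) : bool * C2 :=
  let y := val (projT2 x) in
  if ~~ projT1 x && (`|y.1| == 1) then (true, surgery_gluing p q y)
  else (projT1 x, y).

Definition glued (p q : int) (x y : pieces) : bool := glue p q x == glue p q y.

Lemma glued_refl p q : reflexive (glued p q).
Proof. by move=> x; exact: eqxx. Qed.

Lemma glued_sym p q : symmetric (glued p q).
Proof. by move=> x y; exact: eq_sym. Qed.

Lemma glued_trans p q : transitive (glued p q).
Proof. by move=> y x z /eqP xy /eqP yz; rewrite /glued xy yz. Qed.

Definition glued_rel p q :=
  EquivRel (glued p q) (@glued_refl p q) (@glued_sym p q) (@glued_trans p q).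

Definition lens (p q : int) := quotient_topology {eq_quot (glued_rel p q)}.

HB.instance Definition _ p q := Topological.on (lens p q).
HB.instance Definition _ p q := Quotient.on (lens p q).

Definition of_exterior (p q : int) (x : piece true) : lens p q :=
  \pi_(lens p q) (existT (fun b => piece b) true x).

Lemma of_exterior_continuous p q : continuous (of_exterior p q).
Proof.
move=> x; apply: (@continuous_comp _ _ _ (existT (fun b => piece b) true)).
  exact: existT_continuous.
exact: pi_continuous.
Qed.

HB.instance Definition _ p q := isContinuous.Build (piece true) (lens p q)
  (of_exterior p q) (@of_exterior_continuous p q).

Definition real_coords (x : C2) : 'rV[R]_4 :=
  \row_i [:: complex.Re x.1; complex.Im x.1; complex.Re x.2; complex.Im x.2]`_i.

(* [s] is the radial projection to [sphere3] of the affine 3-simplex in R^4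
   whose vertices are the rows of a matrix of positive determinant. With the
   outward-normal-first convention these are the positively oriented spherical
   simplices. *)
Definition positive_simplex (s : simplex R 3 (piece true)) : Prop :=
  exists2 A : 'M[R]_4, 0 < \det A &
    forall t, exists2 l : R, 0 < l &
      real_coords (val (s t)) = l *: (val t *m A).

(* [z] represents the fundamental class of [lens p q] for the orientation
   extending that of the exterior, as part of the 3-sphere. *)
Definition lens_fundamental_cycle (p q : int) (z : chain R 3 (lens p q)) :
    Prop :=
  is_fundamental_cycle z /\
  forall (s : simplex R 3 (piece true)) (t : std_simplex R 3),
    positive_simplex s -> (forall i, 0 < val t 0 i) ->
    rel_homologous (~` [set of_exterior p q (s t)])
      z << (of_exterior p q \o s : simplex R 3 (lens p q)) >>.

End LensSpaces.

(* A classical theorem, not a definition of homotopy equivalence: it serves as a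
   hypothesis where the homotopy classification of lens spaces is quoted. *)
Definition Whitehead_classification (R : realType) : Prop :=
  forall (p q p' q' : int)
    (z : chain R 3 (lens p q)) (z' : chain R 3 (lens p' q')),
  1 <= p -> 1 <= p' -> coprimez p q -> coprimez p' q' ->
  lens_fundamental_cycle z -> lens_fundamental_cycle z' ->
  oriented_homotopy_equivalent z z' <->
  p = p' /\ exists a : int, (q * q' = a ^+ 2 %[mod p])%Z.

(* Main.v *)
From HB Require Import structures.
From mathcomp Require Import all_boot all_order all_algebra.
From mathcomp Require Import generic_quotient finmap complex freeg.
From mathcomp Require Import all_classical all_reals all_analysis.
From mathcomp Require Import ring lra zify.
Require Import Defs.

(** A class in H^1(L(p,q); R/Z) is an integer n mod p: writing the class as a real
cochain [a], on each of the two solid tori [a] is a multiple (n/p on the glued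
one, nq/p on the exterior) of the cochain measuring the winding of the core
angle, up to coboundaries and integers. The pullback of omega_k is
e^(2 pi i k (a u da)). Subtracting an explicit coboundary from [a u da] makes it
integral on every simplex avoiding the core of the exterior, and on every simplex
of the exterior whose core angle avoids one value; together these open sets miss a
single point. By excision the evaluation on the fundamental class can thus be
read off a small prism around that point, and it is n^2 q / p modulo 1. Hence
   Z^k(L(p,q)) = 1/p sum_(n < p) e^(2 pi i k n^2 q / p).
By Fourier inversion in k these numbers determine the distribution of n^2 q / p
in Q/Z. It charges q/p, so if the invariants of L(p',q') agree then
n^2 q'/p' = q/p mod 1 for some n; this forces p | p', by symmetry p = p', and then
q q' = (n q')^2 mod p. Conversely, if q q' = a^2 then the substitutions n -> q n
and n -> a n identify the two sums. Whitehead's classification concludes. *)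

Set Implicit Arguments.
Unset Strict Implicit.
Unset Printing Implicit Defensive.

Import Order.TTheory GRing.Theory Num.Theory.
Import numFieldNormedType.Exports.
Local Open Scope classical_set_scope.
Local Open Scope ring_scope.

(** * Barycentric subdivision of cochains *)

(** The fundamental class is known only through local homology, so no triangulation is available to
    sum over; this is why the integrand must become integral off one point. The coboundary arises as
    follows. Write a = df + A + d, where A is an explicit real cochain and d is integral. Modulo
    integers, a u da and A u dA differ by the coboundary of f da - A u d. Where the core of the
    exterior is removed, A is closed. Near that core dA = n tau, where tau is the coboundary of the
    integral cochain [mu] counting the jumps of the argument of the disk coordinate; tau is dual to
    the core. The slope of A along the core is n q / p, so A u dA is (n^2 q / p) dlog(ang) u tau
    plus terms that are exact or integral. Adding the jumping argument of [ang] times tau to the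
    correction turns dlog(ang) into a jump count. What remains is n^2 q / p times the intersection
    of the core with the page where [ang] is positive, which is one point. Excision is carried out
    dually: cochains are subdivided, not chains, and values stay in the real numbers and are
    compared modulo integers. *)

Section Subdivision.
Variables (R : comRingType) (P : Type).
Variable bary : forall n, ('I_n.+1 -> P) -> P.

Definition cons_vertex n (b : P) (v : 'I_n -> P) (i : 'I_n.+1) : P :=
  oapp v b (unlift ord0 i).

Definition dcoch n (phi : ('I_n -> P) -> R) (v : 'I_n.+1 -> P) : R :=
  \sum_(i < n.+1) (-1) ^+ i * phi (v \o fintype.lift i).

(* A functional on vertex tuples stands for a cochain on affine simplices; [sd phi]
   is its value on the barycentric subdivision and [sdh] the chain homotopy from
   the identity, both obtained by coning from the barycenter. *)
Fixpoint sd n : (('I_n.+1 -> P) -> R) -> ('I_n.+1 -> P) -> R :=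
  match n with
  | 0 => id
  | n'.+1 => fun phi v =>
      dcoch (sd (fun w => phi (cons_vertex (bary v) w))) v
  end.

Fixpoint sdh n : (('I_n.+2 -> P) -> R) -> ('I_n.+1 -> P) -> R :=
  match n with
  | 0 => fun _ _ => 0
  | n'.+1 => fun phi v =>
      phi (cons_vertex (bary v) v) -
      dcoch (sdh (fun w => phi (cons_vertex (bary v) w))) v
  end.

Lemma cons_vertex0 n b (v : 'I_n -> P) : cons_vertex b v \o fintype.lift ord0 = v.
Proof. by apply/funext => i; rewrite /cons_vertex /= liftK. Qed.

Lemma cons_vertexS n b (v : 'I_n.+1 -> P) (i : 'I_n.+1) :
  cons_vertex b v \o fintype.lift (fintype.lift ord0 i) = cons_vertex b (v \o fintype.lift i).
Proof.
apply/funext => j; rewrite /cons_vertex /=.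
case: (unliftP ord0 j) => [k ->|->] /=.
  have -> : fintype.lift (fintype.lift ord0 i) (fintype.lift ord0 k) =
    fintype.lift ord0 (fintype.lift i k).
    by apply/val_inj; rewrite /= /bump /= !add1n ltnS; case: (leqP i k).
  by rewrite liftK.
have -> : fintype.lift (fintype.lift ord0 i) ord0 = ord0 by apply: val_inj.
by rewrite unlift_none.
Qed.

(** Dual of the cone formula ∂(b v) = v - b ∂v. *)
Lemma dcoch_cons n (phi : ('I_n.+1 -> P) -> R) b v :
  dcoch phi (cons_vertex b v) =
  phi v - dcoch (fun w => phi (cons_vertex b w)) v.
Proof.
rewrite /dcoch big_ord_recl expr0 mul1r cons_vertex0; congr (_ + _).
rewrite -sumrN; apply: eq_bigr => i _.
by rewrite cons_vertexS exprS mulN1r mulNr.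
Qed.

Lemma eq_dcoch n (phi psi : ('I_n -> P) -> R) :
  phi =1 psi -> dcoch phi =1 dcoch psi.
Proof. by move=> e v; apply: eq_bigr => i _; rewrite e. Qed.

Lemma dcochB n (phi psi : ('I_n -> P) -> R) v :
  dcoch (fun w => phi w - psi w) v = dcoch phi v - dcoch psi v.
Proof. by rewrite /dcoch -sumrB; apply: eq_bigr => i _; rewrite mulrBr. Qed.

Lemma dcoch_dcoch n (phi : ('I_n -> P) -> R) v : dcoch (dcoch phi) v = 0.
Proof.
rewrite /dcoch; under eq_bigr do rewrite mulr_sumr.
rewrite pair_big /=.
pose F (u : 'I_n.+2 * 'I_n.+1) : R := (-1) ^+ u.1 * ((-1) ^+ u.2 * phi ((v \o fintype.lift u.1)
  \o fintype.lift u.2)).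
rewrite -/(\sum_u F u) (bigID (fun u : 'I_n.+2 * 'I_n.+1 => (u.1 <= u.2)%N)) /=.
(* Simplicial identity: deleting i and then j with i <= j is the same as deleting j + 1 and then i,
   and the two terms carry opposite signs. *)
pose h (u : 'I_n.+2 * 'I_n.+1) : 'I_n.+2 * 'I_n.+1 := (fintype.lift ord0 u.2, inord u.1).
pose h' (u : 'I_n.+2 * 'I_n.+1) : 'I_n.+2 * 'I_n.+1 := (inord u.2, inord u.1.-1).
rewrite [X in _ + X](reindex_onto h h') /=; last first.
  case=> i j /=; rewrite -ltnNge => ij; rewrite /h /h'; congr pair; apply/val_inj => /=.
    by rewrite inordK; have := ltn_ord i; rewrite /bump; lia.
  by rewrite !inordK //; have := ltn_ord j; lia.
rewrite [X in _ + X](eq_bigl (fun u : 'I_n.+2 * 'I_n.+1 => (u.1 <= u.2)%N)); last first.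
  case=> i j /=; rewrite /h /h' /=; have := ltn_ord i; have := ltn_ord j => hj hi.
 rewrite xpair_eqE -!val_eqE /=.
  case: (leqP i j) => ij.
    rewrite !inordK /=; rewrite /bump; try lia.
  case: (ltnP i n.+1) => hin.
    by rewrite [(inord i : 'I_n.+1) : nat]inordK // /bump /= add1n ij.
  have hk := ltn_ord (inord i : 'I_n.+1).
  rewrite [(inord (inord i : 'I_n.+1) : 'I_n.+2) : nat]inordK; last by lia.
  by rewrite [_ == (i : nat)]ltn_eqF ?andbF //; lia.
rewrite -big_split big1 //= => -[i j] /= ij.
rewrite /F /h /=; have := ltn_ord i; have := ltn_ord j => hj hi.
have -> : (v \o fintype.lift (fintype.lift ord0 j)) \o fintype.lift (inord i : 'I_n.+1) =
  (v \o fintype.lift i) \o fintype.lift j.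
  apply/funext => k /=; congr v; apply/val_inj; rewrite /= inordK; last by lia.
  by rewrite /bump; lia.
rewrite inordK /=; last by lia.
by rewrite /bump /= exprD expr1; ring.
Qed.

Lemma sdhB n (phi psi : ('I_n.+2 -> P) -> R) v :
  sdh (fun w => phi w - psi w) v = sdh phi v - sdh psi v.
Proof.
elim: n phi psi v => [|n IHn] phi psi v /=; first by rewrite subrr.
rewrite (eq_dcoch (fun w => IHn _ _ w)) dcochB; ring.
Qed.

(** Dual of the classical ∂T + T∂ = 1 - S. The cone formula reduces the claim to the cochain [phib],
    whose first vertex is frozen at the barycenter; the induction hypothesis applies to it on each
    face, and a double coboundary drops out. *)
Lemma sd_homotopy n (phi : ('I_n.+2 -> P) -> R) v :
  phi v - sd phi v = sdh (dcoch phi) v + dcoch (sdh phi) v.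
Proof.
elim: n phi v => [|n IHn] phi v.
  rewrite [sdh (dcoch phi) v]/= dcoch_cons /=.
  rewrite /dcoch !big_ord_recl !big_ord0 /=; ring.
rewrite [sdh _ v]/= dcoch_cons [sd _ _]/=.
set b := bary v; pose phib w := phi (cons_vertex b w).
have -> : dcoch (sdh (fun w => dcoch phi (cons_vertex b w))) v =
    dcoch (sdh phi) v - dcoch (sdh (dcoch phib)) v.
  rewrite -dcochB; apply: eq_dcoch => w.
  by rewrite -sdhB; congr sdh; apply/funext => u; rewrite dcoch_cons.
have -> : dcoch (sdh (dcoch phib)) v = dcoch phib v - dcoch (sd phib) v - dcoch (dcoch (sdh
  phib)) v.
  rewrite -!dcochB; apply: eq_dcoch => w.
  by have := IHn phib w => /eqP; rewrite subr_eq => /eqP {1}->; ring.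
rewrite dcoch_dcoch -/phib; ring.
Qed.

Lemma sdh0 n v : sdh (fun _ : 'I_n.+2 -> P => 0) v = 0.
Proof.
elim: n v => [//|n IHn] v /=; rewrite sub0r /dcoch big1 ?oppr0 // => i _.
by rewrite IHn mulr0.
Qed.

(** A formal consequence of the homotopy: dφ - sd dφ and dφ - d sd φ both equal d sdh dφ. Degree 0
    is separate because the homotopy formula starts in degree 1. *)
Lemma sd_dcoch n (phi : ('I_n.+1 -> P) -> R) v : sd (dcoch phi) v = dcoch (sd phi) v.
Proof.
have e : sdh (dcoch (dcoch phi)) v = 0.
  by rewrite (_ : dcoch _ = fun=> 0) ?sdh0 //; apply/funext => w; exact: dcoch_dcoch.
have E := sd_homotopy (dcoch phi) v; rewrite e add0r in E.
rewrite -[LHS](subKr (dcoch phi v)) E -[RHS](subKr (dcoch phi v)); congr (_ - _).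
rewrite -dcochB; case: n phi v {e E} => [|n] phi v.
  by rewrite /dcoch big1 ?big1 // => i _; rewrite /= ?subrr mulr0.
rewrite -[RHS]subr0 -(dcoch_dcoch (sdh phi) v) -dcochB.
by apply: eq_dcoch => w; rewrite sd_homotopy addrK.
Qed.

Section Locality.
Variable S : zmodClosed R.

(** Stands in for convexity: the vertices of the subdivision of a simplex with vertices in [C] stay
    in [C]. *)
Definition bary_closed (C : P -> Prop) :=
  forall n (v : 'I_n.+1 -> P), (forall i, C (v i)) -> C (bary v).

Lemma signr_closed k x : x \in S -> (-1) ^+ k * x \in S.
Proof.
move=> xS; rewrite -signr_odd; case: (odd k); last by rewrite expr0 mul1r.
by rewrite expr1 mulN1r rpredN.
Qed.

Lemma dcoch_closed n (phi : ('I_n -> P) -> R) (v : 'I_n.+1 -> P) :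
  (forall i, phi (v \o fintype.lift i) \in S) -> dcoch phi v \in S.
Proof. by move=> H; apply: rpred_sum => i _; exact: signr_closed. Qed.

Lemma cons_vertexP (C : P -> Prop) n b (v : 'I_n -> P) :
  C b -> (forall i, C (v i)) -> forall i, C (cons_vertex b v i).
Proof. by move=> Cb Cv i; rewrite /cons_vertex; case: (unlift _ _) => [j|] /=. Qed.

Lemma sd_closed (C : P -> Prop) n (phi : ('I_n.+1 -> P) -> R) v :
  bary_closed C -> (forall i, C (v i)) ->
  (forall w, (forall i, C (w i)) -> phi w \in S) -> sd phi v \in S.
Proof.
move=> clC; elim: n phi v => [|n IHn] phi v Cv Cphi /=; first exact: Cphi.
apply: dcoch_closed => i; apply: IHn => [j|w Cw]; first exact: Cv.
by apply: Cphi; apply: cons_vertexP => //; exact: clC.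
Qed.

Lemma sdh_closed (C : P -> Prop) n (phi : ('I_n.+2 -> P) -> R) v :
  bary_closed C -> (forall i, C (v i)) ->
  (forall w, (forall i, C (w i)) -> phi w \in S) -> sdh phi v \in S.
Proof.
move=> clC; elim: n phi v => [|n IHn] phi v Cv Cphi /=; first exact: rpred0.
have Cb := clC _ _ Cv.
apply: rpredB; first by apply: Cphi; exact: cons_vertexP.
apply: dcoch_closed => i; apply: IHn => [j|w Cw]; first exact: Cv.
by apply: Cphi; exact: cons_vertexP.
Qed.

Variables (F : realFieldType) (d : P -> P -> F).
Hypotheses (dxx : forall x, d x x = 0) (dC : forall x y, d x y = d y x).
Hypothesis ball_bary : forall c r, bary_closed (fun x => d x c <= r).
Hypothesis dist_bary : forall n (v : 'I_n.+1 -> P) r,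
  (forall i j, d (v i) (v j) <= r) ->
  forall i, d (bary v) (v i) <= n%:R / n.+1%:R * r.

(** A simplex of the subdivision is a cone from the barycenter over a simplex of a subdivided face.
    Faces have the smaller contraction ratio, so the only new distances to control are those to the
    barycenter. *)
Lemma sd_mesh (C : P -> Prop) n (phi : ('I_n.+1 -> P) -> R) v r :
  bary_closed C -> (forall i, C (v i)) -> (forall i j, d (v i) (v j) <= r) ->
  (forall w, (forall i, C (w i)) ->
     (forall i j, d (w i) (w j) <= n%:R / n.+1%:R * r) -> phi w \in S) ->
  sd phi v \in S.
Proof.
elim: n C phi v => [|n IHn] C phi v clC Cv dv Cphi /=.
  by apply: Cphi => // i j; rewrite !ord1 dxx mul0r mul0r.
have r0 : 0 <= r by rewrite -(dxx (v ord0)).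
set b := bary v; have db := dist_bary dv.
apply: dcoch_closed => i.
(* The invariant set is intersected with a ball around the barycenter, so that the induction on the
   face remembers the distance to the apex. *)
apply: (IHn (fun x => C x /\ d x b <= n.+1%:R / n.+2%:R * r)).
- move=> m w Cw; split; first by apply: clC => k; case: (Cw k).
  by apply: ball_bary => k; case: (Cw k).
- by move=> j /=; split; [exact: Cv | rewrite dC; exact: db].
- by move=> j k; exact: dv.
move=> w Cw dw; apply: Cphi.
  by apply: cons_vertexP; [exact: clC | move=> k; case: (Cw k)].
have ratio : n%:R / n.+1%:R <= n.+1%:R / n.+2%:R :> F.
  rewrite ler_pdivrMr ?ltr0n // mulrAC ler_pdivlMr ?ltr0n // -!natrM ler_nat; lia.
move=> j k; rewrite /cons_vertex; case: (unlift _ j) => [j'|]; case: (unlift _ k) => [k'|] /=.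
- by apply: (le_trans (dw _ _)); exact: ler_wpM2r.
- by case: (Cw j').
- by rewrite dC; case: (Cw k').
- by rewrite dxx mulr_ge0 // divr_ge0.
Qed.

Lemma iter_sd_mesh n N (phi : ('I_n.+1 -> P) -> R) v r :
  (forall i j, d (v i) (v j) <= r) ->
  (forall w, (forall i j, d (w i) (w j) <= (n%:R / n.+1%:R) ^+ N * r) ->
     phi w \in S) ->
  iter N (@sd n) phi v \in S.
Proof.
elim: N v r => [|N IHN] v r dv Sphi /=; first by apply: Sphi => i j; rewrite mul1r.
apply: (@sd_mesh (fun=> True)) dv _ => // w _ dw; apply: IHN dw _ => u du.
by apply: Sphi => i j; rewrite exprSr -mulrA.
Qed.

End Locality.
End Subdivision.

Section Naturality.
Variables (R : comRingType) (P Q : Type).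
Variables (baryP : forall n, ('I_n.+1 -> P) -> P).
Variables (baryQ : forall n, ('I_n.+1 -> Q) -> Q).
Variable f : P -> Q.
Hypothesis f_bary : forall n (v : 'I_n.+1 -> P), f (baryP v) = baryQ (f \o v).

Lemma comp_cons_vertex n b (v : 'I_n -> P) :
  f \o cons_vertex b v = cons_vertex (f b) (f \o v).
Proof. by apply/funext => i; rewrite /cons_vertex /=; case: (unlift _ _). Qed.

(** Used with the affine maps [comb v]: the subdivision of a subsimplex can then be computed inside
    the ambient simplex. *)
Lemma sd_comp n (phi : ('I_n.+1 -> Q) -> R) v :
  sd baryQ phi (f \o v) = sd baryP (fun w => phi (f \o w)) v.
Proof.
elim: n phi v => [//|n IHn] phi v /=; rewrite /dcoch; apply: eq_bigr => i _.
rewrite (IHn _ (v \o fintype.lift i)) -f_bary; congr (_ * sd _ _ _).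
by apply/funext => w; rewrite comp_cons_vertex.
Qed.

Lemma sdh_comp n (phi : ('I_n.+2 -> Q) -> R) v :
  sdh baryQ phi (f \o v) = sdh baryP (fun w => phi (f \o w)) v.
Proof.
elim: n phi v => [//|n IHn] phi v /=; rewrite comp_cons_vertex -f_bary; congr (_ - _).
rewrite /dcoch; apply: eq_bigr => i _.
rewrite (IHn _ (v \o fintype.lift i)); congr (_ * sdh _ _ _).
by apply/funext => w; rewrite comp_cons_vertex.
Qed.

End Naturality.

(** * Affine simplices inside the standard simplex *)

Section Combinations.
Variable R : realType.
Local Notation Delta := (std_simplex R).

Lemma simplex_ge0 n (t : Delta n) i : 0 <= val t 0 i.
Proof. by have [] := set_mem (valP t). Qed.

Lemma simplex_sum1 n (t : Delta n) : \sum_i val t 0 i = 1.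
Proof. by have [] := set_mem (valP t). Qed.

Lemma combP m n (v : 'I_n.+1 -> Delta m) (t : Delta n) :
  \sum_i val t 0 i *: val (v i) \in std_simplex R m.
Proof.
apply/mem_set; split => [j|].
  rewrite summxE; apply: sumr_ge0 => i _; rewrite mxE.
  by apply: mulr_ge0; exact: simplex_ge0.
under eq_bigr do rewrite summxE.
rewrite exchange_big /= -[RHS](simplex_sum1 t); apply: eq_bigr => i _.
by under eq_bigr do rewrite mxE; rewrite -mulr_sumr simplex_sum1 mulr1.
Qed.

Definition comb m n (v : 'I_n.+1 -> Delta m) (t : Delta n) : Delta m :=
  exist (fun x => x \in std_simplex R m) _ (combP v t).

Lemma val_comb m n (v : 'I_n.+1 -> Delta m) t j :
  val (comb v t) 0 j = \sum_i val t 0 i * val (v i) 0 j.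
Proof. by rewrite summxE; apply: eq_bigr => i _; rewrite mxE. Qed.

Lemma simplex_eq n (s t : Delta n) : (forall i, val s 0 i = val t 0 i) -> s = t.
Proof. by move=> e; apply/val_inj/rowP. Qed.

Lemma row_continuous (T : topologicalType) n (f : T -> 'rV[R]_n.+1) :
  (forall j, continuous (fun t => f t 0 j)) -> continuous f.
Proof.
move=> cf t U [Q /= tQ QU].
have FF : Filter (nbhs t) := @nbhs_filter T t.
have near_coord j : \forall s \near t, Q 0 j (f s 0 j) by exact: (cf j t _ (tQ 0 j)).
have /filter_forall := near_coord; apply: filterS => s sQ.
by apply: QU => i j; rewrite ord1; exact: sQ.
Qed.

Lemma sum_continuous (T : topologicalType) (I : Type) (r : seq I) (f : I -> T -> R) :
  (forall i, continuous (f i)) -> continuous (fun t => \sum_(i <- r) f i t).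
Proof.
move=> cf; apply: continuous_big => // x; exact: add_continuous.
Qed.

Lemma coord_simplex_continuous n i : continuous (fun t : Delta n => val t 0 i).
Proof.
move=> t; apply: (@continuous_comp _ _ _ (val : Delta n -> _) (fun s : 'rV[R]_n.+1 => s 0 i)).
  exact: initial_continuous.
exact: coord_continuous.
Qed.

Lemma to_simplex_continuous (T : topologicalType) n (f : T -> Delta n) :
  (forall j, continuous (fun t => val (f t) 0 j)) -> continuous f.
Proof. by move=> cf; apply: continuous_comp_initial; exact: row_continuous. Qed.

Lemma comb_continuous m n (v : 'I_n.+1 -> Delta m) : continuous (comb v).
Proof.
apply: to_simplex_continuous => j.
under eq_fun do rewrite val_comb.
apply: sum_continuous => i t.
by apply: continuousM; [exact: (@coord_simplex_continuous n i t) | exact: cst_continuous].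
Qed.

HB.instance Definition _ m n (v : 'I_n.+1 -> Delta m) :=
  isContinuous.Build (Delta n) (Delta m) (comb v) (@comb_continuous m n v).

Lemma vertP n (i : 'I_n.+1) : delta_mx 0 i \in std_simplex R n.
Proof.
apply/mem_set; split => [j|]; first by rewrite mxE ler0n.
rewrite (bigD1 i) //= mxE !eqxx big1 ?addr0 // => j ji.
by rewrite mxE (negbTE ji) andbF.
Qed.

Definition vert n (i : 'I_n.+1) : Delta n :=
  exist (fun x => x \in std_simplex R n) _ (vertP i).

Lemma val_vert n (i j : 'I_n.+1) : val (vert i) 0 j = (i == j)%:R.
Proof. by rewrite mxE eqxx eq_sym. Qed.

Lemma comb_vert m n (v : 'I_n.+1 -> Delta m) i : comb v (vert i) = v i.
Proof.
apply: simplex_eq => j; rewrite val_comb (bigD1 i) //= val_vert eqxx mul1r.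
by rewrite big1 ?addr0 // => k ki; rewrite val_vert eq_sym (negbTE ki) mul0r.
Qed.

Lemma comb_comb m n k (v : 'I_n.+1 -> Delta m) (w : 'I_k.+1 -> Delta n) t :
  comb v (comb w t) = comb (comb v \o w) t.
Proof.
apply: simplex_eq => j; rewrite !val_comb.
under eq_bigr do rewrite val_comb mulr_suml.
rewrite exchange_big /=; apply: eq_bigr => i _.
by rewrite val_comb mulr_sumr; apply: eq_bigr => l _; rewrite mulrA.
Qed.

Lemma comb_vertE n (t : Delta n) : comb (@vert n) t = t.
Proof.
apply: simplex_eq => j; rewrite val_comb (bigD1 j) //= val_vert eqxx mulr1.
by rewrite big1 ?addr0 // => k ki; rewrite val_vert (negbTE ki) mulr0.
Qed.

Lemma affine_mapE m n (f : 'I_m.+1 -> 'I_n.+1) t : affine_map f t = comb (@vert n \o f) t.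
Proof.
apply: simplex_eq => j; rewrite val_comb /= mxE big_mkcond; apply: eq_bigr => i _.
by rewrite val_vert; case: eqP; rewrite ?mulr1 ?mulr0.
Qed.

Lemma comb_affine m n k (v : 'I_n.+1 -> Delta m) (f : 'I_k.+1 -> 'I_n.+1) t :
  comb v (affine_map f t) = comb (v \o f) t.
Proof.
rewrite affine_mapE comb_comb; congr (comb _ t).
by apply/funext => i /=; rewrite comb_vert.
Qed.

Lemma centerP n : const_mx (n.+1%:R^-1) \in std_simplex R n.
Proof.
apply/mem_set; split => [j|]; first by rewrite mxE invr_ge0 ler0n.
under eq_bigr do rewrite mxE.
by rewrite sumr_const card_ord -[_ *+ _]mulr_natr mulVf // pnatr_eq0.
Qed.

Definition center n : Delta n :=
  exist (fun x => x \in std_simplex R n) _ (centerP n).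

Definition bary m n (v : 'I_n.+1 -> Delta m) : Delta m := comb v (center n).

Lemma comb_bary m n k (v : 'I_n.+1 -> Delta m) (w : 'I_k.+1 -> Delta n) :
  comb v (bary w) = bary (comb v \o w).
Proof. exact: comb_comb. Qed.

Definition dist n (x y : Delta n) : R := `|val x - val y|.

Lemma row_norm_le n (x : 'rV[R]_n) r :
  0 <= r -> (`|x| <= r) <-> forall i, `|x 0 i| <= r.
Proof.
move=> r0; rewrite {1}/Num.Def.normr /= mx_normrE; split.
  by move=> /bigmax_leP[_ H] i; exact: (H (0, i)).
by move=> H; apply/bigmax_leP; split => // -[i j] _ /=; rewrite ord1.
Qed.

Lemma distE n (x y : Delta n) r :
  0 <= r -> (dist x y <= r) <-> forall i, `|val x 0 i - val y 0 i| <= r.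
Proof.
move=> r0; rewrite /dist row_norm_le //.
by split => H i; have := H i; rewrite !mxE.
Qed.

Lemma distxx n (x : Delta n) : dist x x = 0.
Proof. by rewrite /dist subrr normr0. Qed.

Lemma distC n (x y : Delta n) : dist x y = dist y x.
Proof. by rewrite /dist distrC. Qed.

Lemma dist_ge0 n (x y : Delta n) : 0 <= dist x y.
Proof. exact: normr_ge0. Qed.

Lemma comb_ball m n (v : 'I_n.+1 -> Delta m) t c r :
  (forall i, dist (v i) c <= r) -> dist (comb v t) c <= r.
Proof.
move=> dv; have r0 : 0 <= r by exact: le_trans (dist_ge0 _ _) (dv ord0).
apply/distE => // j; rewrite val_comb.
rewrite -[val c 0 j]mul1r -(simplex_sum1 t) mulr_suml -sumrB.
apply: (le_trans (ler_norm_sum _ _ _)).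
rewrite -[leRHS]mul1r -(simplex_sum1 t) mulr_suml; apply: ler_sum => i _.
rewrite -mulrBr normrM ger0_norm ?simplex_ge0 //; apply: ler_wpM2l; first exact: simplex_ge0.
by have /distE := dv i; apply.
Qed.

(** Of the n + 1 equally weighted differences, the one with [v i] itself vanishes; n terms of weight
    1 / (n + 1) remain. *)
Lemma bary_dist m n (v : 'I_n.+1 -> Delta m) r :
  (forall i j, dist (v i) (v j) <= r) ->
  forall i, dist (bary v) (v i) <= n%:R / n.+1%:R * r.
Proof.
move=> dv i; have r0 : 0 <= r by exact: le_trans (dist_ge0 _ _) (dv ord0 ord0).
apply/distE => [|j]; first by rewrite mulr_ge0 // divr_ge0.
set e := _ / _ * r; rewrite /bary val_comb.
rewrite -[val (v i) 0 j]mul1r -(simplex_sum1 (center n)) mulr_suml -sumrB.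
rewrite (bigD1 i) //= subrr add0r.
apply: (le_trans (ler_norm_sum _ _ _)).
have -> : e = \sum_(k < n.+1 | k != i) (n.+1%:R^-1 * r).
  by rewrite sumr_const cardC1 card_ord -[RHS]mulr_natl mulrA.
apply: ler_sum => k ki.
rewrite mxE -mulrBr normrM ger0_norm ?invr_ge0 ?ler0n //; apply: ler_wpM2l;
  first by rewrite invr_ge0.
by have /distE := dv k i; apply.
Qed.

End Combinations.

(** * Subdivision of singular cochains *)

Section Cochains.
Variables (R : realType) (X : topologicalType).
Local Notation Delta := (std_simplex R).
Local Notation cochain n := (simplex R n X -> R).

Definition cob n (phi : cochain n) (s : simplex R n.+1 X) : R :=
  \sum_(i < n.+2) (-1) ^+ i * phi (face i s).

Definition sub_simplex n k (s : simplex R n X) (v : 'I_k.+1 -> Delta n) : simplex R k X :=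
  s \o comb v.

(** Turns a singular cochain into a functional on vertex tuples: a tuple stands for the affine
    simplex it spans in the domain of [s], followed by [s]. *)
Definition along n k (s : simplex R n X) (phi : cochain k) (v : 'I_k.+1 -> Delta n) : R :=
  phi (sub_simplex s v).

Lemma simplexP n (s t : simplex R n X) : (forall x, s x = t x) -> s = t.
Proof. by move=> e; apply/continuousEP. Qed.

Lemma restrict_sub n k l (s : simplex R n X) (v : 'I_k.+1 -> Delta n) (f : 'I_l.+1 -> 'I_k.+1) :
  restrict f (sub_simplex s v) = sub_simplex s (v \o f).
Proof. by apply: simplexP => t /=; rewrite comb_affine. Qed.

Lemma sub_vert n (s : simplex R n X) : sub_simplex s (@vert R n) = s.
Proof. by apply: simplexP => t /=; rewrite comb_vertE. Qed.

Lemma restrictE n k (s : simplex R n X) (f : 'I_k.+1 -> 'I_n.+1) :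
  restrict f s = sub_simplex s (@vert R n \o f).
Proof. by rewrite -{1}(sub_vert s) restrict_sub. Qed.

Lemma sub_sub n k l (s : simplex R n X) (v : 'I_k.+1 -> Delta n) (w : 'I_l.+1 -> Delta k) :
  sub_simplex (sub_simplex s v) w = sub_simplex s (comb v \o w).
Proof. by apply: simplexP => t /=; rewrite comb_comb. Qed.

Lemma along_cob n k (s : simplex R n X) (phi : cochain k) v :
  along s (cob phi) v = dcoch (along s phi) v.
Proof. by rewrite /along /cob /dcoch; apply: eq_bigr => i _; rewrite /face restrict_sub. Qed.

Definition sdX n (phi : cochain n) (s : simplex R n X) : R :=
  sd (@bary R n) (along s phi) (@vert R n).

Definition sdhX n (phi : cochain n.+1) (s : simplex R n X) : R :=
  sdh (@bary R n) (along s phi) (@vert R n).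

Lemma along_along n k l (s : simplex R n X) (phi : cochain l) (v : 'I_k.+1 -> Delta n) w :
  along (sub_simplex s v) phi w = along s phi (comb v \o w).
Proof. by rewrite /along sub_sub. Qed.

Lemma comb_comp_vert n k (v : 'I_k.+1 -> Delta n) : comb v \o @vert R k = v.
Proof. by apply/funext => i; exact: comb_vert. Qed.

Lemma along_sdX n k (s : simplex R n X) (phi : cochain k) v :
  along s (sdX phi) v = sd (@bary R n) (along s phi) v.
Proof.
rewrite -[in RHS](comb_comp_vert v) (sd_comp (baryP := @bary R k)) /along /sdX.
  by congr sd; apply/funext => w; exact: along_along.
by move=> m w; exact: comb_bary.
Qed.

Lemma along_sdhX n k (s : simplex R n X) (phi : cochain k.+1) v :
  along s (sdhX phi) v = sdh (@bary R n) (along s phi) v.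
Proof.
rewrite -[in RHS](comb_comp_vert v) (sdh_comp (baryP := @bary R k)) /along /sdhX.
  by congr sdh; apply/funext => w; exact: along_along.
by move=> m w; exact: comb_bary.
Qed.

Lemma along_iter n k N (s : simplex R n X) (phi : cochain k) v :
  along s (iter N (@sdX k) phi) v = iter N (@sd _ _ (@bary R n) k) (along s phi) v.
Proof.
elim: N v => [//|N IHN] v /=; rewrite along_sdX; congr sd.
by apply/funext => w; exact: IHN.
Qed.

Lemma sdX_homotopy n (phi : cochain n.+1) s :
  phi s - sdX phi s = sdhX (cob phi) s + cob (sdhX phi) s.
Proof.
have -> : cob (sdhX phi) s = along s (cob (sdhX phi)) (@vert R _) by rewrite /along sub_vert.
rewrite along_cob (eq_dcoch (along_sdhX s phi)).
have -> : sdhX (cob phi) s = sdh (@bary R _) (dcoch (along s phi)) (@vert R _).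
  by congr sdh; apply/funext => v; exact: along_cob.
by rewrite -sd_homotopy /sdX [along s phi (@vert R _)]/along sub_vert.
Qed.

Lemma cob_sdX n (phi : cochain n) s : cob (sdX phi) s = sdX (cob phi) s.
Proof.
have -> : cob (sdX phi) s = along s (cob (sdX phi)) (@vert R _) by rewrite /along sub_vert.
rewrite along_cob (eq_dcoch (along_sdX s phi)) -sd_dcoch /sdX; congr sd.
by apply/funext => w; rewrite along_cob.
Qed.

Lemma cob_cob n (phi : cochain n) s : cob (cob phi) s = 0.
Proof.
have -> : cob (cob phi) s = along s (cob (cob phi)) (@vert R _) by rewrite /along sub_vert.
by rewrite along_cob (eq_dcoch (along_cob s phi)) dcoch_dcoch.
Qed.

Lemma cob_iter n N (phi : cochain n) : cob (iter N (@sdX n) phi) = iter N (@sdX n.+1) (cob phi).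
Proof.
elim: N => [//|N IHN]; apply/funext => s /=.
by rewrite cob_sdX IHN.
Qed.

Local Notation int_val := (@Num.int R).

Lemma cob_int n (phi : cochain n) s : (forall i, phi (face i s) \is a Num.int) ->
  cob phi s \is a Num.int.
Proof. by move=> H; apply: rpred_sum => i _; apply: signr_closed. Qed.

Definition within_simplex n k (s : simplex R n X) (t : simplex R k X) : Prop :=
  exists v, t = sub_simplex s v.

Lemma sdX_int n (phi : cochain n) s :
  (forall t, within_simplex s t -> phi t \is a Num.int) -> sdX phi s \is a Num.int.
Proof.
move=> H; apply: (@sd_closed _ _ (@bary R n) _ (fun=> True)) => // w _.
by apply: H; exists w.
Qed.

Lemma sdhX_int n (phi : cochain n.+1) s :
  (forall t, within_simplex s t -> phi t \is a Num.int) -> sdhX phi s \is a Num.int.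
Proof.
move=> H; apply: (@sdh_closed _ _ (@bary R n) _ (fun=> True)) => // w _.
by apply: H; exists w.
Qed.

Lemma within_trans n k l (s : simplex R n X) (t : simplex R k X) (u : simplex R l X) :
  within_simplex s t -> within_simplex t u -> within_simplex s u.
Proof. by move=> [v ->] [w ->]; rewrite sub_sub; exists (comb v \o w). Qed.

Lemma iter_sdX_int n N (phi : cochain n) s :
  (forall t, within_simplex s t -> phi t \is a Num.int) ->
  iter N (@sdX n) phi s \is a Num.int.
Proof.
elim: N s => [|N IHN] s H /=.
  by apply: H; exists (@vert R n); rewrite sub_vert.
by apply: sdX_int => t st; apply: IHN => u tu; apply: H; exact: within_trans st tu.
Qed.

Lemma within_range n k (s : simplex R n X) (t : simplex R k X) :
  within_simplex s t -> range t `<=` range s.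
Proof. by move=> [v ->] _ [x _ <-] /=; exists (comb v x). Qed.

Lemma within_face n (s : simplex R n.+1 X) i : within_simplex s (face i s).
Proof. by rewrite /face restrictE; eexists. Qed.

Lemma within_restrict n k (s : simplex R n X) (f : 'I_k.+1 ->
  'I_n.+1) : within_simplex s (restrict f s).
Proof. by rewrite restrictE; eexists. Qed.

End Cochains.

Section Evaluation.
Variables (R : realType) (X : topologicalType).
Local Notation Delta := (std_simplex R).
Local Notation cochain n := (simplex R n X -> R).

Definition ev n (phi : cochain n) (z : chain R n X) : R :=
  fglift (phi : _ -> zmodule R) z.

Lemma ev_zmod_morphism n (phi : cochain n) : zmod_morphism (ev phi).
Proof. exact: (lift_is_additive (phi : _ -> zmodule R)). Qed.

HB.instance Definition _ n (phi : cochain n) :=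
  GRing.isZmodMorphism.Build (chain R n X) R (ev phi) (ev_zmod_morphism phi).

Lemma boundary_zmod_morphism n : zmod_morphism (@boundary R X n).
Proof. exact: lift_is_additive. Qed.

HB.instance Definition _ n :=
  GRing.isZmodMorphism.Build (chain R n.+1 X) (chain R n X) (@boundary R X n)
    (@boundary_zmod_morphism n).

Lemma evU n (phi : cochain n) s : ev phi << s >> = phi s.
Proof. by rewrite /ev liftU. Qed.

Lemma chain_sumE n (z : chain R n X) : z = \sum_(s <- dom z) << s >> *~ coeff s z.
Proof.
rewrite -{1}(freeg_sumE z); apply: eq_bigr => s _.
by rewrite freegU_mulz intz.
Qed.

Lemma evE n (phi : cochain n) z : ev phi z = \sum_(s <- dom z) phi s *~ coeff s z.
Proof.
rewrite {1}(chain_sumE z) raddf_sum; apply: eq_bigr => s _.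
by rewrite raddfMz /= evU.
Qed.

Lemma boundaryU n (s : simplex R n.+1 X) :
  boundary << s >> = \sum_(i < n.+2) (-1) ^+ i *: << face i s >>.
Proof. by rewrite /boundary liftU scale1r. Qed.

Lemma ev_boundary n (phi : cochain n) (z : chain R n.+1 X) :
  ev phi (boundary z) = ev (cob phi) z.
Proof.
rewrite {1}(chain_sumE z) [RHS]evE !raddf_sum; apply: eq_bigr => s _.
rewrite !raddfMz /= boundaryU raddf_sum; congr (_ *~ _).
rewrite /cob; apply: eq_bigr => i _; rewrite -signr_odd -[in RHS]signr_odd.
case: (odd i) => /=.
  by rewrite !expr1 scaleN1r mulN1r raddfN /= evU.
by rewrite !expr0 scale1r mul1r evU.
Qed.

Lemma ev_int n (phi : cochain n) z :
  (forall s, s \in dom z -> phi s \is a Num.int) -> ev phi z \is a Num.int.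
Proof.
move=> H; rewrite evE big_seq; apply: rpred_sum => s sz.
by rewrite rpredMz // H.
Qed.

Lemma ev_cochainB n (phi psi : cochain n) z :
  ev (fun s => phi s - psi s) z = ev phi z - ev psi z.
Proof. by rewrite !evE -sumrB; apply: eq_bigr => s _; rewrite mulrzBl. Qed.

End Evaluation.

(** * Small simplices, excision and extension of cocycles *)

Section Smallness.
Variables (R : realType) (X : topologicalType).
Local Notation Delta := (std_simplex R).
Local Notation cochain n := (simplex R n X -> R).

Lemma std_simplex_compact n : compact (std_simplex R n).
Proof.
apply: bounded_closed_compact.
  exists 1; split=> // M M1 t [t0 t1] /=.
  apply/row_norm_le => [|i]; first by lra.
  rewrite ger0_norm //; apply: le_trans (ltW M1).
  by rewrite -t1 (bigD1 i) //= lerDl sumr_ge0.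
have -> : std_simplex R n =
    \bigcap_(i in [set: 'I_n.+1]) [set t : 'rV[R]_n.+1 | 0 <= t 0 i] `&`
    [set t : 'rV[R]_n.+1 | \sum_i t 0 i = 1].
  apply/seteqP; split => t [t0 t1]; split => //; first by move=> i _; exact: t0.
  by move=> i; exact: t0.
apply: closedI.
  apply: closed_bigI => i _.
  have /continuous_closedP cl : continuous (fun t : 'rV[R]_n.+1 => t 0 i).
    exact: coord_continuous.
  exact: cl (@closed_ge R 0).
have /continuous_closedP cl : continuous (fun t : 'rV[R]_n.+1 => \sum_i t 0 i).
  by apply: sum_continuous => i; exact: coord_continuous.
exact: cl (@closed_eq R 1).
Qed.

(** A Lebesgue number for a cover described by a predicate on sets, so that it serves for open
    covers and equally for local properties such as local constancy. Compactness enters as the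
    near-covering property, with half radii for the triangle inequality. *)
Lemma lebesgue_family n (G : set (Delta n) -> Prop) :
  (forall x : Delta n, exists2 U, nbhs x U & G U) ->
  exists2 e : R, 0 < e & forall x : Delta n,
    exists2 U, G U & forall y, dist x y < e -> U y.
Proof.
move=> GU.
pose P e (x : 'rV[R]_n.+1) := forall x' : Delta n, val x' = x ->
  exists2 U, G U & forall y, dist x' y < e -> U y.
have /compact_near_coveringP cov := @std_simplex_compact n.
have : \forall e \near 0^'+, std_simplex R n `<=` P e.
  apply: cov => x Kx.
  pose x' : Delta n := exist _ x (mem_set Kx).
  have [U [W [[V oV <-] Vx VU]] GU'] := GU x'.
  have /nbhs_ballP[r /= r0 rV] : nbhs x V by exact: open_nbhs_nbhs.
  have r20 : 0 < r / 2 by rewrite divr_gt0.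
  exists (ball x (r / 2), [set e | e < r / 2]).
    split; first exact: nbhsx_ballx.
    exact: nbhs_right_lt.
  move=> [y e] /= [xy er] x'' x''y; exists U => // w dw; apply: VU => /=; apply: rV.
  rewrite mx_norm_ball /= in xy *.
  rewrite -[x - _](subrKA y); apply: le_lt_trans (ler_normD _ _) _.
  rewrite [r]splitr; apply: ltrD => //.
  by rewrite -x''y; exact: lt_trans dw er.
move=> H; near (0 : R)^'+ => e.
have e0 : 0 < e by near: e; exact: nbhs_right_gt.
exists e => // x.
have He : std_simplex R n `<=` P e by near: e.
exact: (He (val x) (set_mem (valP x)) x erefl).
Unshelve. all: by end_near. Qed.

Lemma lebesgue_number n (s : simplex R n X) (A B : set X) :
  open A -> open B -> range s `<=` A `|` B ->
  exists2 e : R, 0 < e & forall x : Delta n,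
    (forall y, dist x y < e -> A (s y)) \/ (forall y, dist x y < e -> B (s y)).
Proof.
move=> oA oB sAB.
have [x|e e0 He] := @lebesgue_family n (fun U => U `<=` s @^-1` A \/ U `<=` s @^-1` B).
  have nb C : open C -> C (s x) -> nbhs x (s @^-1` C).
    by move=> oC Cx; apply: (@cts_fun _ _ s x); exact: open_nbhs_nbhs.
  by have [Ax|Bx] := sAB (s x) (ex_intro2 _ _ x I erefl);
    [exists (s @^-1` A); [exact: nb | left] | exists (s @^-1` B); [exact: nb | right]].
exists e => // x; have [U [UA|UB] HU] := He x; [left|right] => y /HU; [exact: UA|exact: UB].
Qed.

Definition small n (A B : set X) (s : simplex R n X) : Prop :=
  range s `<=` A \/ range s `<=` B.

Lemma small_within n k (A B : set X) (s : simplex R n X) (t : simplex R k X) :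
  small A B s -> within_simplex s t -> small A B t.
Proof.
by move=> [sA|sB] /within_range st; [left|right]; exact: subset_trans st _.
Qed.

Lemma simplex_dist_le1 n (x y : Delta n) : dist x y <= 1.
Proof.
have coord_le1 (t : Delta n) i : val t 0 i <= 1.
  by rewrite -(simplex_sum1 t) (bigD1 i) //= lerDl sumr_ge0 // => j _; exact: simplex_ge0.
apply/distE => // i; rewrite ler_norml.
have := simplex_ge0 x i; have := simplex_ge0 y i.
have := coord_le1 x i; have := coord_le1 y i; lra.
Qed.

(** The mesh (k / (k + 1))^N drops below the Lebesgue number of [s]. The bound depends on [s] alone,
    hence is common to all affine subsimplices of [s]. *)
Lemma iter_sdX_small n k (s : simplex R n X) (A B : set X) :
  open A -> open B -> range s `<=` A `|` B ->
  exists N0 : nat, forall N, (N0 <= N)%N -> forall phi : cochain k,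
    (forall t, small A B t -> phi t \is a Num.int) ->
    forall t, within_simplex s t -> iter N (@sdX R X k) phi t \is a Num.int.
Proof.
move=> oA oB /(lebesgue_number oA oB)[e e0 He].
have [N0 HN0] : exists N0 : nat, forall N, (N0 <= N)%N -> (k%:R / k.+1%:R : R) ^+ N < e.
  have q1 : `|k%:R / k.+1%:R : R| < 1.
    by rewrite ger0_norm ?divr_ge0 // ltr_pdivrMr ?ltr0n // mul1r ltr_nat.
  have /cvgrPdist_lt/(_ e e0)[N0 _ HN] := cvg_expr q1.
  exists N0 => N N0N; have := HN N N0N; rewrite /= sub0r normrN; exact/le_lt_trans/ler_norm.
exists N0 => N N0N phi Hphi t [v ->].
have -> : iter N (@sdX R X k) phi (sub_simplex s v) = along s (iter N (@sdX R X k) phi) v by [].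
have ball_bary (c : Delta n) r : bary_closed (@bary R n) (fun x => dist x c <= r).
  by move=> m u Hu; exact: comb_ball.
rewrite along_iter.
apply: (iter_sd_mesh (@distxx R n) (@distC R n) ball_bary (@bary_dist R n) (r := 1)).
  by move=> i j; exact: simplex_dist_le1.
move=> w dw; apply: Hphi; rewrite mulr1 in dw.
have near0 x : dist (w ord0) (comb w x) < e.
  rewrite distC; apply: le_lt_trans (HN0 N N0N); apply: comb_ball => i; exact: dw.
case: (He (w ord0)) => H; [left|right]; move=> _ [x _ <-]; exact: H (near0 x).
Qed.

(* [z] and [e] differ by a chain whose simplices lie in the union of [A] and [B];
   after enough subdivisions these become small, so [phi] is integral on them. *)
Lemma excision n (phi : cochain n.+1) (A B : set X) (z e a : chain R n.+1 X) (b : chain R n.+2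
  X) :
  open A -> open B ->
  (forall s, cob phi s \is a Num.int) ->
  (forall s, small A B s -> phi s \is a Num.int) ->
  boundary z = 0 -> z - (e + a) = boundary b ->
  (forall s, s \in dom a -> range s `<=` A `|` B) ->
  (forall s, s \in dom (boundary e) -> small A B s) ->
  ev phi z - ev phi e \is a Num.int.
Proof.
move=> oA oB cphi sphi bz zb sa se.
pose psi N := iter N (@sdX R X n.+1) phi.
have cpsi N s : cob (psi N) s \is a Num.int.
  by rewrite /psi cob_iter; apply: iter_sdX_int => t _; exact: cphi.
have spsi N s : small A B s -> psi N s \is a Num.int.
  move=> ss; apply: iter_sdX_int => t st; apply: sphi; exact: small_within st.
have ze : ev phi z = ev phi (e + a) + ev (cob phi) b.
  by rewrite -ev_boundary -zb raddfB /= addrCA subrr addr0.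
have step N y : ev (psi N) y - ev (psi N.+1) y =
    ev (sdhX (cob (psi N))) y + ev (sdhX (psi N)) (boundary y).
  rewrite ev_boundary -ev_cochainB !evE -big_split; apply: eq_bigr => s _ /=.
  by rewrite -mulrzDl -sdX_homotopy.
have evT N y : ev (sdhX (cob (psi N))) y \is a Num.int.
  by apply: ev_int => s _; apply: sdhX_int => t _; exact: cpsi.
(* [e + a] is a cycle, being homologous to [z], so the boundary term of the homotopy disappears for
   it, although not for [a] alone. *)
have y0 N : ev (sdhX (psi N)) (boundary (e + a)) = 0.
  have -> : e + a = z - boundary b by rewrite -zb subKr.
  rewrite raddfB /= bz raddfB /= raddf0 sub0r !ev_boundary evE big1 ?oppr0 // => s _.
  by rewrite cob_cob mul0rz.
have e0 N : ev (sdhX (psi N)) (boundary e) \is a Num.int.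
  apply: ev_int => s /se ss; apply: sdhX_int => t st.
  by apply: spsi; exact: small_within st.
have [N HN] : exists N, ev (psi N) a \is a Num.int.
  have [N HN] : exists N0, forall N, (N0 <= N)%N -> forall s, s \in dom a ->
    psi N s \is a Num.int.
    elim: (dom a) sa => [_|s r IH sa]; first by exists 0%N.
    have [N1 H1] := IH (fun t tr => sa t (mem_behead (s := s :: r) tr)).
    have [N2 H2] := iter_sdX_small n.+1 oA oB (sa s (mem_head _ _)).
    exists (maxn N1 N2) => N; rewrite geq_max => /andP[N1N N2N] t.
    rewrite inE => /predU1P[->|].
      by apply: H2 => //; exists (@vert R n.+1); rewrite sub_vert.
    exact: H1.
  by exists N; apply: ev_int; exact: HN.
(* Telescoping over the subdivisions, applied to the cycle [e + a] and to [e], whose boundary is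
   small. *)
have tel y : (forall M, ev (sdhX (psi M)) (boundary y) \is a Num.int) ->
    ev phi y - ev (psi N) y \is a Num.int.
  move=> Hy; elim: (N) => [|M IH]; first by rewrite subrr rpred0.
  rewrite -[ev phi y - _](subrKA (ev (psi M) y)); apply: rpredD => //.
  by rewrite step rpredD.
have t1 : ev phi (e + a) - ev (psi N) (e + a) \is a Num.int.
  by apply: tel => M; rewrite y0 rpred0.
have t2 := tel e e0.
have cb : ev (cob phi) b \is a Num.int by apply: ev_int.
have -> : ev phi z - ev phi e =
    ev (cob phi) b + (ev phi (e + a) - ev (psi N) (e + a)) + ev (psi N) a - (ev phi e - ev (psi
      N) e).
  by rewrite ze [ev (psi N) (e + a)]raddfD /=; ring.
by apply: rpredB => //; apply: rpredD => //; exact: rpredD.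
Qed.

(** In degree 1 the other half of the homotopy formula vanishes, because the homotopy is zero on
    points. *)
Lemma sdX_homotopy1 (phi : cochain 1) s : phi s - sdX phi s = sdhX (cob phi) s.
Proof.
rewrite sdX_homotopy [cob _ _]big1 ?addr0 // => i _.
by rewrite /sdhX /= mulr0.
Qed.

Lemma iter_sdX_step (phi : cochain 1) N s :
  iter N (@sdX R X 1) phi s - iter N.+1 (@sdX R X 1) phi s =
    sdhX (iter N (@sdX R X 2) (cob phi)) s.
Proof. by rewrite /= sdX_homotopy1 cob_iter. Qed.

(** Subdividing changes the values of a 1-cochain with integral coboundary by integers only, and
    deep subdivisions see only small simplices. *)
Lemma cocycle_int_small (phi : cochain 1) (A B : set X) :
  open A -> open B -> A `|` B = setT ->
  (forall s, cob phi s \is a Num.int) ->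
  (forall s, small A B s -> phi s \is a Num.int) ->
  forall s, phi s \is a Num.int.
Proof.
move=> oA oB AB cphi sphi s.
have [|N HN] := @iter_sdX_small 1 1 s A B oA oB; first by rewrite AB.
rewrite -(subrK (iter N (@sdX R X 1) phi s) (phi s)); apply: rpredD; last first.
  by apply: HN => //; exists (@vert R 1); rewrite sub_vert.
elim: (N) => [|M IH]; first by rewrite subrr rpred0.
rewrite -[phi s - _](subrKA (iter M (@sdX R X 1) phi s)); apply: rpredD => //.
rewrite iter_sdX_step; apply: sdhX_int => t _; apply: iter_sdX_int => u _; exact: cphi.
Qed.

(** The extension takes on [s] the value of a deep subdivision of [phi]. Consecutive subdivisions
    differ by the homotopy applied to the subdivided coboundary, which is eventually integral, so
    the value stabilises modulo integers. The depth depends on [s], as no bound serves all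
    simplices. *)
Lemma cocycle_extension (phi : cochain 1) (A B : set X) :
  open A -> open B -> A `|` B = setT ->
  (forall s, small A B s -> cob phi s \is a Num.int) ->
  exists psi : cochain 1, (forall s, cob psi s \is a Num.int) /\
    forall s, small A B s -> psi s - phi s \is a Num.int.
Proof.
move=> oA oB AB cphi.
pose I N := iter N (@sdX R X 1) phi.
have stable s M : (forall N, (M <= N)%N -> sdhX (iter N (@sdX R X 2) (cob phi)) s \is a Num.int)
  ->
    forall N, (M <= N)%N -> I M s - I N s \is a Num.int.
  move=> H N /subnK <-; elim: (N - M)%N => [|K IH]; first by rewrite subrr rpred0.
  rewrite -[I M s - _](subrKA (I (K + M)%N s)); apply: rpredD => //.
  by rewrite /I addSn iter_sdX_step; apply: H; exact: leq_addl.
have ex s : exists M, forall N, (M <= N)%N -> I M s - I N s \is a Num.int.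
  have [|M HM] := @iter_sdX_small 1 2 s A B oA oB; first by rewrite AB.
  exists M; apply: stable => N MN; apply: sdhX_int => t st; exact: HM.
have [M HM] := choice ex.
exists (fun s => I (M s) s); split => [s|s ss]; last first.
  rewrite -opprB rpredN; have := @stable s 0%N; apply => // N _.
  by apply: sdhX_int => t st; apply: iter_sdX_int => u tu; apply: cphi; apply: small_within tu;
    exact: small_within st.
have [|K HK] := @iter_sdX_small 2 2 s A B oA oB; first by rewrite AB.
(* A depth at which all three faces have stabilised and the subdivided coboundary is integral on
   [s]. *)
pose L := (\max_(i < 3) M (face i s) + K)%N.
have -> : cob (fun s => I (M s) s) s =
    cob (fun t => I (M t) t - I L t) s + cob (I L) s.
  by rewrite /cob -big_split; apply: eq_bigr => i _ /=; rewrite -mulrDr subrK.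
apply: rpredD.
  apply: cob_int => i; apply: HM; apply: leq_trans (leq_addr _ _).
  exact: (leq_bigmax i).
rewrite /I cob_iter; apply: HK => //; first exact: leq_addl.
by exists (@vert R 2); rewrite sub_vert.
Qed.

End Smallness.

Local Open Scope complex_scope.

(** * Arguments of complex numbers *)

Section Circle.
Variable R : realType.
Implicit Types (x y a b : R) (z w : R[i]).
Local Notation cRe := (@complex.Re R).
Local Notation cIm := (@complex.Im R).

Lemma complex_eq z w : cRe z = cRe w -> cIm z = cIm w -> z = w.
Proof. by case: z w => a b [c d] /= -> ->. Qed.

Lemma cReM z w : cRe (z * w) = cRe z * cRe w - cIm z * cIm w.
Proof. by case: z w => a b [c d]. Qed.

Lemma cImM z w : cIm (z * w) = cRe z * cIm w + cIm z * cRe w.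
Proof. by case: z w => a b [c d]. Qed.

Lemma e2piD a b : e2pi (a + b) = e2pi a * e2pi b.
Proof.
by apply: complex_eq; rewrite ?cReM ?cImM /= mulrDr ?cosD // sinD addrC [sin _ * _]mulrC.
Qed.

Lemma e2pi0 : e2pi (0 : R) = 1.
Proof. by rewrite /e2pi mulr0 cos0 sin0. Qed.

Lemma e2piNM a : e2pi (- a) * e2pi a = 1.
Proof. by rewrite -e2piD addNr e2pi0. Qed.

Lemma e2pi_neq0 a : e2pi a != 0.
Proof. by apply/eqP => e; have := e2piNM a; rewrite e mulr0 => /eqP; rewrite eq_sym oner_eq0. Qed.

Lemma e2piN a : e2pi (- a) = (e2pi a)^-1.
Proof. by apply: (mulIf (e2pi_neq0 a)); rewrite e2piNM mulVf // e2pi_neq0. Qed.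

Lemma e2piB a b : e2pi (a - b) = e2pi a / e2pi b.
Proof. by rewrite e2piD e2piN. Qed.

Lemma normr_e2pi a : `|e2pi a| = 1.
Proof. by rewrite normc_def /= cos2Dsin2 sqrtr1. Qed.

Lemma e2piMn a n : e2pi (a *+ n) = e2pi a ^+ n.
Proof. by elim: n => [|n IH]; rewrite ?mulr0n ?e2pi0 ?expr0 // mulrS e2piD IH exprS. Qed.

Lemma e2piMz a (m : int) : e2pi (a *~ m) = e2pi a ^ m.
Proof.
case: m => n; first by rewrite -pmulrn e2piMn.
by rewrite NegzE -nmulrn e2piN e2piMn -exprnN.
Qed.

Lemma e2pi1 : e2pi (1 : R) = 1.
Proof.
rewrite /e2pi mulr1 mulr_natl cos2pi sin2pi; reflexivity.
Qed.

Lemma e2pi_int a : a \is a Num.int -> e2pi a = 1.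
Proof. by move=> /intrP[m ->]; rewrite e2piMz e2pi1 exp1rz. Qed.

(** On [0, 1) the sine vanishes only at 0 and 1/2, and at 1/2 the cosine is -1. *)
Lemma e2pi_eq1 a : e2pi a = 1 -> a \is a Num.int.
Proof.
move=> e; have fE : a = frac a + (Num.floor a)%:~R by rewrite /frac subrK.
have {}e : e2pi (frac a) = 1.
  by rewrite /frac e2piB e e2pi_int ?divr1 // intr_int.
have /andP[f0 f1] : 0 <= frac a < 1.
  rewrite /frac subr_ge0 floor_le_tmp /= ltrBlDl.
  by have := floorD1_gt a; rewrite intrD.
suff f : frac a = 0 by rewrite fE f add0r intr_int.
have pi0 := pi_gt0 R.
case: e => c s; apply/eqP; rewrite eq_le f0 andbT leNgt; apply/negP => fpos.
have [fl|fg|fe] := ltgtP (frac a) (1 / 2).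
- have : 0 < sin (2 * pi * frac a) by apply: sin_gt0_pi; nra.
  by rewrite s ltxx.
- have : 0 < sin (2 * pi * frac a - pi) by apply: sin_gt0_pi; nra.
  by rewrite sinB cospi sinpi s; lra.
- by move: c; rewrite fe (_ : 2 * pi * (1 / 2) = pi); [rewrite cospi; lra | field].
Qed.

Lemma e2pi_eq a b : e2pi a = e2pi b <-> a - b \is a Num.int.
Proof.
split => [e|/e2pi_int]; first by apply: e2pi_eq1; rewrite e2piB e divff // e2pi_neq0.
by rewrite e2piB => e; rewrite -[RHS]mul1r -e divfK // e2pi_neq0.
Qed.

(** The modulus as an element of [R]; the norm on [R[i]] takes values in [R[i]]. *)
Definition cabs z : R := Num.sqrt (cRe z ^+ 2 + cIm z ^+ 2).

Lemma cabsE z : `|z| = (cabs z)%:C.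
Proof. exact: normc_def. Qed.

Lemma cabs_ge0 z : 0 <= cabs z.
Proof. exact: sqrtr_ge0. Qed.

Lemma sqr_cabs z : cabs z ^+ 2 = cRe z ^+ 2 + cIm z ^+ 2.
Proof. by rewrite sqr_sqrtr // addr_ge0 // sqr_ge0. Qed.

Lemma cabsM z w : cabs (z * w) = cabs z * cabs w.
Proof. by apply: complexI; rewrite rmorphM /= -!cabsE normrM. Qed.

Lemma cabs_eq0 z : (cabs z == 0) = (z == 0).
Proof. by rewrite -[RHS]normr_eq0 cabsE eq_complex /= eqxx andbT. Qed.

Lemma cabs_gt0 z : (0 < cabs z) = (z != 0).
Proof. by rewrite lt_def cabs_ge0 andbT cabs_eq0. Qed.

Lemma cabs_real x : cabs x%:C = `|x|.
Proof. by rewrite /cabs /= expr0n addr0 sqrtr_sqr. Qed.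

Lemma cabs_e2pi a : cabs (e2pi a) = 1.
Proof. by apply: complexI; rewrite -cabsE normr_e2pi. Qed.

Lemma cabs0 : cabs 0 = 0.
Proof. by apply/eqP; rewrite cabs_eq0. Qed.

Lemma cabs1 : cabs 1 = 1.
Proof. by rewrite (cabs_real 1) normr1. Qed.

Lemma cabsX z n : cabs (z ^+ n) = cabs z ^+ n.
Proof. by elim: n => [|n IH]; rewrite ?expr0 ?cabs1 // !exprS cabsM IH. Qed.

Lemma cabs_conj z : cabs (z^*) = cabs z.
Proof. by case: z => a b; rewrite /cabs /= sqrrN. Qed.

Lemma mul_conj z : z * z^* = (cabs z ^+ 2)%:C.
Proof.
rewrite sqr_cabs; case: z => a b; apply: complex_eq; rewrite ?cReM ?cImM /=; ring.
Qed.

(** The argument is measured in turns. Every [a] is an argument of 0, so uniqueness requires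
    [z != 0]. *)
Definition has_arg z a := z = (cabs z)%:C * e2pi a.

Lemma has_argM z w a b : has_arg z a -> has_arg w b -> has_arg (z * w) (a + b).
Proof. by rewrite /has_arg cabsM rmorphM e2piD /= => {1}-> {1}->; rewrite mulrACA. Qed.

Lemma conj_e2pi a : (e2pi a)^* = e2pi (- a).
Proof. by rewrite /e2pi mulrN cosN sinN. Qed.

Lemma has_arg_conj z a : has_arg z a -> has_arg (z^*) (- a).
Proof.
by rewrite /has_arg cabs_conj -conj_e2pi => {1}->; rewrite rmorphM /= oppr0.
Qed.

(** Multiplying z w^* by w gives z times the positive number |w|^2. This is how an argument is
    continued from [w] to a nearby [z]. *)
Lemma has_arg_step z w a c : w != 0 -> has_arg w a -> has_arg (z * w^*) c -> has_arg z (a + c).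
Proof.
move=> w0 ha hc; have := has_argM hc ha; rewrite -mulrA [w^* * w]mulrC mul_conj.
have w2 : (cabs w ^+ 2)%:C != 0 by rewrite eq_complex /= eqxx andbT expf_eq0 /= cabs_eq0.
rewrite /has_arg cabsM cabs_real ger0_norm ?sqr_ge0 //; move: (cabs w ^+ 2) w2 => W w2.
rewrite [(cabs z * W)%:C]rmorphM /= mulrAC => /(mulIf w2).
by rewrite addrC.
Qed.

Lemma has_argX z a n : has_arg z a -> has_arg (z ^+ n) (n%:R * a).
Proof.
move=> h; elim: n => [|n IH].
  by rewrite expr0 mul0r /has_arg cabs1 e2pi0 mulr1.
by rewrite exprS -natr1 mulrDl mul1r addrC; exact: has_argM.
Qed.

Lemma has_arg_e2pi a : has_arg (e2pi a) a.
Proof. by rewrite /has_arg cabs_e2pi mul1r. Qed.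

Lemma has_arg_eq z a b : z != 0 -> has_arg z a -> has_arg z b -> a - b \is a Num.int.
Proof.
move=> z0 ha hb; apply/e2pi_eq; have : (cabs z)%:C * e2pi a =
  (cabs z)%:C * e2pi b by rewrite -ha -hb.
by apply: mulfI; rewrite eq_complex /= eqxx andbT cabs_eq0.
Qed.

Lemma has_arg_int z a b : a - b \is a Num.int -> has_arg z b -> has_arg z a.
Proof. by move=> /e2pi_eq e; rewrite /has_arg e. Qed.

(** Half-angle formula: the principal argument of x + iy is 2 atan (y / (r + x)), divided here by 2
    pi. It is continuous off 0 and the negative reals, the domain that [slit] describes. *)
Definition larg z : R := atan (cIm z / (cabs z + cRe z)) / pi.

Definition slit z := 0 < cabs z + cRe z.

Lemma slitP z : (cIm z != 0) || (0 < cRe z) -> slit z.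
Proof.
rewrite /slit; case: (ltgtP (cRe z) 0) => [r0|r0 _|r0].
- rewrite orbF => i0; rewrite -[cRe z]opprK subr_gt0.
  rewrite -(@ltr_pXn2r _ 2) ?nnegrE ?oppr_ge0 ?cabs_ge0 1?ltW // sqr_cabs sqrrN ltrDl.
  by rewrite lt_def sqrf_eq0 i0 sqr_ge0.
- by have := cabs_ge0 z; lra.
- rewrite orbF r0 addr0 cabs_gt0 => i0; apply: contraNN i0 => /eqP ->; exact: eqxx.
Qed.

Lemma half_angle (F : fieldType) (r x y : F) : r + x != 0 -> r ^+ 2 = x ^+ 2 + y ^+ 2 ->
  1 + (y / (r + x)) ^+ 2 = 2 * r / (r + x).
Proof.
move=> rx e; have y2 : y ^+ 2 = r ^+ 2 - x ^+ 2 by rewrite e; ring.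
by rewrite expr_div_n y2; field.
Qed.

Lemma half_angle_re (F : realFieldType) (r x : F) : r + x != 0 -> r != 0 ->
  x = r * ((2 * r / (r + x))^-1 + (2 * r / (r + x))^-1 - 1).
Proof. by move=> rx r0; field; rewrite r0 rx. Qed.

Lemma half_angle_im (F : realFieldType) (r x y : F) : r + x != 0 -> r != 0 ->
  y = r * (y / (r + x) * (2 * r / (r + x))^-1 + y / (r + x) * (2 * r / (r + x))^-1).
Proof. by move=> rx r0; field; rewrite r0 rx. Qed.

Lemma has_arg_larg z : slit z -> has_arg z (larg z).
Proof.
rewrite /slit /has_arg /larg; have := sqr_cabs z; have := cabs_ge0 z.
have -> : z = cRe z +i* cIm z by case: z.
move: (cRe z) (cIm z) (cabs _) => x y r /= r0 Q s0.
have pi0 := lt0r_neq0 (pi_gt0 R).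
have e (A : R) : 2 * pi * (A / pi) = A *+ 2 by rewrite -[RHS]mulr_natl -mulrA [pi * _]mulrC divfK.
rewrite /e2pi e; have rx0 : r + x != 0 by rewrite gt_eqF.
have T1 := half_angle rx0 Q; have [t tE] : exists t, t = y / (r + x) by eexists.
rewrite -tE in T1 *.
have ca : cos (atan t) != 0.
  by rewrite gt_eqF // cos_gt0_pihalf // atan_gtNpi2 atan_ltpi2.
have c2 : cos (atan t) ^+ 2 = (1 + t ^+ 2)^-1.
  by have := cos2_tan2 ca; rewrite atanK => <-; rewrite invrK.
have sc : sin (atan t) = t * cos (atan t).
  by rewrite -{1}[t in RHS]atanK /tan divfK.
have rn0 : r != 0.
  apply: contraTneq s0 => r0'; move: Q; rewrite r0' add0r expr0n /= => /esym/eqP.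
  by rewrite paddr_eq0 ?sqr_ge0 // sqrf_eq0 => /andP[/eqP -> _]; rewrite ltxx.
rewrite cos_mulr2n sin_mulr2n sc.
have -> : cos (atan t) * (t * cos (atan t)) = t * cos (atan t) ^+ 2 by ring.
rewrite c2 T1 tE !mulr2n; apply: complex_eq; rewrite ?cReM ?cImM /= !mul0r ?subr0 ?addr0.
  exact: half_angle_re.
exact: half_angle_im.
Qed.

End Circle.

Section ComplexContinuity.
Variables (R : realType).
Local Notation cRe := (@complex.Re R).
Local Notation cIm := (@complex.Im R).

Definition ccont (T : topologicalType) (g : T -> R[i]) (x : T) : Prop :=
  {for x, continuous (fun t => cRe (g t))} /\ {for x, continuous (fun t => cIm (g t))}.

Variable T : topologicalType.
Implicit Types (g h : T -> R[i]) (f : T -> R) (x : T).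

Lemma ccontE g x : ccont g x <-> {for x, continuous (g : T -> R[i]^o)}.
Proof.
have cB (z w : R[i]) : cRe (z - w) = cRe z - cRe w /\ cIm (z - w) = cIm z - cIm w.
  by case: z w => a b [].
have gE : {for x, continuous (g : T -> R[i]^o)} <->
    forall e : R[i], 0 < e -> \forall t \near nbhs x, `|g x - g t| < e.
  exact: (@cvgrPdist_lt R[i] (R[i]^o) T (nbhs x) _ g (g x)).
rewrite gE {gE}; split=> [[cr ci]|cg]; last first.
  have near_lt e : 0 < e -> \forall y \near x, cabs (g x - g y) < e.
    move=> e0; have e0' : 0 < e%:C by rewrite ltcR.
    by have := cg _ e0'; under eq_near do rewrite cabsE ltcR.
  split; apply/cvgrPdist_lt => e /near_lt; apply: filterS => y; apply: le_lt_trans.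
    rewrite -(cB _ _).1 -(@ler_pXn2r _ 2) ?nnegrE ?cabs_ge0 // sqr_cabs.
    by rewrite real_normK ?num_real // lerDl sqr_ge0.
  rewrite -(cB _ _).2 -(@ler_pXn2r _ 2) ?nnegrE ?cabs_ge0 // sqr_cabs.
  by rewrite real_normK ?num_real // lerDr sqr_ge0.
move=> e; rewrite ltcE /= => /andP[/eqP ie e0].
have e20 : 0 < cRe e / 2 by rewrite divr_gt0.
have /cvgrPdist_lt/(_ _ e20) Hr := cr; have /cvgrPdist_lt/(_ _ e20) Hi := ci.
near=> y.
have hr : `|cRe (g x) - cRe (g y)| < cRe e / 2 by near: y.
have hi : `|cIm (g x) - cIm (g y)| < cRe e / 2 by near: y.
have -> : e = (cRe e)%:C by apply: complex_eq.
rewrite cabsE ltcR [cRe e]splitr.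
apply: le_lt_trans (ltrD hr hi).
rewrite -(@ler_pXn2r _ 2) ?nnegrE ?cabs_ge0 ?addr_ge0 // sqr_cabs.
rewrite !(cB _ _).1 !(cB _ _).2 [leRHS]sqrrD !real_normK ?num_real //.
by rewrite addrAC lerDl mulrn_wge0 // mulr_ge0.
Unshelve. all: by end_near. Qed.

Lemma ccont_re g x : ccont g x -> {for x, continuous (fun t => cRe (g t))}.
Proof. by case. Qed.

Lemma ccont_im g x : ccont g x -> {for x, continuous (fun t => cIm (g t))}.
Proof. by case. Qed.

Lemma ccontM g h x : ccont g x -> ccont h x -> ccont (fun t => g t * h t) x.
Proof.
move=> [gr gi] [hr hi]; split.
  have -> : (fun t => cRe (g t * h t)) = fun t => cRe (g t) * cRe (h t) - cIm (g t) * cIm (h t).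
    by apply/funext => t; rewrite cReM.
  by apply: continuousB; exact: continuousM.
have -> : (fun t => cIm (g t * h t)) = fun t => cRe (g t) * cIm (h t) + cIm (g t) * cRe (h t).
  by apply/funext => t; rewrite cImM.
by apply: continuousD; exact: continuousM.
Qed.

Lemma ccont_cst c x : ccont (fun=> c) x.
Proof. by split; exact: cst_continuous. Qed.

Lemma ccont_conj g x : ccont g x -> ccont (fun t => conjc (g t)) x.
Proof.
move=> [gr gi]; split.
  by have -> : (fun t => cRe (conjc (g t))) = fun t => cRe (g t) by apply/funext => t;
    case: (g t).
have -> : (fun t => cIm (conjc (g t))) = fun t => - cIm (g t) by apply/funext => t; case: (g t).
exact: continuousN.
Qed.

Lemma ccontX g n x : ccont g x -> ccont (fun t => g t ^+ n) x.
Proof.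
move=> cg; elim: n => [|n IH].
  have -> : (fun t => g t ^+ 0) = fun=> 1 by apply/funext => t; rewrite expr0.
  exact: ccont_cst.
have -> : (fun t => g t ^+ n.+1) = fun t => g t * g t ^+ n by apply/funext => t; rewrite exprS.
exact: ccontM.
Qed.

Lemma ccont_real f x : {for x, continuous f} -> ccont (fun t => (f t)%:C) x.
Proof. by move=> cf; split => //; exact: cst_continuous. Qed.

Lemma ccont_cabs g x : ccont g x -> {for x, continuous (fun t => cabs (g t))}.
Proof.
move=> [gr gi]; apply: (@continuous_comp _ _ _ _ (@Num.sqrt R)); last exact: sqrt_continuous.
by apply: continuousD; exact: continuousM.
Qed.

Lemma ccont_e2pi f x : {for x, continuous f} -> ccont (fun t => e2pi (f t)) x.
Proof.
move=> cf; have c2 : {for x, continuous (fun t => 2 * pi * f t)}.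
  by apply: continuousM => //; exact: cst_continuous.
split.
  apply: (@continuous_comp _ _ _ (fun t => 2 * pi * f t) (@cos R)) => //.
  exact: continuous_cos.
apply: (@continuous_comp _ _ _ (fun t => 2 * pi * f t) (@sin R)) => //.
exact: continuous_sin.
Qed.

Lemma larg_continuous g x : ccont g x -> slit (g x) -> {for x, continuous (fun t => larg (g t))}.
Proof.
move=> cg sg; apply: continuousM; last exact: cst_continuous.
apply: (@continuous_comp _ _ _ _ (@atan R)); last exact: continuous_atan.
apply: continuousM; first exact: ccont_im.
apply: continuousV; first by rewrite gt_eqF.
by apply: continuousD; [exact: ccont_cabs|exact: ccont_re].
Qed.

End ComplexContinuity.

(** * Continuous lifts of arguments along simplices *)

Section Lifting.
Variable R : realType.
Local Notation Delta := (std_simplex R).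
Local Notation cRe := (@complex.Re R).
Local Notation cIm := (@complex.Im R).

(** The point of the 1-simplex with coordinates (1 - t, t); outside [0, 1] it is a default
    vertex. *)
Definition pt (t : R) : Delta 1 :=
  insubd (vert R (ord0 : 'I_2)) (\row_(i < 2) if i == 0 then 1 - t else t).

Lemma val_pt t : 0 <= t <= 1 -> forall i, val (pt t) 0 i = if i == 0 then 1 - t else t.
Proof.
move=> /andP[t0 t1] i; rewrite insubdK ?mxE //; apply/mem_set; split=> [j|].
  by rewrite mxE; case: ifP; lra.
by rewrite !big_ord_recl big_ord0 !mxE /=; ring.
Qed.

Definition pair_fun (T : Type) (x y : T) (i : 'I_2) : T := if i == 0 then x else y.

Definition seg n (x y : Delta n) (t : R) : Delta n := comb (pair_fun x y) (pt t).

Lemma val_seg n (x y : Delta n) t j : 0 <= t <= 1 ->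
  val (seg x y t) 0 j = (1 - t) * val x 0 j + t * val y 0 j.
Proof. by move=> t01; rewrite val_comb !big_ord_recl big_ord0 !val_pt //= addr0. Qed.

Lemma seg0 n (x y : Delta n) : seg x y 0 = x.
Proof. by apply: simplex_eq => j; rewrite val_seg ?lexx ?ler01 //; ring. Qed.

Lemma seg1 n (x y : Delta n) : seg x y 1 = y.
Proof. by apply: simplex_eq => j; rewrite val_seg ?lexx ?ler01 //; ring. Qed.

Lemma seg_dist n (x y : Delta n) s t : 0 <= s <= 1 -> 0 <= t <= 1 ->
  dist (seg x y s) (seg x y t) <= `|s - t|.
Proof.
move=> s01 t01; apply/distE => // i; rewrite !val_seg //.
have -> : (1 - s) * val x 0 i + s * val y 0 i - ((1 - t) * val x 0 i + t * val y 0 i) =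
  (s - t) * (val y 0 i - val x 0 i) by ring.
rewrite normrM -[leRHS]mulr1; apply: ler_wpM2l => //.
have /distE H := simplex_dist_le1 y x; exact: H.
Qed.

Lemma conjM (z w : R[i]) : conjc (z * w) = conjc z * conjc w.
Proof. by case: z w => a b [c d]; apply: complex_eq => /=; ring. Qed.

Lemma has_arg_ex (z : R[i]) : exists a, has_arg z a.
Proof.
have [sz|] := boolP ((cIm z != 0) || (0 < cRe z)).
  by exists (larg z); exact/has_arg_larg/slitP.
rewrite negb_or negbK -leNgt => /andP[/eqP i0 r0].
exists (1 / 2); have e : e2pi (1 / 2 : R) = -1.
  have h : 2 * pi * (1 / 2) = pi :> R by rewrite mulrC mulrA div1r mulVf ?mul1r ?pnatr_eq0.
  by rewrite /e2pi h cospi sinpi; apply: complex_eq; rewrite /= ?oppr0.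
have c : cabs z = - cRe z by rewrite /cabs i0 expr0n addr0 sqrtr_sqr ler0_norm.
by rewrite /has_arg e c; apply: complex_eq; rewrite ?cReM ?cImM /=; lra.
Qed.

Lemma seg_continuous n (x : Delta n) t : 0 <= t <= 1 -> continuous (fun y => seg x y t).
Proof.
move=> t01; apply: to_simplex_continuous => j.
have -> : (fun y : Delta n => val (seg x y t) 0 j) =
    (fun y : Delta n => (1 - t) * val x 0 j) \+ (fun y : Delta n => t * val y 0 j).
  by apply/funext => y; rewrite val_seg.
move=> y; apply: (@continuousD R R^o (Delta n) (fun y : Delta n => (1 - t) * val x 0 j) (fun y :
  Delta n => t * val y 0 j)).
  exact: cst_continuous.
by apply: continuousM; [exact: cst_continuous|exact: coord_simplex_continuous].
Qed.

Lemma natr_div01 k N : (k <= N)%N -> (0 < N)%N -> 0 <= (k%:R / N%:R : R) <= 1.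
Proof.
move=> kN N0; rewrite divr_ge0 //= ler_pdivrMr ?ltr0n // mul1r ler_nat //.
Qed.

Lemma seg_chain (e : R) : 0 < e -> exists2 N : nat, (0 < N)%N &
  forall n (x y : Delta n) k, (k < N)%N -> dist (seg x y (k%:R / N%:R)) (seg x y (k.+1%:R /
    N%:R)) < e.
Proof.
move=> e0; pose N := (Num.trunc e^-1).+1; exists N => // n x y k kN.
apply: (le_lt_trans (seg_dist _ _ _ _)); try exact: natr_div01.
  by apply: natr_div01 => //; exact: ltnW.
rewrite distrC -mulrBl -natrB // subSnn mul1r ger0_norm ?invr_ge0 //.
rewrite invf_plt ?posrE ?ltr0n //; exact: truncnS_gt.
Qed.

(** Connectedness of the simplex: two points are joined by a chain on the segment between them, with
    steps shorter than a Lebesgue number. *)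
Lemma locally_constant n (T : Type) (phi : Delta n -> T) :
  (forall x : Delta n, exists2 U, nbhs x U & forall u v, U u -> U v -> phi u = phi v) ->
  forall x y, phi x = phi y.
Proof.
move=> H x y.
have [e e0 He] := lebesgue_family (G := fun U => forall u v, U u -> U v -> phi u = phi v) H.
have [N N0 HN] := seg_chain e0.
have step k : (k <= N)%N -> phi (seg x y (k%:R / N%:R)) = phi x.
  elim: k => [_|k IH kN]; first by rewrite mul0r seg0.
  rewrite -IH; last exact: ltnW.
  have [U HU Ue] := He (seg x y (k%:R / N%:R)); apply: HU; last by apply: Ue; rewrite distxx.
  exact/Ue/HN.
have := step N (leqnn N); rewrite divff ?seg1 // pnatr_eq0 -lt0n //.
Qed.

Lemma int_continuous_constant n (phi : Delta n -> R) :
  continuous phi -> (forall x, phi x \is a Num.int) -> forall x y, phi x = phi y.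
Proof.
move=> cphi iphi; apply: locally_constant => x.
exists [set u | `|phi x - phi u| < 1 / 2].
  have /cvgrPdist_lt := cphi x; apply; lra.
move=> u v /= xu xv; apply/eqP; rewrite -subr_eq0.
have /intrP[m mE] : phi u - phi v \is a Num.int by exact: rpredB.
have : `|phi u - phi v| < 1.
  have -> : phi u - phi v = (phi x - phi v) - (phi x - phi u) by ring.
  by apply: le_lt_trans (ler_normB _ _) _; lra.
rewrite mE -intr_norm -[1]/(1%:~R) ltr_int => m1.
suff -> : m = 0 by rewrite eqxx.
lia.
Qed.

Section LiftExistence.
Variables (n : nat) (g : Delta n -> R[i]).
Hypothesis cg : forall x, ccont g x.
Hypothesis g0 : forall x, g x != 0.

Let close : exists2 e : R, 0 < e & forall x y, dist x y < e -> slit (g y * conjc (g x)).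
Proof.
pose Q (U : set (Delta n)) := forall u v, U u -> U v -> slit (g v * conjc (g u)).
have [x|e e0 He] := lebesgue_family (G := Q).
  pose k u := g u * conjc (g x).
  (* On this set [k] lies within an eighth of a turn of the positive axis, so the quotient of two of
     its values has positive real part. *)
  pose U := [set u | cIm (k u) < cRe (k u)] `&` [set u | - cIm (k u) < cRe (k u)].
  have ck : ccont k x by apply: ccontM => //; exact: ccont_cst.
  have kx : cIm (k x) = 0 /\ 0 < cRe (k x).
    by rewrite /k mul_conj /= exprn_gt0 // cabs_gt0.
  have FF : Filter (nbhs x) := nbhs_filter x.
  exists U.
    have pos (f : Delta n -> R) : {for x, continuous f} -> 0 < f x -> nbhs x [set u | 0 < f u].
      move=> /cvgrPdist_lt cf fx; apply: filterS (cf _ fx) => u /=; rewrite ltr_norml.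
      by move=> /andP[h1 h2]; lra.
    apply: filterI.
      have := pos (fun u => cRe (k u) - cIm (k u)); rewrite kx.1 subr0.
      move=> /(_ (continuousB (ccont_re ck) (ccont_im ck)) kx.2).
      by apply: filterS => u /=; rewrite subr_gt0.
    have := pos (fun u => cRe (k u) + cIm (k u)); rewrite kx.1 addr0.
    move=> /(_ (continuousD (ccont_re ck) (ccont_im ck)) kx.2).
    by apply: filterS => u /= h; lra.
  move=> u v /= [/= u1 u2] [/= v1 v2]; apply: slitP; apply/orP; right.
  have : 0 < cRe (k v * conjc (k u)).
    rewrite cReM; move: u1 u2 v1 v2; case: (k u) (k v) => a b [c d] /= *.
    nra.
  have -> : k v * conjc (k u) = (cabs (g x) ^+ 2)%:C * (g v * conjc (g u)).
    rewrite -mul_conj /k conjM conjcK; ring.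
  by rewrite cReM /= mul0r subr0 pmulr_rgt0 // exprn_gt0 // cabs_gt0.
exists e => // x y xy; have [U QU HU] := He x.
by apply: QU; apply: HU; rewrite ?distxx.
Qed.

(** The lift at x adds to an argument at the base vertex the principal arguments of N successive
    quotients along the segment to x. As N does not depend on x, this is a finite sum of continuous
    functions. *)
Lemma lift_exists : exists2 f : Delta n -> R, continuous f & forall x, has_arg (g x) (f x).
Proof.
have [e e0 He] := close.
have [N N0 HN] := seg_chain e0.
pose x0 : Delta n := vert R ord0.
have [a Ha] := has_arg_ex (g x0).
pose step k x := larg (g (seg x0 x (k.+1%:R / N%:R)) * conjc (g (seg x0 x (k%:R / N%:R)))).
have slit_step k x : (k < N)%N -> slit (g (seg x0 x (k.+1%:R / N%:R)) * conjc (g (seg x0 x (k%:R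
  / N%:R)))).
  by move=> kN; apply: He; exact: HN.
have lift_k x k : (k <= N)%N -> has_arg (g (seg x0 x (k%:R / N%:R))) (a + \sum_(i < k) step i x).
  elim: k => [_|k IH kN]; first by rewrite mul0r seg0 big_ord0 addr0.
  rewrite big_ord_recr /= addrA; apply: has_arg_step (IH (ltnW kN)) _ => //.
  exact/has_arg_larg/slit_step.
exists (fun x => a + \sum_(i < N) step i x); last first.
  by move=> x; have := lift_k x N (leqnn N); rewrite divff ?seg1 // pnatr_eq0 -lt0n.
have cseg k x : (k <= N)%N -> ccont (fun y => g (seg x0 y (k%:R / N%:R))) x.
  move=> kN; have c1 := seg_continuous (natr_div01 kN N0).
  have [c2 c3] := cg (seg x0 x (k%:R / N%:R)).
  split; first by apply: (@continuous_comp _ _ _ (fun y => seg x0 y (k%:R / N%:R)) (fun t => cRe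
    (g t))) => //; exact: c1.
  by apply: (@continuous_comp _ _ _ (fun y => seg x0 y (k%:R / N%:R)) (fun t => cIm (g t))) =>
    //; exact: c1.
have cs : continuous (fun x => \sum_(i < N) step i x).
  apply: sum_continuous => i x; apply: larg_continuous.
    by apply: ccontM; [|apply: ccont_conj]; apply: cseg => //; exact: ltnW.
  exact: slit_step.
by move=> x; apply: continuousD; [exact: cst_continuous|exact: cs].
Qed.

End LiftExistence.

Lemma lift_unique n (g : Delta n -> R[i]) (f f' : Delta n -> R) :
  (forall x, g x != 0) -> continuous f -> continuous f' ->
  (forall x, has_arg (g x) (f x)) -> (forall x, has_arg (g x) (f' x)) ->
  forall x y, f x - f y = f' x - f' y.
Proof.
move=> g0 cf cf' hf hf' x y; apply/eqP; rewrite -subr_eq0; apply/eqP.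
have c : continuous (fun x => f x - f' x) by move=> t; apply: continuousB; [exact: cf|exact: cf'].
have := int_continuous_constant c _ x y.
move=> /(_ (fun t => has_arg_eq (g0 t) (hf t) (hf' t))); lra.
Qed.

Variable X : topologicalType.

(* The increase of the argument of [g] along [s], in turns (meaningless if [g] has a zero). *)
Definition dlog (g : X -> R[i]) (s : simplex R 1 X) : R :=
  xget 0 [set d | exists2 f : Delta 1 -> R, continuous f /\ (forall x, has_arg (g (s x)) (f x)) &
                  d = f (vert R 1) - f (vert R 0)].

Lemma dlogE (g : X -> R[i]) (s : simplex R 1 X) (f : Delta 1 -> R) :
  (forall x, g (s x) != 0) -> continuous f -> (forall x, has_arg (g (s x)) (f x)) ->
  dlog g s = f (vert R 1) - f (vert R 0).
Proof.
move=> g0 cf hf; rewrite /dlog; case: xgetP => [_ ->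
  [f' [cf' hf'] ->]|/(_ (f (vert R 1) - f (vert R 0)))].
  exact: (lift_unique (g := fun x => g (s x))).
by case; exists f.
Qed.

Definition ccontinuous (T : topologicalType) (g : T -> R[i]) := forall x, ccont g x.

Lemma ccont_comp (T U : topologicalType) (g : U -> R[i]) (f : T -> U) :
  continuous f -> ccontinuous g -> ccontinuous (g \o f).
Proof.
move=> cf cg x; have [c2 c3] := cg (f x); split.
  by apply: (@continuous_comp _ _ _ f (fun t => cRe (g t))) => //; exact: cf.
by apply: (@continuous_comp _ _ _ f (fun t => cIm (g t))) => //; exact: cf.
Qed.

Lemma simplex_lift n (g : X -> R[i]) (s : simplex R n X) :
  ccontinuous g -> (forall x, g (s x) != 0) ->
  exists2 f : Delta n -> R, continuous f & forall x, has_arg (g (s x)) (f x).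
Proof.
move=> cg g0; apply: (@lift_exists n (g \o s)) => //.
by apply: ccont_comp => //; exact: cts_fun.
Qed.

Lemma dlog_sub n (g : X -> R[i]) (s : simplex R n X) (f : Delta n -> R) (v : 'I_2 -> Delta n) :
  (forall x, g (s x) != 0) -> continuous f -> (forall x, has_arg (g (s x)) (f x)) ->
  dlog g (sub_simplex s v) = f (v 1) - f (v 0).
Proof.
move=> g0 cf hf; rewrite (@dlogE _ _ (f \o comb v)) //=.
- by rewrite !comb_vert.
- by move=> x; apply: continuous_comp; [exact: cts_fun|exact: cf].
Qed.

End Lifting.

Local Open Scope quotient_scope.

Section UnitPowers.
Variable R : realType.
Implicit Types (z w : R[i]) (m : int).

(* Unlike [z ^ m], continuous at 0; the two agree on the unit circle. *)
Definition zpow z m : R[i] := if m is Negz n then conjc z ^+ n.+1 else z ^+ `|m|%N.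

Lemma cabs_conjc z : cabs (conjc z) = cabs z.
Proof. exact: cabs_conj. Qed.

Lemma cabs_zpow z m : cabs (zpow z m) = cabs z ^+ `|m|%N.
Proof. by case: m => n /=; rewrite cabsX ?cabs_conjc. Qed.

Lemma has_arg_zpow z a m : has_arg z a -> has_arg (zpow z m) (m%:~R * a).
Proof.
case: m => n ha /=; first exact: has_argX.
have := has_argX n.+1 (has_arg_conj ha).
by rewrite NegzE mulrNz mulNr mulrN.
Qed.

Lemma zpow_e2pi (a : R) m : zpow (e2pi a) m = e2pi (m%:~R * a).
Proof.
have := has_arg_zpow m (has_arg_e2pi a).
by rewrite {1}/has_arg cabs_zpow cabs_e2pi expr1n mul1r.
Qed.

Lemma ccont_zpow (T : topologicalType) (g : T -> R[i]) m x :
  ccont g x -> ccont (fun t => zpow (g t) m) x.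
Proof. by case: m => n cg; apply: ccontX => //; exact: ccont_conj. Qed.

Lemma zpow_eq0 z m : zpow z m == 0 -> z == 0.
Proof. by rewrite -!cabs_eq0 cabs_zpow expf_eq0 => /andP[]. Qed.

Definition phase z : R[i] := if z == 0 then 1 else ((cabs z)^-1)%:C * z.

Lemma cabs_phase z : cabs (phase z) = 1.
Proof.
rewrite /phase; case: eqVneq => z0; first exact: cabs1.
by rewrite cabsM cabs_real ger0_norm ?invr_ge0 ?cabs_ge0 // mulVf // cabs_eq0.
Qed.

Lemma unit_arg z : cabs z = 1 -> exists a, z = e2pi a.
Proof. by move=> z1; have [a] := has_arg_ex z; rewrite /has_arg z1 mul1r; exists a. Qed.

Lemma has_arg_phase z a : z != 0 -> has_arg z a -> phase z = e2pi a.
Proof.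
move=> z0 ha; rewrite /phase (negbTE z0) {2}ha mulrA -[_%:C * _%:C]rmorphM /= mulVf ?cabs_eq0 //.
by rewrite mul1r.
Qed.

Lemma phase_unit z : cabs z = 1 -> phase z = z.
Proof.
move=> z1; rewrite /phase z1 invr1 mul1r; case: eqVneq => // z0.
by move: z1; rewrite z0 cabs0 => /eqP; rewrite eq_sym oner_eq0.
Qed.

Lemma phase_scale (x : R) z : 0 < x -> phase (x%:C * z) = phase z.
Proof.
move=> x0; have xC : x%:C != 0 by rewrite eq_complex /= eqxx andbT gt_eqF.
rewrite /phase mulf_eq0 (negbTE xC) /=; case: eqVneq => // z0.
rewrite cabsM cabs_real gtr0_norm // invfM mulrA -[_%:C * _%:C]rmorphM /=.
by rewrite mulrAC mulVf ?mul1r ?gt_eqF.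
Qed.

Lemma ccont_phase (T : topologicalType) (g : T -> R[i]) x :
  ccont g x -> g x != 0 -> ccont (fun t => phase (g t)) x.
Proof.
move=> cg g0; have FF : Filter (nbhs x) := nbhs_filter x.
have cc := ccont_cabs cg.
have near0 : \forall t \near x, ((cabs (g t))^-1)%:C * g t = phase (g t).
  have cx : 0 < cabs (g x) by rewrite cabs_gt0.
  have /cvgrPdist_lt/(_ _ cx) := cc; apply: filterS => t /= ht.
  rewrite /phase; case: eqVneq => // gt0; move: ht.
  by rewrite gt0 cabs0 subr0 gtr0_norm // ltxx.
have [cr ci] : ccont (fun t => ((cabs (g t))^-1)%:C * g t) x.
  apply: ccontM => //; apply: ccont_real; apply: continuousV => //.
  by rewrite cabs_eq0.
have congruence (f f' : T -> R) : {for x, continuous f} -> (\forall t \near x, f t = f' t) ->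
    {for x, continuous f'}.
  move=> cf ff'; have e : f x = f' x by exact: nbhs_singleton ff'.
  apply/cvgrPdist_lt => eps eps0; have /cvgrPdist_lt/(_ _ eps0) H := cf.
  by near=> t; rewrite -e -(near ff' t) //; near: t.
split.
  by apply: congruence cr _; apply: filterS near0 => t ->.
by apply: congruence ci _; apply: filterS near0 => t ->.
Unshelve. all: by end_near. Qed.

End UnitPowers.

(** * Coordinates on lens spaces *)

Section LensPoints.
Variables (R : realType) (p q : int).
Hypothesis cpq : coprimez p q.
Implicit Types (u w : R[i]) (b : bool).

Let mr := (egcdz q p).1.
Let ms := (egcdz q p).2.

Lemma lens_bezout : mr * q + ms * p = 1.
Proof.
rewrite /mr /ms; case: (egcdzP q p) => c d /= -> _.
by apply/eqP; rewrite gcdzC.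
Qed.

(** Both pieces are parametrized by D^2 x S^1. On the exterior the point with disk coordinate u has
    second coordinate of modulus sqrt (2 - |u|^2), by the equation of the sphere. *)
Definition rad b u : R := if b then Num.sqrt (2 - cabs u ^+ 2) else 1.

Definition valid u w : Prop := cabs u <= 1 /\ cabs w = 1.

Lemma sqr_rad u : cabs u <= 1 -> rad true u ^+ 2 = 2 - cabs u ^+ 2.
Proof.
move=> u1; rewrite sqr_sqrtr // subr_ge0.
have := cabs_ge0 u; nra.
Qed.

Lemma rad_ge1 b u : cabs u <= 1 -> 1 <= rad b u.
Proof.
case: b => //= u1; have := cabs_ge0 u; have := sqr_rad u1;
  have : 0 <= rad true u by exact: sqrtr_ge0.
rewrite -/(rad true u); nra.
Qed.

Lemma piece_point b u w : valid u w -> piece b ((u, (rad b u)%:C * w) : C2).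
Proof.
move=> [u1 w1]; have r1 := rad_ge1 b u1; have u0 := cabs_ge0 u.
have r0 : 0 <= rad b u by lra.
have cw : cabs ((rad b u)%:C * w) = rad b u by rewrite cabsM w1 mulr1 cabs_real ger0_norm.
case: b r1 r0 cw => r1 r0 cw; rewrite /piece.
  split => /=.
    rewrite /sphere3 /= !cabsE cw -!rmorphXn -rmorphD /= sqr_rad //.
    by rewrite addrC subrK rmorph_nat.
  by rewrite /= !cabsE cw lecR; lra.
by rewrite /solid_torus /= !cabsE cw lecR.
Qed.

Lemma piece_inv b (y : C2) : piece b y -> exists u w, valid u w /\ y = (u, (rad b u)%:C * w).
Proof.
case: y => u y2; case: b => /= [[]|[]] /=; last first.
  rewrite !cabsE lecR => u1 [y21].
  by exists u, y2; rewrite mul1r.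
rewrite /sphere3 /= !cabsE lecR -!rmorphXn -rmorphD /= => e' uy.
have e : cabs u ^+ 2 + cabs y2 ^+ 2 = 2 by apply: complexI; rewrite e' rmorph_nat.
have u0 := cabs_ge0 u; have y0 := cabs_ge0 y2.
have u1 : cabs u <= 1 by nra.
have y2r : cabs y2 = rad true u.
  by rewrite /rad -e addrAC subrr add0r sqrtr_sqr ger0_norm.
have yn0 : y2 != 0 by rewrite -cabs_gt0 y2r; have := rad_ge1 true u1; lra.
have [a ha] := has_arg_ex y2.
exists u, (e2pi a); split; first by split => //; rewrite cabs_e2pi.
by rewrite {1}ha y2r.
Qed.

Definition raw_point b u w (h : valid u w) : pieces (R := R) :=
  existT (fun b => piece b) b (exist (fun y => y \in piece b) _ (mem_set (piece_point b h))).

Lemma valid01 : valid 0 1.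
Proof. by split; rewrite ?cabs0 ?cabs1. Qed.

(* [u] is the coordinate on the meridian disk and [w] the core angle. *)
Definition lpt b u w : lens (R := R) p q :=
  if pselect (valid u w) is left h then \pi_(lens p q) (raw_point b h)
  else \pi_(lens p q) (raw_point b valid01).

Lemma lptE b u w (h : valid u w) : lpt b u w = \pi_(lens p q) (raw_point b h).
Proof.
rewrite /lpt; case: pselect => // h'; congr (\pi_(lens p q) (raw_point b _)).
exact: Prop_irrelevance.
Qed.

Lemma raw_inv (x : pieces (R := R)) : exists b u w (h : valid u w), x = raw_point b h.
Proof.
case: x => b [y yb]; have [u [w [h e]]] := piece_inv (set_mem yb).
exists b, u, w, h; rewrite /raw_point; congr existT; apply: val_inj; exact: e.
Qed.

Lemma lpt_cases (x : lens (R := R) p q) : exists b u w, valid u w /\ x = lpt b u w.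
Proof.
have [b [u [w [h e]]]] := raw_inv (repr x).
by exists b, u, w; split => //; rewrite (lptE b h) -e reprK.
Qed.

Lemma exprz_e2pi (a : R) (m : int) : e2pi a ^ m = e2pi (m%:~R * a).
Proof. by rewrite -e2piMz -mulrzr mulrC. Qed.

Lemma rad_unit b u : cabs u = 1 -> rad b u = 1.
Proof. by case: b => //= u1; rewrite u1 expr1n (_ : 2 - 1 = 1 :> R) ?sqrtr1 //; ring. Qed.

Lemma gluing_e2pi (a c : R) : surgery_gluing p q ((e2pi a, e2pi c) : C2) =
  (e2pi (q%:~R * a + ms%:~R * c), e2pi ((- p)%:~R * a + mr%:~R * c)).
Proof.
rewrite /surgery_gluing /mr /ms; case: (egcdz q p) => r s /=.
by rewrite !exprz_e2pi -!e2piD.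
Qed.

Lemma lpt_glue (a c : R) : lpt false (e2pi a) (e2pi c) =
  lpt true (e2pi (q%:~R * a + ms%:~R * c)) (e2pi ((- p)%:~R * a + mr%:~R * c)).
Proof.
have val2 x y : valid (e2pi x) (e2pi y) by split; rewrite cabs_e2pi.
rewrite (lptE _ (val2 _ _)) (lptE _ (val2 _ _)).
apply/eqmodP; rewrite /= /glued /glue /=.
have radE x : Num.sqrt (2 - cabs (e2pi x) ^+ 2) = 1 :> R.
  exact: (rad_unit true (cabs_e2pi x)).
by rewrite normr_e2pi eqxx !mul1r radE mul1r gluing_e2pi.
Qed.

(** The rows give the angles (disk, core) of the opposite piece in terms of those of the piece [b]
    on the gluing torus. The entry at [false] is the gluing matrix, of determinant 1 by Bezout, and
    the entry at [true] is its inverse. *)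
Definition lens_pair (b : bool) : (int * int) * (int * int) :=
  if b then ((mr, - ms), (p, q)) else ((q, ms), (- p, mr)).

Lemma unimodular_inv (F : comRingType) (k l m n : F) : k * n - l * m = 1 ->
  forall a c, k * (n * a - l * c) + l * (- m * a + k * c) = a /\
    m * (n * a - l * c) + n * (- m * a + k * c) = c.
Proof.
move=> d a c; split.
  by rewrite -[RHS]mul1r -d; ring.
by rewrite -[RHS]mul1r -d; ring.
Qed.

Definition lin (m : int * int) (a c : R) : R := m.1%:~R * a + m.2%:~R * c.

Lemma lin_inv b (a c : R) :
  lin (lens_pair (~~ b)).1 (lin (lens_pair b).1 a c) (lin (lens_pair b).2 a c) = a /\
  lin (lens_pair (~~ b)).2 (lin (lens_pair b).1 a c) (lin (lens_pair b).2 a c) = c.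
Proof.
have bz : mr%:~R * q%:~R + ms%:~R * p%:~R = 1 :> R.
  by rewrite -!rmorphM -rmorphD /= lens_bezout.
rewrite /lin; case: b => /=; rewrite !rmorphN /=.
  have d : q%:~R * mr%:~R - ms%:~R * - p%:~R = 1 :> R by rewrite mulrN opprK mulrC bz.
  by have := unimodular_inv d a c; rewrite opprK !mulNr.
have d : mr%:~R * q%:~R - - ms%:~R * p%:~R = 1 :> R by rewrite mulNr opprK bz.
by have := unimodular_inv d a c; rewrite !mulNr !opprK.
Qed.

Lemma lpt_glueE b (a c : R) :
  lpt b (e2pi a) (e2pi c) =
  lpt (~~ b) (e2pi (lin (lens_pair b).1 a c)) (e2pi (lin (lens_pair b).2 a c)).
Proof.
case: b; last exact: lpt_glue.
rewrite lpt_glue -/(lin (lens_pair false).1 _ _) -/(lin (lens_pair false).2 _ _).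
by have [-> ->] := lin_inv true a c.
Qed.

Definition in_piece b u w (h : valid u w) : piece b :=
  exist (fun y => y \in piece b) _ (mem_set (piece_point b h)).

Lemma piece_continuous b (T : topologicalType) (u w : T -> R[i]) x
    (h : forall t, valid (u t) (w t)) : ccont u x -> ccont w x ->
  {for x, continuous (fun t => in_piece b (h t))}.
Proof.
move=> cu cw.
have crad : {for x, continuous (fun t => rad b (u t))}.
  case: b; last exact: cst_continuous.
  apply: (@continuous_comp _ _ _ (fun t => 2 - cabs (u t) ^+ 2) (@Num.sqrt R));
    last exact: sqrt_continuous.
  apply: continuousB; first exact: cst_continuous.
  by apply: continuousM; exact: ccont_cabs.
pose y t : C2 := (u t, (rad b (u t))%:C * w t).
have cy : {for x, continuous (y : T -> C2)}.
  have c1 : {for x, continuous (u : T -> R[i]^o)} by exact/ccontE.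
  have c2 : {for x, continuous ((fun t => (rad b (u t))%:C * w t) : T -> R[i]^o)}.
    by apply/ccontE/ccontM => //; exact: ccont_real.
  by have FF : Filter (nbhs x) := nbhs_filter x; exact: (cvg_pair c1 c2).
move=> U [? /= [[W oW <-]]] /= Wx HU.
have : nbhs x (y @^-1` W) by apply: cy; exact: open_nbhs_nbhs.
by apply: (@filterS _ (nbhs x) (nbhs_filter x)) => t Wt; apply: HU.
Qed.

Lemma lpt_continuous b (T : topologicalType) (u w : T -> R[i]) x :
  (forall t, valid (u t) (w t)) -> ccont u x -> ccont w x ->
  {for x, continuous (fun t => lpt b (u t) (w t))}.
Proof.
move=> h cu cw.
have -> : (fun t => lpt b (u t) (w t)) = (fun t => \pi_(lens p q) (raw_point b (h t))).
  by apply/funext => t; rewrite (lptE _ (h t)).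
apply: (@continuous_comp _ _ _ (fun t => raw_point b (h t)) (\pi_(lens p q)));
  last exact: pi_continuous.
apply: (@continuous_comp _ _ _ (fun t => in_piece b (h t)) (existT (fun b => piece b) b)) => //.
exact: piece_continuous.
Qed.

(** The descent condition for a function given separately in the coordinates of each piece:
    agreement on the gluing torus. *)
Definition compat (F : bool -> R[i] -> R[i] -> R[i]) : Prop :=
  forall a c : R, F false (e2pi a) (e2pi c) =
    F true (e2pi (lin (lens_pair false).1 a c)) (e2pi (lin (lens_pair false).2 a c)).

Definition on_pieces (F : bool -> R[i] -> R[i] -> R[i]) (y : pieces (R := R)) : R[i] :=
  F (projT1 y) (val (projT2 y)).1 (phase (val (projT2 y)).2).

Definition descend (F : bool -> R[i] -> R[i] -> R[i]) (x : lens (R := R) p q) : R[i] :=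
  on_pieces F (repr x).

Lemma on_piecesE F b u w (h : valid u w) : on_pieces F (raw_point b h) = F b u w.
Proof.
rewrite /on_pieces /= phase_scale ?phase_unit //; first by case: h.
by have := rad_ge1 b h.1; lra.
Qed.

Lemma on_pieces_glued F : compat F ->
  forall y y', \pi_(lens p q) y = \pi_(lens p q) y' -> on_pieces F y = on_pieces F y'.
Proof.
move=> cF.
(* The value read off from [glue p q y] instead of [y]; it visibly depends only on the class of
   [y]. *)
pose nf (y : pieces (R := R)) := if ~~ (glue p q y).1 then F false (glue p q y).2.1 (phase (glue
  p q y).2.2)
  else F true (glue p q y).2.1 (phase (glue p q y).2.2).
have nfE y : on_pieces F y = nf y.
  have [b [u [w [h ->]]]] := raw_inv y; rewrite on_piecesE.
  rewrite /nf /glue /=; case: b h => h /=.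
    by rewrite -/(rad true u) phase_scale ?phase_unit //; [case: h | have := rad_ge1 true h.1;
      lra].
  have [u1 w1] := h; case: eqVneq => [u1'|_] /=; last by rewrite mul1r phase_unit.
  have {}u1' : cabs u = 1 by apply: complexI; rewrite -cabsE.
  have [a ->] := unit_arg u1'; have [c ->] := unit_arg w1.
  by rewrite mul1r gluing_e2pi /= phase_unit ?cabs_e2pi // cF.
by move=> y y' /eqmodP /eqP e; rewrite !nfE /nf e.
Qed.

Lemma descendE F b u w : compat F -> valid u w -> descend F (lpt b u w) = F b u w.
Proof.
move=> cF h; rewrite (lptE _ h) /descend -(on_piecesE F b h).
by apply: on_pieces_glued => //; rewrite reprK.
Qed.

Lemma descend_continuous F : compat F ->
  (forall b (T : topologicalType) (u w : T -> R[i]) x, (forall t, valid (u t) (w t)) ->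
     ccont u x -> ccont w x -> ccont (fun t => F b (u t) (w t)) x) ->
  ccontinuous (descend F).
Proof.
move=> cF contF.
suff c : continuous (descend F : lens (R := R) p q -> R[i]^o) by move=> x; apply/ccontE; exact: c.
apply: (@repr_comp_continuous _ _ _ (on_pieces F : pieces (R := R) -> R[i]^o)); last first.
  by move=> y y' /eqP e; apply/eqP; exact: on_pieces_glued.
move=> [b y].
suff : {for y, continuous (fun t : piece b => (F b (val t).1 (phase (val t).2) : R[i]^o))}.
  by move=> cb U nU; exact: (cb U nU).
apply/ccontE.
have vy (t : piece b) : valid (val t).1 (phase (val t).2).
  have [u [w [h ->]]] := piece_inv (set_mem (valP t)); rewrite /= phase_scale ?phase_unit //.
    by case: h.
  by have := rad_ge1 b h.1; lra.
have cval : {for y, continuous (val : piece b -> C2)} by exact: initial_continuous.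
have c1 : ccont (fun t : piece b => (val t).1) y.
  apply/ccontE; apply: (@continuous_comp _ _ _ (val : piece b -> C2) (fst : C2 -> R[i]^o)) => //.
  exact: cvg_fst.
have c2 : ccont (fun t : piece b => (val t).2) y.
  apply/ccontE; apply: (@continuous_comp _ _ _ (val : piece b -> C2) (snd : C2 -> R[i]^o)) => //.
  exact: cvg_snd.
apply: contF => //; apply: ccont_phase => //.
have [u [w [h ->]]] := piece_inv (set_mem (valP y)).
rewrite -cabs_gt0 cabsM h.2 mulr1 cabs_real; have := rad_ge1 b h.1; rewrite normr_gt0.
by move=> r1; rewrite gt_eqF //; lra.
Qed.

End LensPoints.

(** * The two open solid tori and their charts *)

Section LensCharts.
Variables (R : realType) (p q : int).
Hypothesis cpq : coprimez p q.
Implicit Types (u w : R[i]) (b : bool).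
Local Notation W := (lens (R := R) p q).
Local Notation pair := (lens_pair p q).

(** A function vanishing exactly on the core of the piece opposite to [b], whatever the exponents in
    the gluing matrix are. *)
Definition depth_piece b b' u w : R[i] := if b' == b then 1 else (cabs u)%:C.
Definition turn_piece b b' u w : R[i] :=
  if b' == b then w else zpow u (pair b').2.1 * zpow w (pair b').2.2.
Definition disk_piece b b' u w : R[i] :=
  if b' == b then u else zpow u (pair b').1.1 * zpow w (pair b').1.2.

Lemma zpow_lin (m : int * int) (a c : R) : zpow (e2pi a) m.1 * zpow (e2pi c) m.2 =
  e2pi (lin m a c).
Proof. by rewrite !zpow_e2pi -e2piD. Qed.

Let tf : (true == false) = false. Proof. by []. Qed.
Let ft : (false == true) = false. Proof. by []. Qed.

Lemma depth_compat b : compat p q (depth_piece b).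
Proof. by move=> a c; rewrite /depth_piece; case: b => /=; rewrite cabs_e2pi. Qed.

Lemma turn_compat b : compat p q (turn_piece b).
Proof.
move=> a c; rewrite /turn_piece; case: b; rewrite eqxx ?tf ?ft zpow_lin //.
by rewrite -[in LHS](lin_inv cpq false a c).2.
Qed.

Lemma disk_compat b : compat p q (disk_piece b).
Proof.
move=> a c; rewrite /disk_piece; case: b; rewrite eqxx ?tf ?ft zpow_lin //.
by rewrite -[in LHS](lin_inv cpq false a c).1.
Qed.

Definition depth b : W -> R[i] := descend (depth_piece b).
(* [ang b] and [disk b] extend the coordinates of the piece [b] to the other piece,
   with zeros only on its core. *)
Definition ang b : W -> R[i] := descend (turn_piece b).
Definition disk b : W -> R[i] := descend (disk_piece b).

Lemma depthE b b' u w : valid u w -> depth b (lpt p q b' u w) = depth_piece b b' u w.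
Proof. exact: descendE (@depth_compat b). Qed.

Lemma angE b b' u w : valid u w -> ang b (lpt p q b' u w) = turn_piece b b' u w.
Proof. exact: descendE (@turn_compat b). Qed.

Lemma diskE b b' u w : valid u w -> disk b (lpt p q b' u w) = disk_piece b b' u w.
Proof. exact: descendE (@disk_compat b). Qed.

Lemma depth_continuous b : ccontinuous (depth b).
Proof.
apply: (descend_continuous (@depth_compat b)) => b' T u w x h cu cw.
rewrite /depth_piece; case: (b' == b); first exact: ccont_cst.
by apply: ccont_real; exact: ccont_cabs.
Qed.

Lemma ang_continuous b : ccontinuous (ang b).
Proof.
apply: (descend_continuous (@turn_compat b)) => b' T u w x h cu cw.
by rewrite /turn_piece; case: (b' == b) => //; apply: ccontM; exact: ccont_zpow.
Qed.

Lemma disk_continuous b : ccontinuous (disk b).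
Proof.
apply: (descend_continuous (@disk_compat b)) => b' T u w x h cu cw.
by rewrite /disk_piece; case: (b' == b) => //; apply: ccontM; exact: ccont_zpow.
Qed.

(* [Y b] is the complement of the core of the other solid torus. *)
Definition Y b : set W := [set x | depth b x != 0].

Lemma zpow_neq0 z m : z != 0 -> zpow z m != 0 :> R[i].
Proof. by apply: contraNN => /zpow_eq0. Qed.

Lemma unit_neq0 w : cabs w = 1 -> w != 0.
Proof. by move=> w1; rewrite -cabs_eq0 w1 oner_eq0. Qed.

Lemma ang_neq0 b x : Y b x -> ang b x != 0.
Proof.
have [b' [u [w [h ->]]]] := lpt_cases x.
rewrite /Y /= depthE // angE // /depth_piece /turn_piece; case: (b' == b).
  by move=> _; apply: unit_neq0; case: h.
rewrite eq_complex /= eqxx andbT cabs_eq0 => u0.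
by apply: mulf_neq0; apply: zpow_neq0 => //; apply: unit_neq0; case: h.
Qed.

Lemma Y_cover : Y true `|` Y false = setT.
Proof.
apply/seteqP; split => // x _.
have [b' [u [w [h ->]]]] := lpt_cases x.
by rewrite /Y; case: b' h => h; [left|right]; rewrite /= depthE // /depth_piece eqxx oner_eq0.
Qed.

Lemma Y_open b : open (Y b).
Proof.
rewrite openE => x Yx; have FF : Filter (nbhs x) := nbhs_filter x.
have c : 0 < cabs (depth b x) by rewrite cabs_gt0.
have /cvgrPdist_lt/(_ _ c) := ccont_cabs (@depth_continuous b x).
apply: filterS => y /=; apply: contraTN => /eqP ->.
by rewrite cabs0 subr0 gtr0_norm // ltxx.
Qed.

Definition clip (x : R) : R := Num.min 1 (Num.max 0 (2 - x)).

Definition chart_out b (e : R * R * R) : W :=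
  let v := e.1.1 +i* e.1.2 in
  lpt p q (~~ b) ((clip (cabs v))%:C * (zpow (phase v) (pair b).1.1 * zpow (e2pi e.2) (pair
    b).1.2))
      (zpow (phase v) (pair b).2.1 * zpow (e2pi e.2) (pair b).2.2).

Definition chart_in b (e : R * R * R) : W :=
  let v := e.1.1 +i* e.1.2 in lpt p q b (((Num.max 1 (cabs v))^-1)%:C * v) (e2pi e.2).

(** Coordinates (v, t) on the universal cover of [Y b]. The piece [b] is |v| <= 1; the other piece
    without its core is 1 <= |v| < 2, at radius 2 - |v|. The clipping past 2 makes the map total and
    continuous on R^3, so that paths can be contracted to the origin. *)
Definition chart b (e : R * R * R) : W :=
  if cabs (e.1.1 +i* e.1.2) <= 1 then chart_in b e else chart_out b e.

Lemma clip01 x : 0 <= clip x <= 1.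
Proof. by rewrite /clip le_min ler01 le_max lexx /= ge_min lexx. Qed.

Lemma clip_ge1 x : 1 <= x <= 2 -> clip x = 2 - x.
Proof. by move=> /andP[x1 x2]; rewrite /clip max_r ?min_r //; lra. Qed.

Lemma valid_out b (v : R[i]) (t : R) :
  valid ((clip (cabs v))%:C * (zpow (phase v) (pair b).1.1 * zpow (e2pi t) (pair b).1.2))
      (zpow (phase v) (pair b).2.1 * zpow (e2pi t) (pair b).2.2).
Proof.
have /andP[c0 c1] := clip01 (cabs v).
by split; rewrite !cabsM ?cabs_real !cabs_zpow cabs_phase cabs_e2pi !expr1n ?mulr1 // ger0_norm.
Qed.

Lemma valid_in (v : R[i]) (t : R) : valid (((Num.max 1 (cabs v))^-1)%:C * v) (e2pi t).
Proof.
have m0 : 0 < Num.max 1 (cabs v) by rewrite lt_max ltr01.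
split; last exact: cabs_e2pi.
have mi : 0 <= (Num.max 1 (cabs v))^-1 by rewrite invr_ge0 ltW.
rewrite cabsM cabs_real (ger0_norm mi) ler_pdivrMl // mulr1.
by rewrite le_max lexx orbT.
Qed.

Lemma coord_v_continuous (e : R * R * R) : ccont (fun e : R * R * R => e.1.1 +i* e.1.2) e.
Proof.
split => /=.
  apply: (@continuous_comp _ _ _ (fst : R * R * R -> R * R) fst); exact: cvg_fst.
apply: (@continuous_comp _ _ _ (fst : R * R * R -> R * R) snd); [exact: cvg_fst|exact: cvg_snd].
Qed.

Lemma coord_t_continuous (e : R * R * R) : {for e, continuous (fun e : R * R * R => e.2)}.
Proof. exact: cvg_snd. Qed.

Lemma chart_in_continuous b : continuous (chart_in b).
Proof.
move=> e.
apply: (@lpt_continuous R p q b (R * R * R)%type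
  (fun e => ((Num.max 1 (cabs (e.1.1 +i* e.1.2)))^-1)%:C * (e.1.1 +i* e.1.2)) (fun e => e2pi
    e.2) e).
- by move=> f; exact: valid_in.
- apply: ccontM; last exact: coord_v_continuous.
  apply: ccont_real; apply: continuousV; first by rewrite gt_eqF // lt_max ltr01.
  apply: continuous_max; first exact: cst_continuous.
  by apply: ccont_cabs; exact: coord_v_continuous.
- by apply: ccont_e2pi; exact: coord_t_continuous.
Qed.

Lemma clip_continuous : continuous clip.
Proof.
move=> x; apply: (@continuous_min R R (fun=> 1) (fun x => Num.max 0 (2 - x)) x);
  first exact: cst_continuous.
apply: (@continuous_max R R (fun=> 0) (fun x => 2 - x) x); first exact: cst_continuous.
by apply: continuousB; [exact: cst_continuous|].
Qed.

Lemma chart_out_continuous b (e : R * R * R) : e.1.1 +i* e.1.2 != 0 ->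
  {for e, continuous (chart_out b)}.
Proof.
move=> e0.
have cv := coord_v_continuous e.
have cp : ccont (fun e : R * R * R => phase (e.1.1 +i* e.1.2)) e by exact: ccont_phase.
have ct : ccont (fun e : R * R * R => e2pi e.2) e by apply: ccont_e2pi; exact: coord_t_continuous.
apply: (@lpt_continuous R p q (~~ b) (R * R * R)%type
  (fun e => (clip (cabs (e.1.1 +i* e.1.2)))%:C * (zpow (phase (e.1.1 +i* e.1.2)) (pair b).1.1 *
    zpow (e2pi e.2) (pair b).1.2))
  (fun e => zpow (phase (e.1.1 +i* e.1.2)) (pair b).2.1 * zpow (e2pi e.2) (pair b).2.2) e).
- by move=> f; exact: valid_out.
- apply: ccontM; last by apply: ccontM; exact: ccont_zpow.
  apply: ccont_real; apply: (@continuous_comp _ _ _ (fun e : R * R * R => cabs (e.1.1 +i*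
    e.1.2)) clip).
    exact: ccont_cabs.
  exact: clip_continuous.
- by apply: ccontM; exact: ccont_zpow.
Qed.

Lemma continuous_two (T U : topologicalType) (f g h : T -> U) x :
  {for x, continuous f} -> {for x, continuous g} -> f x = g x -> h x = f x ->
  (forall y, h y = f y \/ h y = g y) -> {for x, continuous h}.
Proof.
move=> cf cg fg hf H A; rewrite hf => Afx.
have Fx : nbhs x (f @^-1` A) := cf _ Afx.
have Gx : nbhs x (g @^-1` A) by apply: cg; rewrite -fg.
apply: (@filterS _ (nbhs x) (nbhs_filter x)) (@filterI _ (nbhs x) (nbhs_filter x) _ _ Fx Gx).
by move=> y [/= fy gy]; case: (H y) => ->.
Qed.

Lemma chart_glue b (e : R * R * R) : cabs (e.1.1 +i* e.1.2) = 1 -> chart_in b e = chart_out b e.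
Proof.
move=> v1; rewrite /chart_in /chart_out v1.
have [a ea] := unit_arg v1; rewrite ea phase_unit ?cabs_e2pi // !zpow_lin.
by rewrite maxxx invr1 mul1r clip_ge1 ?lexx ?ler1n // (_ : 2 - 1 =
  1 :> R) ?mul1r -?lpt_glueE //; ring.
Qed.

Lemma chart_continuous b : continuous (chart b).
Proof.
move=> e; have cv := ccont_cabs (coord_v_continuous e).
have FF : Filter (nbhs e) := nbhs_filter e.
have H f : chart b f = chart_in b f \/ chart b f = chart_out b f.
  by rewrite /chart; case: ifP; [left|right].
have [v1|v1|v1] := ltgtP (cabs (e.1.1 +i* e.1.2)) 1.
- have near_in : \forall f \near e, chart_in b f = chart b f.
    have d : 0 < 1 - cabs (e.1.1 +i* e.1.2) by rewrite subr_gt0.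
    have /cvgrPdist_lt/(_ _ d) := cv; apply: filterS => f /=.
    by rewrite ltr_norml => /andP[h1 h2]; rewrite /chart ifT //; lra.
  move=> A; rewrite {1}/chart ifT 1?ltW // => Ae.
  have := @chart_in_continuous b e _ Ae; rewrite /= => Ae'.
  apply: (@filterS _ (nbhs e) FF) (@filterI _ (nbhs e) FF _ _ near_in Ae') => f /= [fe Af].
  by rewrite -fe.
- have near_out : \forall f \near e, chart_out b f = chart b f.
    have d : 0 < cabs (e.1.1 +i* e.1.2) - 1 by rewrite subr_gt0.
    have /cvgrPdist_lt/(_ _ d) := cv; apply: filterS => f /=.
    rewrite ltr_norml => /andP[h1 h2]; rewrite /chart ifF //.
    by apply/negbTE; rewrite -ltNge; lra.
  move=> A; rewrite {1}/chart ifF => [Ae|]; last by apply/negbTE; rewrite -ltNge.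
  have e0 : e.1.1 +i* e.1.2 != 0 by rewrite -cabs_gt0; lra.
  have := @chart_out_continuous b e e0 _ Ae; rewrite /= => Ae'.
  apply: (@filterS _ (nbhs e) FF) (@filterI _ (nbhs e) FF _ _ near_out Ae') => f /= [fe Af].
  by rewrite -fe.
- have e0 : e.1.1 +i* e.1.2 != 0 by rewrite -cabs_gt0; lra.
  apply: (@continuous_two _ _ (chart_in b) (chart_out b)) => //.
  + exact: chart_in_continuous.
  + exact: chart_out_continuous.
  + exact: chart_glue.
  + by rewrite /chart v1 lexx.
Qed.

(** The coordinate v of the chart. On the opposite piece at radius r, [disk b] has modulus a power
    of r; dividing by it and multiplying by 2 - r restores the modulus of v. *)
Definition chart_inv b (x : W) : R[i] :=
  ((2 - cabs (depth b x)) / cabs (depth b x) ^+ `|(pair (~~ b)).1.1|)%:C * disk b x.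

Lemma chart_outE b (e : R * R * R) : 1 <= cabs (e.1.1 +i* e.1.2) -> chart b e = chart_out b e.
Proof.
rewrite le_eqVlt => /predU1P[/esym v1|v1].
  by rewrite -chart_glue // /chart v1 lexx.
by rewrite /chart ifF //; apply/negbTE; rewrite -ltNge.
Qed.

Lemma has_arg_unit w t : cabs w = 1 -> has_arg w t -> w = e2pi t.
Proof. by rewrite /has_arg => -> ->; rewrite mul1r. Qed.

Lemma complex_eta (z : R[i]) : complex.Re z +i* complex.Im z = z.
Proof. by case: z. Qed.

Lemma chart_invK b (x : W) t : Y b x -> has_arg (ang b x) t ->
  chart b (complex.Re (chart_inv b x), complex.Im (chart_inv b x), t) = x.
Proof.
have [b' [u [w [h ->]]]] := lpt_cases x; have [u1 w1] := h.
rewrite /Y /= depthE // angE // /chart_inv depthE // diskE // /depth_piece /turn_piece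
  /disk_piece.
case: (eqVneq b' b) => [->|b'b] /=.
  move=> _ /(has_arg_unit w1) wt.
  have -> : ((2 - cabs (1 : R[i])) / cabs (1 : R[i]) ^+ `|(pair (~~ b)).1.1|)%:C * u = u.
    by rewrite cabs1 expr1n divr1 (_ : 2 - 1 = 1 :> R) ?mul1r //; ring.
  rewrite /chart /= complex_eta u1 /chart_in /= complex_eta.
  by rewrite max_l // invr1 mul1r -wt.
have {b'b} -> : b' = ~~ b by case: b b' b'b => -[].
rewrite eq_complex /= eqxx andbT cabs_eq0 => u0.
have [a ua] := has_arg_ex u; have [c wc] := unit_arg w1.
have r0 : 0 < cabs u by rewrite cabs_gt0.
set r := cabs u in ua u1 r0 *; set m := pair (~~ b) => ht.
have t' : e2pi t = e2pi (lin m.2 a c).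
  apply/e2pi_eq; apply: has_arg_eq ht _.
    by apply: mulf_neq0; apply: zpow_neq0 => //; exact: unit_neq0.
  apply: has_argM; apply: has_arg_zpow; first exact: ua.
  by rewrite wc; exact: has_arg_e2pi.
have vE : ((2 - cabs r%:C) / cabs r%:C ^+ `|m.1.1|)%:C * (zpow u m.1.1 * zpow w m.1.2) =
    (2 - r)%:C * e2pi (lin m.1 a c).
  have -> : zpow u m.1.1 = (r ^+ `|m.1.1|)%:C * e2pi (m.1.1%:~R * a).
    by rewrite {1}(has_arg_zpow m.1.1 ua) cabs_zpow.
  rewrite wc zpow_e2pi cabs_real gtr0_norm // /lin e2piD.
  rewrite [in LHS]rmorphM fmorphV /=.
  rewrite -!mulrA mulKf //.
  by rewrite eq_complex /= eqxx andbT expf_neq0 // gt_eqF.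
have r2 : 0 < 2 - r by lra.
have cv : cabs ((2 - r)%:C * e2pi (lin m.1 a c)) = 2 - r.
  by rewrite cabsM cabs_real cabs_e2pi mulr1 gtr0_norm.
have pz : phase ((2 - r)%:C * e2pi (lin m.1 a c)) = e2pi (lin m.1 a c).
  by rewrite phase_scale // phase_unit ?cabs_e2pi.
rewrite vE; move: (_%:C * e2pi (lin m.1 a c)) cv pz => z cv pz.
rewrite chart_outE /chart_out /= complex_eta cv; last by lra.
rewrite clip_ge1; last by apply/andP; split; lra.
rewrite pz t' !zpow_lin.
have [e1 e2] := lin_inv (R := R) cpq (~~ b) a c; rewrite negbK in e1 e2.
rewrite e1 e2 -wc; congr lpt.
by rewrite [RHS]ua subKr.
Qed.

Lemma chart_inv_simplex_continuous n b (s : simplex R n W) : range s `<=` Y b ->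
  ccontinuous (fun x => chart_inv b (s x)).
Proof.
move=> sY x.
have cs : continuous s by exact: cts_fun.
have cD := ccont_cabs (ccont_comp cs (@depth_continuous b) x).
apply: ccontM; last exact: ccont_comp cs (@disk_continuous b) x.
apply: ccont_real; apply: continuousM.
  by apply: continuousB; [exact: cst_continuous|exact: cD].
apply: continuousV.
  by rewrite expf_neq0 // cabs_eq0; apply: sY; exists x.
move: (`|_|%N) => k; elim: k => [|k IH].
  have -> : (fun x => cabs (depth b (s x)) ^+ 0) = fun=> 1 by apply/funext => y; rewrite expr0.
  exact: cst_continuous.
have -> : (fun x => cabs (depth b (s x)) ^+ k.+1) =
  fun x => cabs (depth b (s x)) * cabs (depth b (s x)) ^+ k.
  by apply/funext => y; rewrite exprS.
by apply: continuousM.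
Qed.

End LensCharts.

(** * First cohomology of lens spaces *)

Section OneCochains.
Variables (R : realType) (X : topologicalType).
Local Notation Delta := (std_simplex R).

Definition simplex_of n (f : Delta n -> X) (cf : continuous f) : simplex R n X := mkcts cf.

Lemma face_simplex_of n (f : Delta n.+1 -> X) (cf : continuous f) i t :
  face i (simplex_of cf) t = f (affine_map (fintype.lift i) t).
Proof. by []. Qed.

(** The coboundary of [f], regarded as a 0-cochain on points. *)
Definition path_diff (f : X -> R) (s : simplex R 1 X) : R := f (s (vert R 1)) - f (s (vert R 0)).

Lemma cob1E (a : simplex R 1 X -> R) (s : simplex R 2 X) :
  cob a s = a (face 0 s) - a (face 1 s) + a (face (inord 2) s).
Proof.
rewrite /cob !big_ord_recl big_ord0 /= addr0 expr0 mul1r expr1 mulN1r.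
rewrite (_ : (-1) ^+ _ = 1); last by rewrite /= /bump /= expr2 mulrNN mulr1.
rewrite mul1r -addrA; congr (_ + (- a (face _ s) + a (face _ s))); apply: val_inj => //=.
by rewrite inordK.
Qed.

Lemma face_at n (s : simplex R n.+1 X) i t : face i s t =
  s (comb (@vert R n.+1 \o fintype.lift i) t).
Proof. by rewrite /face restrictE. Qed.

Lemma cob_path_diff (f : X -> R) (s : simplex R 2 X) : cob (path_diff f) s = 0.
Proof.
rewrite cob1E /path_diff !face_at !comb_vert /=.
have e (i : 'I_3) (j : 'I_2) k : (bump i j = k)%N ->
  vert R (fintype.lift i j) = vert R (inord k : 'I_3).
  by move=> <-; congr vert; apply: val_inj; rewrite /= inordK //;
    exact: (ltn_ord (fintype.lift i j)).
rewrite (e _ _ 2) // (e _ _ 1) // (e _ _ 2) // (e _ _ 0) // (e _ _ 1) ?(e _ _ 0) //=;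
  rewrite /bump ?inordK //=.
by ring.
Qed.

Definition const_simplex n (x : X) : simplex R n X := cst x.

Lemma face_const n i x : face i (const_simplex n.+1 x) = const_simplex n x.
Proof. by apply/continuousEP. Qed.

Lemma cocycle_const (a : simplex R 1 X -> R) x :
  (forall s, cob a s \is a Num.int) -> a (const_simplex 1 x) \is a Num.int.
Proof.
move=> ca; have := ca (const_simplex 2 x); rewrite cob1E !face_const.
by rewrite subrr add0r.
Qed.

End OneCochains.

(** * Contracting lifted paths in a chart *)

Section Rays.
Variables (R : realType) (X : topologicalType) (chi : R * R * R -> X).
Hypothesis cchi : continuous chi.
Local Notation Delta := (std_simplex R).
Implicit Types (e : R * R * R).

Definition scale3 (k : R) e : R * R * R := (k * e.1.1, k * e.1.2, k * e.2).

Lemma triple_continuous (T : topologicalType) (x y z : T -> R) t :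
  {for t, continuous x} -> {for t, continuous y} -> {for t, continuous z} ->
  {for t, continuous (fun t => (x t, y t, z t))}.
Proof.
move=> cx cy cz; have FF : Filter (nbhs t) := nbhs_filter t.
exact: (cvg_pair (cvg_pair cx cy) cz).
Qed.

Lemma chi_continuous n (x y z : Delta n -> R) :
  continuous x -> continuous y -> continuous z -> continuous (fun t => chi (x t, y t, z t)).
Proof.
move=> cx cy cz t.
apply: (@continuous_comp _ _ _ (fun t => (x t, y t, z t)) chi); last exact: cchi.
by apply: triple_continuous; [exact: cx|exact: cy|exact: cz].
Qed.

Lemma ray_continuous e : continuous (fun t : Delta 1 => chi (scale3 (val t 0 1) e)).
Proof.
have c k : continuous (fun t : Delta 1 => val t 0 1 * k).
  by move=> t; apply: continuousM; [exact: (@coord_simplex_continuous R 1 1 t)|exact: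
    cst_continuous].
exact: chi_continuous (c e.1.1) (c e.1.2) (c e.2).
Qed.

Definition ray e : simplex R 1 X := simplex_of (@ray_continuous e).

Section Homotopy.
Variables (x y z : Delta 1 -> R).
Hypotheses (cx : continuous x) (cy : continuous y) (cz : continuous z).
Let lift3 (t : Delta 1) := (x t, y t, z t).

Lemma triangle_continuous (f : 'I_3 -> 'I_2) (u : Delta 2 -> R) : continuous u ->
  continuous (fun t : Delta 2 => chi (scale3 (u t) (lift3 (affine_map f t)))).
Proof.
move=> cu.
have c (h : Delta 1 -> R) : continuous h -> continuous (fun t : Delta 2 => u t * h (affine_map f
  t)).
  move=> ch t; apply: continuousM; first exact: cu.
  by apply: continuous_comp; [exact: affine_map_continuous|exact: ch].
exact: chi_continuous (c _ cx) (c _ cy) (c _ cz).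
Qed.

Lemma u1_continuous : continuous (fun t : Delta 2 => 1 - val t 0 0).
Proof.
move=> t; apply: continuousB; first exact: cst_continuous.
exact: (@coord_simplex_continuous R 2 0 t).
Qed.

Lemma u2_continuous : continuous (fun t : Delta 2 => val t 0 (inord 2)).
Proof. exact: (@coord_simplex_continuous R 2 (inord 2)). Qed.

Definition fold1 (i : 'I_3) : 'I_2 := if i == inord 2 then 1 else 0.
Definition fold2 (i : 'I_3) : 'I_2 := if i == 0 then 0 else 1.

Lemma diag_continuous : continuous (fun t : Delta 1 => chi (scale3 (val t 0 1) (lift3 t))).
Proof.
have c (h : Delta 1 -> R) : continuous h -> continuous (fun t : Delta 1 => val t 0 1 * h t).
  by move=> ch t; apply: continuousM; [exact: (@coord_simplex_continuous R 1 1 t)|exact: ch].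
exact: chi_continuous (c _ cx) (c _ cy) (c _ cz).
Qed.

Variable s : simplex R 1 X.
Hypothesis sE : forall t, s t = chi (lift3 t).

(** Scaling the lifted path down to the origin sweeps out a square whose sides are [s], the two rays
    and a constant path. So the function sending a point to the value of [a] on its ray is a
    primitive of [a] on the cover, modulo integers. *)
Lemma cocycle_ray (a : simplex R 1 X -> R) : (forall s, cob a s \is a Num.int) ->
  a s - (a (ray (lift3 (vert R 1))) - a (ray (lift3 (vert R 0)))) \is a Num.int.
Proof.
move=> ca.
(* The two triangles into which the diagonal [d] cuts the square of the path parameter and the
   scale. [T1] has the faces [s], [d] and the starting ray; [T2] has the end ray, [d] and a constant
   simplex. *)
pose T1 := simplex_of (@triangle_continuous fold1 _ u1_continuous).
pose T2 := simplex_of (@triangle_continuous fold2 _ u2_continuous).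
pose d := simplex_of diag_continuous.
have scale1 e : scale3 1 e = e by case: e => -[e1 e2] e3; rewrite /scale3 /= !mul1r.
have scale0 e : scale3 0 e = (0, 0, 0) by case: e => -[e1 e2] e3; rewrite /scale3 /= !mul0r.
have aff2 (f : 'I_2 -> 'I_3) (g : 'I_3 -> 'I_2) (t : Delta 1) : affine_map g (affine_map f t) =
  comb (@vert R 1 \o (g \o f)) t.
  by rewrite affine_mapE comb_affine.
have aid (h : 'I_2 -> 'I_2) (t : Delta 1) : h =1 id -> comb (@vert R 1 \o h) t = t.
  move=> /funext hid; have -> : @vert R 1 \o h = @vert R 1 by rewrite hid.
  exact: comb_vertE.
have acst (h : 'I_2 -> 'I_2) (i : 'I_2) (t : Delta 1) : h =1 (fun=> i) ->
  comb (@vert R 1 \o h) t = vert R i.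
  move=> /funext hid; apply: simplex_eq => j; rewrite val_comb hid /=.
  by rewrite -mulr_suml simplex_sum1 mul1r.
have sum2 (t : Delta 1) : val t 0 0 = 1 - val t 0 1.
  have := simplex_sum1 t; rewrite !big_ord_recl big_ord0 addr0 => <-.
  by rewrite (_ : fintype.lift ord0 ord0 = 1) ?addrK //; apply: val_inj.
have co (f : 'I_2 -> 'I_3) (t : Delta 1) j : val (affine_map f t) 0 j =
    (if f 0 == j then val t 0 0 else 0) + (if f 1 == j then val t 0 1 else 0).
  rewrite mxE big_mkcond !big_ord_recl big_ord0 /= addr0.
  by rewrite (_ : fintype.lift ord0 ord0 = 1) //; apply: val_inj.
have two k : k = 0 \/ k = 1 :> 'I_2 by case: k => [[|[|]]] // h; [left|right]; apply: val_inj.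
have l00 : fintype.lift (0 : 'I_3) (0 : 'I_2) = inord 1 by apply: val_inj; rewrite /= inordK.
have l01 : fintype.lift (0 : 'I_3) (1 : 'I_2) = inord 2 by apply: val_inj; rewrite /= inordK.
have l10 : fintype.lift (1 : 'I_3) (0 : 'I_2) = 0 by apply: val_inj.
have l11 : fintype.lift (1 : 'I_3) (1 : 'I_2) = inord 2 by apply: val_inj; rewrite /= inordK.
have l20 : fintype.lift (inord 2 : 'I_3) (0 : 'I_2) = 0 by apply: val_inj;
  rewrite /= /bump inordK.
have l21 : fintype.lift (inord 2 : 'I_3) (1 : 'I_2) = inord 1 by apply: val_inj;
  rewrite /= /bump !inordK.
have neq (i j : nat) : (i < 3)%N -> (j < 3)%N -> ((inord i : 'I_3) == inord j) = (i == j).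
  by move=> i3 j3; rewrite -val_eqE /= !inordK.
have z0 : (0 : 'I_3) = inord 0 by apply: val_inj; rewrite /= inordK.
have F10 : face 0 T1 = s.
  apply: simplexP => t; rewrite sE face_simplex_of co l00 l01 z0 !neq //=
    addr0 subr0 scale1 aff2 aid // => k.
  by case: (two k) => -> /=; rewrite -?z0 ?l00 ?l01 /fold1 ?z0 ?neq.
have F11 : face 1 T1 = d.
  apply: simplexP => t; rewrite face_simplex_of co l10 l11 z0 !neq //=
    addr0 sum2 subKr aff2 aid // => k.
  by case: (two k) => -> /=; rewrite -?z0 ?l10 ?l11 /fold1 ?z0 ?neq.
have F12 : face (inord 2) T1 = ray (lift3 (vert R 0)).
  apply: simplexP => t; rewrite face_simplex_of co l20 l21 z0 !neq //=
    addr0 sum2 subKr aff2 (acst _ 0) // => k.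
  by case: (two k) => -> /=; rewrite -?z0 ?l20 ?l21 /fold1 ?z0 ?neq.
have F20 : face 0 T2 = ray (lift3 (vert R 1)).
  apply: simplexP => t; rewrite face_simplex_of co l00 l01 !neq //= add0r aff2 (acst _ 1) //.
have F21 : face 1 T2 = d.
  apply: simplexP => t; rewrite face_simplex_of co l10 l11 z0 !neq //= add0r aff2 aid // => k.
  by case: (two k) => -> /=; rewrite -?z0 ?l10 ?l11 /fold2 ?z0 ?neq.
have F22 : face (inord 2) T2 = const_simplex R 1 (chi (0, 0, 0)).
  by apply: simplexP => t; rewrite face_simplex_of co l20 l21 z0 !neq //= addr0 scale0.
have := ca T1; have := ca T2; rewrite !cob1E F10 F11 F12 F20 F21 F22.
have := @cocycle_const R X a (chi (0, 0, 0)) ca.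
move: (a s) (a d) (a (ray (lift3 (vert R 0)))) (a (ray (lift3 (vert R 1)))) (a (const_simplex _
  _ _)).
move=> As Ad A0 A1 Ac hc h2 h1.
have -> : As - (A1 - A0) = (As - Ad + A0) - (A1 - Ad + Ac) + Ac by ring.
by rewrite rpredD // rpredB.
Qed.

End Homotopy.
End Rays.

Section Arguments.
Variable R : realType.

Lemma frac01 (a : R) : 0 <= frac a < 1.
Proof.
rewrite /frac subr_ge0 floor_le_tmp /= ltrBlDl.
by have := floorD1_gt a; rewrite intrD.
Qed.

Lemma frac_int (a : R) : a - frac a \is a Num.int.
Proof. by rewrite /frac subKr intr_int. Qed.

Lemma int_lt1 (x : R) : x \is a Num.int -> -1 < x < 1 -> x = 0.
Proof.
move=> /intrP[m ->] /andP[h1 h2].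
have m1 : m < 1 by rewrite -(@ltr_int R).
have m2 : -1 < m by rewrite -(@ltr_int R).
by have -> : m = 0 by lia.
Qed.

Lemma turnP (x : R[i]) : cabs x = 1 -> 0 <= turn x < 1 /\ e2pi (turn x) = x.
Proof.
move=> x1; rewrite /turn; case: xgetP => [a _ [h1 h2]//|].
have [a ->] := unit_arg x1 => /(_ (frac a)) [].
split; first exact: frac01.
by apply/esym/e2pi_eq; exact: frac_int.
Qed.

(** The branch with values in [0, 1), jumping across the positive reals. The value 0 at z = 0 is the
    one that the normal form needs on the core. *)
Definition argc (z : R[i]) : R := if z == 0 then 0 else turn (phase z).

Lemma argc01 z : 0 <= argc z < 1.
Proof.
rewrite /argc; case: eqP => _; first by rewrite lexx ltr01.
by have [] := turnP (cabs_phase z).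
Qed.

Lemma has_arg_argc z : has_arg z (argc z).
Proof.
rewrite /argc; case: eqVneq => [->|z0]; first by rewrite /has_arg cabs0 mul0r.
have [_ e] := turnP (cabs_phase z); have [a ha] := has_arg_ex z.
apply: (has_arg_int _ ha); apply/e2pi_eq; rewrite e; exact: has_arg_phase.
Qed.

Lemma argc_eq z a : z != 0 -> has_arg z a -> 0 <= a < 1 -> argc z = a.
Proof.
move=> z0 ha a01; have := has_arg_eq z0 (has_arg_argc z) ha.
have := argc01 z => h1 h2; apply/eqP; rewrite -subr_eq0; apply/eqP/int_lt1 => //; lra.
Qed.

Section Dlog.
Variable X : topologicalType.
Local Notation Delta := (std_simplex R).
Implicit Types (g h k : X -> R[i]) (s : simplex R 1 X).

(** The difference counts, with sign, the jumps of the branch [argc] along [s]. *)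
Lemma dlog_argc g s : ccontinuous g -> (forall x, g (s x) != 0) ->
  dlog g s - path_diff (argc \o g) s \is a Num.int.
Proof.
move=> cg g0; have [f cf hf] := simplex_lift cg g0.
rewrite (dlogE g0 cf hf) /path_diff /=.
have h x := has_arg_eq (g0 x) (hf x) (has_arg_argc (g (s x))).
have -> : f (vert R 1) - f (vert R 0) - (argc (g (s (vert R 1))) - argc (g (s (vert R 0)))) =
   (f (vert R 1) - argc (g (s (vert R 1)))) - (f (vert R 0) - argc (g (s (vert R 0)))) by ring.
exact: rpredB.
Qed.

Lemma cob_dlog g (s : simplex R 2 X) : ccontinuous g -> (forall x, g (s x) != 0) ->
  cob (dlog g) s = 0.
Proof.
move=> cg g0; have [f cf hf] := simplex_lift cg g0.
rewrite cob1E /face !restrictE !(dlog_sub _ g0 cf hf) /=.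
have e (i : 'I_3) (j : 'I_2) (k : nat) : (bump i j = k)%N ->
  vert R (fintype.lift i j) = vert R (inord k : 'I_3).
  by move=> <-; congr vert; apply: val_inj; rewrite /= inordK //;
    exact: (ltn_ord (fintype.lift i j)).
rewrite (e _ _ 2) // (e _ _ 1) // (e _ _ 2) // (e _ _ 0) // (e _ _ 1) ?(e _ _ 0) //=;
  rewrite /bump ?inordK //=.
by ring.
Qed.

Lemma dlog_lin g h k (m n : int) s :
  ccontinuous h -> ccontinuous k ->
  (forall x, g (s x) != 0) -> (forall x, h (s x) != 0) -> (forall x, k (s x) != 0) ->
  (forall x a b, has_arg (h (s x)) a -> has_arg (k (s x)) b ->
    has_arg (g (s x)) (lin (m, n) a b)) ->
  dlog g s = m%:~R * dlog h s + n%:~R * dlog k s.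
Proof.
move=> ch ck g0 h0 k0 rel.
have [f cf hf] := simplex_lift ch h0; have [f' cf' hf'] := simplex_lift ck k0.
have cF : continuous (fun x => m%:~R * f x + n%:~R * f' x).
  move=> x; apply: (@continuousD R R^o _ (fun x => m%:~R * f x) (fun x => n%:~R * f' x) x).
    by apply: continuousM; [exact: cst_continuous|exact: cf].
  by apply: continuousM; [exact: cst_continuous|exact: cf'].
rewrite (dlogE h0 cf hf) (dlogE k0 cf' hf') (dlogE g0 cF (fun x => rel x _ _ (hf x) (hf' x))).
by rewrite /lin /=; ring.
Qed.

End Dlog.
End Arguments.

Section ChartCohomology.
Variables (R : realType) (p q : int).
Hypothesis cpq : coprimez p q.
Local Notation W := (lens (R := R) p q).

Lemma in_Y b (s : simplex R 1 W) : range s `<=` Y b -> forall x, Y b (s x).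
Proof. by move=> sY x; apply: sY; exists x. Qed.

Lemma chart_algebra (A B1 B0 G1 G0 F1 F0 H : R) : A - (B1 - B0) \is a Num.int ->
  B1 - H * F1 - G1 \is a Num.int -> B0 - H * F0 - G0 \is a Num.int ->
  A - (H * (F1 - F0) + (G1 - G0)) \is a Num.int.
Proof.
move=> h h1 h0; have := rpredD h (rpredB h1 h0); congr (_ \is a Num.int); ring.
Qed.

(** Cohomology of the open solid torus [Y b], whose fundamental group is generated by the core: up
    to integers and coboundaries only the slope [al] along the core remains. *)
Lemma chart_cohomology b (a : simplex R 1 W -> R) : (forall s, cob a s \is a Num.int) ->
  exists (al : R) (f : W -> R), forall s : simplex R 1 W, range s `<=` Y b ->
    a s - (al * dlog (ang b) s + path_diff f s) \is a Num.int.
Proof.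
move=> ca.
(* A primitive of [a], modulo integers, on the cover. *)
pose B e := a (ray (@chart_continuous R p q cpq b) e).
have BE (s : simplex R 1 W) x y z (cx : continuous x) (cy : continuous y) (cz : continuous z) :
    (forall t, s t = chart p q b (x t, y t, z t)) ->
    a s - (B (x (vert R 1), y (vert R 1), z (vert R 1)) - B (x (vert R 0), y (vert R 0),
      z (vert R 0))) \is a Num.int.
  by move=> sE; exact: (cocycle_ray (@chart_continuous R p q cpq b) cx cy cz sE ca).
pose shift (e : R * R * R) (m : int) : R * R * R := (e.1, e.2 + m%:~R).
have chart_shift e m : chart p q b (shift e m) = chart p q b e.
  case: e => -[e1 e2] e3; rewrite /shift /chart /chart_in /chart_out /=.
  by rewrite e2piD [e2pi m%:~R]e2pi_int ?intr_int // mulr1.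
(* The holonomy of [a] around the core, which becomes the slope. *)
pose h := B (0, 0, 1) - B (0, 0, 0).
have line_c (k c : R) : continuous (fun t : std_simplex R 1 => val t 0 1 * k + c).
  move=> t; apply: (@continuousD R R^o _ (fun t : std_simplex R 1 => val t 0 1 * k) (fun=> c)
    t); last exact: cst_continuous.
  by apply: continuousM; [exact: (@coord_simplex_continuous R 1 1 t)|exact: cst_continuous].
have v1 : val (vert R (1 : 'I_2)) 0 1 = 1 :> R by rewrite val_vert eqxx.
have v0 : val (vert R (0 : 'I_2)) 0 1 = 0 :> R by rewrite val_vert.
(* The segment from the origin to [e] and its translate by m turns project to the same simplex, so
   both lifts compute the value of [a] on it. *)
have step e m : B (shift e m) - B e - (B (0, 0, m%:~R) - B (0, 0, 0)) \is a Num.int.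
  pose s := simplex_of (chi_continuous (@chart_continuous R p q cpq b) (line_c e.1.1 0) (line_c
    e.1.2 0) (line_c e.2 0)).
  have h1 := BE s _ _ _ (line_c e.1.1 0) (line_c e.1.2 0) (line_c e.2 0) (fun=> erefl).
  have sE t : s t = chart p q b (val t 0 1 * e.1.1 + 0, val t 0 1 * e.1.2 + 0,
    val t 0 1 * e.2 + m%:~R).
    have -> : s t = chart p q b (val t 0 1 * e.1.1 + 0, val t 0 1 * e.1.2 + 0,
      val t 0 1 * e.2 + 0) by [].
    by rewrite -[LHS](chart_shift _ m) /shift /= !addr0.
  have h2 := BE s _ _ _ (line_c e.1.1 0) (line_c e.1.2 0) (line_c e.2 m%:~R) sE.
  rewrite v1 v0 !mul1r !mul0r !addr0 !add0r in h1 h2.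
  have eE : e = (e.1.1, e.1.2, e.2) by case: e {s h1 h2 sE} => -[].
  rewrite -eE in h1; rewrite {1}eE /shift /=.
  have := rpredB h1 h2; congr (_ \is a Num.int); ring.
have hm (m : int) : B (0, 0, m%:~R) - B (0, 0, 0) - m%:~R * h \is a Num.int.
  have nat_case (n : nat) : B (0, 0, n%:R) - B (0, 0, 0) - n%:R * h \is a Num.int.
    elim: n => [|n IH]; first by rewrite subrr mul0r subr0 rpred0.
    have := rpredD (step (0, 0, n%:R) 1) IH; rewrite /shift /= natr1.
    by congr (_ \is a Num.int); rewrite /h -natr1; ring.
  case: m => n; first exact: nat_case.
  have := step (0, 0, (Negz n)%:~R) n.+1; rewrite /shift /= => h1.
  have h2 := nat_case n.+1.
  have e : (Negz n)%:~R + n.+1%:~R = 0 :> R by rewrite -intrD NegzE addNr.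
  rewrite e in h1; have := rpredD h1 h2; rewrite -rpredN.
  congr (_ \is a Num.int).
  have -> : (Negz n)%:~R = - n.+1%:R :> R by rewrite NegzE mulrNz.
  by rewrite -pmulrn; ring.
(* Without its linear part the primitive is periodic modulo integers, hence descends to a function
   on [Y b]. *)
pose g e := B e - h * e.2.
have g_per e m : g (shift e m) - g e \is a Num.int.
  have := rpredD (step e m) (hm m); congr (_ \is a Num.int).
  by rewrite /g /shift /=; ring.
pose tr (x : W) := (complex.Re (chart_inv b x), complex.Im (chart_inv b x)).
exists h, (fun x => g (tr x, argc (ang b x))) => s sY.
have Ys := in_Y sY.
have a0 x : ang b (s x) != 0 by apply: ang_neq0 => //; exact: Ys.
have [F cF hF] := simplex_lift (@ang_continuous R p q cpq b) a0.
have ci := chart_inv_simplex_continuous cpq sY.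
have cre : continuous (fun x => complex.Re (chart_inv b (s x))) by move=> x;
  exact: ccont_re (ci x).
have cim : continuous (fun x => complex.Im (chart_inv b (s x))) by move=> x;
  exact: ccont_im (ci x).
have sE t : s t = chart p q b (complex.Re (chart_inv b (s t)), complex.Im (chart_inv b (s t)),
  F t).
  by rewrite chart_invK.
have h1 : a s - (B (tr (s (vert R 1)), F (vert R 1)) - B (tr (s (vert R 0)),
  F (vert R 0))) \is a Num.int.
  exact: BE cre cim cF sE.
rewrite (dlogE a0 cF hF) /path_diff.
have gE i : g (tr (s (vert R i)), F (vert R i)) - g (tr (s (vert R i)),
  argc (ang b (s (vert R i)))) \is a Num.int.
  have /intrP[m mE] := has_arg_eq (a0 (vert R i)) (hF (vert R i)) (has_arg_argc (ang b (s (vert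
    R i)))).
  have := g_per (tr (s (vert R i)), argc (ang b (s (vert R i)))) m.
  by rewrite /shift /= -mE subrKC.
exact: (chart_algebra h1 (gE 1) (gE 0)).
Qed.

End ChartCohomology.

(** * The overlap of the two solid tori and its loops *)

Section Classification.
Variables (R : realType) (p q : int).
Hypothesis cpq : coprimez p q.
Local Notation W := (lens (R := R) p q).
Local Notation Delta := (std_simplex R).

Let mr := (egcdz q p).1.
Let ms := (egcdz q p).2.

Definition overlap : set W := Y true `&` Y false.

Lemma lpt_overlap b u w : valid u w -> overlap (lpt p q b u w) <-> u != 0.
Proof.
move=> h; rewrite /overlap /Y /= !depthE // /depth_piece.
case: b => /=; rewrite oner_eq0 eq_complex /= eqxx andbT cabs_eq0; split=> //; first by case.
by case.
Qed.

Lemma overlap_cases (x : W) : overlap x ->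
  exists b u w, [/\ valid u w, u != 0 & x = lpt p q b u w].
Proof.
have [b [u [w [h ->]]]] := lpt_cases x.
by move=> /(lpt_overlap b h) u0; exists b, u, w.
Qed.

Lemma disk_neq0 x : overlap x -> disk true x != 0.
Proof.
move=> /overlap_cases[b [u [w [h u0 ->]]]]; rewrite diskE // /disk_piece.
case: (b == true) => //; apply: mulf_neq0; apply: zpow_neq0 => //.
by apply: unit_neq0; case: h.
Qed.

Lemma lin_int (m : int * int) (a a' c c' : R) : a - a' \is a Num.int -> c - c' \is a Num.int ->
  lin m a c - lin m a' c' \is a Num.int.
Proof.
move=> ha hc; rewrite /lin.
have -> : m.1%:~R * a + m.2%:~R * c - (m.1%:~R * a' + m.2%:~R * c') =
  m.1%:~R * (a - a') + m.2%:~R * (c - c') by ring.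
by rewrite rpredD // rpredM // intr_int.
Qed.

(** The last row of the inverse gluing matrix: up to positive factors, [ang false] is the p-th power
    of [disk true] times the q-th power of [ang true]. *)
Lemma phase_relation x a c : overlap x -> has_arg (disk true x) a -> has_arg (ang true x) c ->
  has_arg (ang false x) (lin (p, q) a c).
Proof.
move=> ox; have d0 := disk_neq0 ox; have t0 : ang true x != 0 by apply: ang_neq0 => //; case: ox.
move: ox d0 t0 => /overlap_cases[b [u [w [h u0 ->]]]];
  rewrite diskE // !angE // /disk_piece /turn_piece.
case: b => d0 t0 /=.
  by move=> ha hc; apply: has_argM; exact: has_arg_zpow.
have [a0 ha0] := has_arg_ex u; have [c0 hc0] := has_arg_ex w.
have h1 : has_arg (zpow u q * zpow w ms) (lin (q, ms) a0 c0) by apply: has_argM;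
  exact: has_arg_zpow.
have h2 : has_arg (zpow u (- p) * zpow w mr) (lin (- p, mr) a0 c0) by apply: has_argM;
  exact: has_arg_zpow.
move=> /(has_arg_eq d0)/(_ h1) da /(has_arg_eq t0)/(_ h2) dc.
apply: (has_arg_int _ hc0).
by have := lin_int (p, q) da dc; rewrite (lin_inv cpq false a0 c0).2.
Qed.

Lemma dlog_relation (s : simplex R 1 W) : range s `<=` overlap ->
  dlog (ang false) s = p%:~R * dlog (disk true) s + q%:~R * dlog (ang true) s.
Proof.
move=> so; have sx x : overlap (s x) by apply: so; exists x.
apply: dlog_lin.
- exact: disk_continuous.
- exact: ang_continuous.
- by move=> x; apply: ang_neq0 => //; case: (sx x).
- by move=> x; apply: disk_neq0.
- by move=> x; apply: ang_neq0 => //; case: (sx x).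
- by move=> x a c; exact: phase_relation.
Qed.

Lemma affine_path_continuous (a c : R) : continuous (fun t : Delta 1 => a + c * val t 0 1).
Proof.
move=> t; apply: (@continuousD R R^o _ (fun=> a) (fun t : Delta 1 => c * val t 0 1) t);
  first exact: cst_continuous.
by apply: continuousM; [exact: cst_continuous|exact: (@coord_simplex_continuous R 1 1 t)].
Qed.

Lemma coord1_le1 (t : Delta 1) : 0 <= val t 0 1 <= 1.
Proof.
rewrite simplex_ge0 /= -(simplex_sum1 t) !big_ord_recl big_ord0 /= addr0.
rewrite (_ : fintype.lift ord0 ord0 = 1); last by apply: val_inj.
by rewrite lerDr simplex_ge0.
Qed.

Lemma polar_path b (r r' a a' c c' : R) : 0 < r <= 1 -> 0 < r + r' <= 1 ->
  exists s : simplex R 1 W, range s `<=` overlap /\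
    forall t : Delta 1, let k := val t 0 1 in
     s t = lpt p q b ((r + r' * k)%:C * e2pi (a + a' * k)) (e2pi (c + c' * k)).
Proof.
move=> r01 r01'.
pose u (t : Delta 1) := (r + r' * val t 0 1)%:C * e2pi (a + a' * val t 0 1).
pose w (t : Delta 1) := e2pi (c + c' * val t 0 1).
have rt (t : Delta 1) : 0 < r + r' * val t 0 1 <= 1.
  have /andP[k0 k1] := coord1_le1 t; have /andP[h0 h1] := r01; have /andP[h2 h3] := r01'.
  move: (val t 0 1) k0 k1 => k k0 k1.
  have -> : r + r' * k = (1 - k) * r + k * (r + r') by ring.
  apply/andP; split; last by nra.
  by have [->|kn0] := eqVneq k 0; [lra|have kp : 0 < k by rewrite lt_def kn0]; nra.
have cu (t : Delta 1) : cabs (u t) = r + r' * val t 0 1.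
  by rewrite /u cabsM cabs_real cabs_e2pi mulr1 gtr0_norm //; have /andP[] := rt t.
have h (t : Delta 1) : valid (u t) (w t).
  by split; rewrite ?cabs_e2pi // cu; have /andP[] := rt t.
have cs : continuous (fun t => lpt p q b (u t) (w t)).
  move=> t; apply: (@lpt_continuous R p q b _ u w t h).
    by apply: ccontM; [apply: ccont_real|apply: ccont_e2pi]; exact: affine_path_continuous.
  by apply: ccont_e2pi; exact: affine_path_continuous.
exists (simplex_of cs); split=> // _ [t _ <-] /=.
apply/(lpt_overlap b (h t)); rewrite -cabs_gt0 cu; by have /andP[] := rt t.
Qed.

Definition base_point : W := lpt p q false 1 1.

Lemma base_pointE b : base_point = lpt p q b 1 1.
Proof.
rewrite /base_point; have h := lpt_glueE (R := R) cpq false 0 0;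
  rewrite /lin !mulr0 !addr0 !e2pi0 in h.
by case: b.
Qed.

Lemma overlap_connected x : overlap x ->
  exists s : simplex R 1 W, [/\ range s `<=` overlap, s (vert R 0) = x & s (vert R 1) =
    base_point].
Proof.
move=> /overlap_cases[b [u [w [h u0 ->]]]].
have [a ua] := has_arg_ex u; have [w1 w2] := h; have [c wc] := unit_arg w2.
have r0 : 0 < cabs u by rewrite cabs_gt0.
have [||s [so sE]] := @polar_path b (cabs u) (1 - cabs u) a (- a) c (- c); try by apply/andP;
  split; lra.
exists s; split => //; rewrite sE /= val_vert /=.
  by rewrite !mulr0 !addr0 -ua -wc.
by rewrite !mulr1 !subrr subrKC mul1r e2pi0 -base_pointE.
Qed.

Definition g_disk (x : W) : R := argc (disk true x).

(** The loop on the gluing torus running [a] times along the meridian of the glued solid torus and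
    [c] times along its core direction. Comparing a cocycle on it from both sides relates the two
    slopes. *)
Lemma torus_loop (a c : R) : a \is a Num.int -> c \is a Num.int ->
  exists s : simplex R 1 W, [/\ range s `<=` overlap, s (vert R 0) = base_point, s (vert R 1) =
    base_point,
    dlog (ang false) s = c & dlog (ang true) s = lin (- p, mr) a c].
Proof.
move=> ai ci.
have [||s [so sE]] := @polar_path false 1 0 0 a 0 c; try by apply/andP; split; lra.
have sE' (t : Delta 1) : s t = lpt p q false (e2pi (a * val t 0 1)) (e2pi (c * val t 0 1)).
  by rewrite sE /= mul0r addr0 mul1r !add0r.
have sx x : overlap (s x) by apply: so; exists x.
have v01 (t : Delta 1) : valid (e2pi (a * val t 0 1 : R)) (e2pi (c * val t 0 1)) by split;
  rewrite cabs_e2pi.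
have cont k : continuous (fun t : Delta 1 => k * val t 0 1 : R).
  by move=> t; apply: continuousM; [exact: cst_continuous|exact: (@coord_simplex_continuous R 1
    1 t)].
exists s; split => //.
- by rewrite sE' val_vert /= !mulr0 e2pi0.
- by rewrite sE' val_vert /= !mulr1 !e2pi_int.
- rewrite (@dlogE R W (ang false) s (fun t => c * val t 0 1)) ?val_vert /=
  ?mulr1 ?mulr0 ?subr0 //.
  + by move=> x; apply: ang_neq0 => //; case: (sx x).
  + by move=> x; rewrite sE' angE // /turn_piece /=; exact: has_arg_e2pi.
- rewrite (@dlogE R W (ang true) s (fun t => lin (- p, mr) a c * val t 0 1)) ?val_vert /=
  ?mulr1 ?mulr0 ?subr0 //.
  + by move=> x; apply: ang_neq0 => //; case: (sx x).
  + move=> x; rewrite sE' angE // /turn_piece [_ == _]/=.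
    have -> : lin (- p, mr) a c * val x 0 1 = lin (- p, mr) (a * val x 0 1) (c * val x 0 1).
      by rewrite /lin /=; ring.
    rewrite -/(has_arg _ _) (zpow_lin (lens_pair p q false).2); exact: has_arg_e2pi.
Qed.

End Classification.

(** Here m / p is the slope on the exterior and n is mr m reduced modulo p; Bezout shows that the
    slope agrees with n q / p modulo integers. *)
Lemma slope_eq (F : fieldType) (mr ms q p m k n : F) : p != 0 -> mr * q + ms * p = 1 ->
  mr * m = k * p + n -> m / p - q * n / p = ms * m + q * k.
Proof.
move=> p0 bez e; apply: (mulIf p0); rewrite mulrBl !mulfVK //.
have -> : n = mr * m - k * p by rewrite e addrAC subrr add0r.
transitivity ((mr * q + ms * p) * m - q * (mr * m - k * p)); first by rewrite bez mul1r.
ring.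
Qed.

Lemma slope_eq' (F : fieldType) (mr p m k n : F) : p != 0 ->
  mr * m = k * p + n -> m / p * mr - n / p = k.
Proof.
move=> p0 e; apply: (mulIf p0); rewrite mulrBl mulrAC !mulfVK //.
by rewrite [m * mr]mulrC e addrK.
Qed.

Lemma cob1_lin (R : realType) (X : topologicalType) (B C : simplex R 1 X ->
  R) (k l : R) (s : simplex R 2 X) :
  cob (fun t => k * B t + l * C t) s = k * cob B s + l * cob C s.
Proof.
rewrite !cob1E; move: (B _) (B _) (B _) (C _) (C _) (C _) => b0 b1 b2 c0 c1 c2; ring.
Qed.

Lemma cob1B (R : realType) (X : topologicalType) (B C : simplex R 1 X -> R) (s : simplex R 2 X) :
  cob (fun t => B t - C t) s = cob B s - cob C s.
Proof.
rewrite !cob1E; move: (B _) (B _) (B _) (C _) (C _) (C _) => b0 b1 b2 c0 c1 c2; ring.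
Qed.

Lemma cob1Z (R : realType) (X : topologicalType) (B : simplex R 1 X ->
  R) (k : R) (s : simplex R 2 X) :
  cob (fun t => k * B t) s = k * cob B s.
Proof. by rewrite !cob1E mulrDr mulrBr. Qed.

(** * Normal form of a 1-cocycle modulo integers *)

Section NormalForm.
Variables (R : realType) (p q : int).
Hypotheses (p1 : 1 <= p) (cpq : coprimez p q).
Local Notation W := (lens (R := R) p q).
Local Notation Delta := (std_simplex R).

Let mr := (egcdz q p).1.
Let ms := (egcdz q p).2.
Let g (x : W) : R := g_disk x.

Definition eqz (x y : R) : Prop := x - y \is a Num.int.
Local Notation "x === y" := (eqz x y) (at level 70).

Lemma eqz_refl x : x === x. Proof. by rewrite /eqz subrr rpred0. Qed.
Lemma eqz_sym x y : x === y -> y === x. Proof. by rewrite /eqz -opprB rpredN. Qed.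
Lemma eqz_trans y x z : x === y -> y === z -> x === z.
Proof. by move=> h1 h2; rewrite /eqz -(subrKA y); exact: rpredD. Qed.
Lemma eqzD x y x' y' : x === y -> x' === y' -> x + x' === y + y'.
Proof. by move=> h1 h2; rewrite /eqz opprD addrACA; exact: rpredD. Qed.
Lemma eqzN x y : x === y -> - x === - y.
Proof. by rewrite /eqz -opprD rpredN. Qed.
Lemma eqzB x y x' y' : x === y -> x' === y' -> x - x' === y - y'.
Proof. by move=> h1 h2; apply: eqzD => //; exact: eqzN. Qed.
Lemma eqzMz k x y : k \is a Num.int -> x === y -> k * x === k * y.
Proof. by move=> hk h; rewrite /eqz -mulrBr; exact: rpredM. Qed.
Lemma eqz0 x : x \is a Num.int <-> x === 0. Proof. by rewrite /eqz subr0. Qed.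

(* [g] is the argument of [disk true]: it jumps, and this is what makes the
   two descriptions agree on the overlap. *)
Definition normal (a : simplex R 1 W -> R) (n : nat) (f : W -> R) : Prop :=
  (forall s : simplex R 1 W, range s `<=` Y false ->
     a s === n%:R / p%:~R * dlog (ang false) s + path_diff f s) /\
  (forall s : simplex R 1 W, range s `<=` Y true ->
     a s === q%:~R * n%:R / p%:~R * dlog (ang true) s + path_diff f s + n%:R * path_diff g s).

Lemma overlap_algebra (P Q n dT dK F1 F0 F1' F0' G1 G0 : R) : P != 0 ->
  Q * n / P * dT + (F1 - F0) === n / P * (P * dK + Q * dT) + (F1' - F0') ->
  n * dK === n * (G1 - G0) -> F1 - F1' - n * G1 === F0 - F0' - n * G0.
Proof.
move=> P0 e4 e5; have := eqzD e4 e5; rewrite /eqz; congr (_ \is a Num.int).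
have -> : n / P * (P * dK + Q * dT) = n * dK + Q * n / P * dT.
  by rewrite mulrDr mulrA divfK //; ring.
ring.
Qed.

Lemma regroup_algebra (n F1 F0 H1 H0 G1 G0 : R) :
  F1 === H1 + n * G1 -> F0 === H0 + n * G0 -> F1 - F0 === H1 - H0 + n * (G1 - G0).
Proof.
move=> h1 h0; have := eqzB h1 h0.
by have -> : H1 + n * G1 - (H0 + n * G0) = H1 - H0 + n * (G1 - G0) by ring.
Qed.

Lemma cancel_algebra (x x' u v v' w : R) :
  x === u + v + w -> x' === u + v' + w -> x' - x - (v' - v) \is a Num.int.
Proof.
move=> h h'; have := eqzB h' h; rewrite /eqz.
by have -> : x' - x - (u + v' + w - (u + v + w)) = x' - x - (v' - v) by ring.
Qed.

Let p0 : p%:~R != 0 :> R.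
Proof. by rewrite intr_eq0; lia. Qed.

Let bez : mr%:~R * q%:~R + ms%:~R * p%:~R = 1 :> R.
Proof. by rewrite -!rmorphM -rmorphD /= (lens_bezout cpq). Qed.

Lemma sub_Y b (s : simplex R 1 W) : range s `<=` overlap (p := p) (q := q) -> range s `<=` Y b.
Proof. by move=> so x /so[]; case: b. Qed.

Lemma dlog_turn b (s : simplex R 1 W) : range s `<=` Y b ->
  dlog (ang b) s === path_diff (@argc R \o ang b) s.
Proof.
move=> sY; apply: dlog_argc; first exact: ang_continuous.
by move=> x; apply: ang_neq0 => //; exact: in_Y.
Qed.

Lemma dlog_disk (s : simplex R 1 W) : range s `<=` overlap (p := p) (q := q) ->
  dlog (disk true) s === path_diff g s.
Proof.
move=> so; apply: dlog_argc; first exact: disk_continuous.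
by move=> x; apply: disk_neq0 => //; apply: so; exists x.
Qed.

Lemma path_diffD (f h : W -> R) (s : simplex R 1 W) :
  path_diff (fun x => f x + h x) s = path_diff f s + path_diff h s.
Proof. by rewrite /path_diff; ring. Qed.

Lemma path_diffB (f h : W -> R) (s : simplex R 1 W) :
  path_diff (fun x => f x - h x) s = path_diff f s - path_diff h s.
Proof. by rewrite /path_diff; ring. Qed.

Lemma path_diffZ k (f : W -> R) (s : simplex R 1 W) :
  path_diff (fun x => k * f x) s = k * path_diff f s.
Proof. by rewrite /path_diff; ring. Qed.

Lemma adjust_slope b (a : simplex R 1 W -> R) (al be : R) (f : W -> R) :
  al - be \is a Num.int ->
  (forall s : simplex R 1 W, range s `<=` Y b -> a s === al * dlog (ang b) s + path_diff f s) ->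
  forall s : simplex R 1 W, range s `<=` Y b ->
    a s === be * dlog (ang b) s + path_diff (fun x => f x + (al - be) * argc (ang b x)) s.
Proof.
move=> hz ha s sY; apply: eqz_trans (ha s sY) _.
have -> : al * dlog (ang b) s + path_diff f s =
   be * dlog (ang b) s + (path_diff f s + (al - be) * dlog (ang b) s) by ring.
rewrite path_diffD path_diffZ; apply: eqzD; first exact: eqz_refl.
by apply: eqzD; [exact: eqz_refl|apply: eqzMz => //; exact: dlog_turn].
Qed.

(** On the core of the exterior the disk coordinate is 0, where [argc] takes its default value. This
    lets one function [f] serve both halves of the normal form. *)
Lemma g_core x : ~ Y false x -> g x = 0.
Proof.
have [b [u [w [h ->]]]] := lpt_cases x.
rewrite /Y /= depthE // /g /g_disk diskE // /depth_piece /disk_piece.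
case: b => /=; last by rewrite oner_eq0 => /(_ erefl).
move=> /negP; rewrite negbK eq_complex /= eqxx andbT cabs_eq0 => /eqP ->.
by rewrite /argc eqxx.
Qed.

(** Each solid torus contributes a slope and a primitive. Two loops on the gluing torus determine
    the slopes modulo integers, and connectedness of the overlap matches the primitives up to a
    constant. *)
Lemma normal_exists (a : simplex R 1 W -> R) : (forall s, cob a s \is a Num.int) ->
  exists2 n : nat, (n < `|p|)%N & exists f, normal a n f.
Proof.
move=> ca.
have [al [f1 h1]] := chart_cohomology cpq true ca.
have [al' [f1' h1']] := chart_cohomology cpq false ca.
have loop (x y : R) : x \is a Num.int -> y \is a Num.int -> al * lin (- p, mr) x y === al' * y.
  move=> xi yi; have [s [so s0 s1 df dt]] := torus_loop cpq xi yi.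
  have e1 := h1 s (@sub_Y true s so); have e2 := h1' s (@sub_Y false s so).
  rewrite /path_diff s0 s1 subrr addr0 dt in e1.
  rewrite /path_diff s0 s1 subrr addr0 df in e2.
  have E1 : a s === al * lin (- p, mr) x y by exact: e1.
  have E2 : a s === al' * y by exact: e2.
  exact: eqz_trans (eqz_sym E1) E2.
(* The meridian of the glued solid torus bounds there and winds -p times around the core of the
   exterior. *)
have /intrP[m alp] : al * p%:~R \is a Num.int.
  have := loop 1 0 (rpred1 _) (rpred0 _); rewrite mulr0 => h0; have h := (eqz0 _).2 h0.
  have e : al * p%:~R = - (al * lin (- p, mr) 1 0) by rewrite /lin /= rmorphN /=; ring.
  by rewrite e rpredN; exact: h.
(* The core direction of the glued solid torus winds mr times around the core of the exterior. *)
have alr : al * mr%:~R === al'.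
  by have := loop 0 1 (rpred0 _) (rpred1 _); rewrite /lin /= mulr0 add0r !mulr1.
have alE : al = m%:~R / p%:~R by rewrite -alp mulfK.
have [n [k [nk n0 np]]] : exists n k : int, [/\ mr * m = k * p + n, 0 <= n & n < p].
  exists ((mr * m) %% p)%Z, ((mr * m) %/ p)%Z; split; first exact: divz_eq.
    by apply: modz_ge0; lia.
  by rewrite ltz_pmod //; lia.
have nN : `|n|%N%:R = n%:~R :> R by rewrite pmulrn /= gez0_abs.
have nkR : mr%:~R * m%:~R = k%:~R * p%:~R + n%:~R :> R by rewrite -!rmorphM -rmorphD /= nk.
have i1 : al - q%:~R * `|n|%N%:R / p%:~R \is a Num.int.
  have -> : al - q%:~R * `|n|%N%:R / p%:~R = (ms * m + q * k)%:~R.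
    by rewrite nN alE rmorphD !rmorphM; exact: slope_eq p0 bez nkR.
  exact: intr_int.
have i2 : al' - `|n|%N%:R / p%:~R \is a Num.int.
  apply: eqz_trans (eqz_sym alr) _; rewrite /eqz.
  have -> : al * mr%:~R - `|n|%N%:R / p%:~R = k%:~R.
    by rewrite nN alE; exact: slope_eq' p0 nkR.
  exact: intr_int.
have [f0 h2] : exists f0 : W -> R, forall s : simplex R 1 W, range s `<=` Y true ->
    a s === q%:~R * `|n|%N%:R / p%:~R * dlog (ang true) s + path_diff f0 s.
  by eexists; exact: adjust_slope i1 h1.
have [f0' h2'] : exists f0' : W -> R, forall s : simplex R 1 W, range s `<=` Y false ->
    a s === `|n|%N%:R / p%:~R * dlog (ang false) s + path_diff f0' s.
  by eexists; exact: adjust_slope i2 h1'.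
exists `|n|%N; first lia.
(* The mismatch of the two primitives. Both formulas for [a] hold on the overlap, and the relation
   between the [dlog] cochains makes [h] constant there modulo integers. *)
pose h x := f0 x - f0' x - `|n|%N%:R * g x.
have hs (s : simplex R 1 W) : range s `<=` overlap (p := p) (q := q) ->
    h (s (vert R 1)) === h (s (vert R 0)).
  move=> so.
  have e1 := h2 s (@sub_Y true s so); have e2 := h2' s (@sub_Y false s so).
  have e3 := dlog_disk so; have rel := dlog_relation cpq so.
  have e4 := eqz_trans (eqz_sym e1) e2; rewrite rel in e4.
  have e5 := eqzMz (intr_int _ n) e3; rewrite -nN in e5.
  exact: (overlap_algebra p0 e4 e5).
pose ka := h (base_point R p q).
have hconn x : overlap x -> h x === ka.
  move=> /(overlap_connected cpq)[s [so s0 s1]].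
  by apply: eqz_sym; have := hs s so; rewrite s0 s1.
(* The constant is absorbed into the primitive on [Y false]; on the core of the exterior, which
   [Y false] misses, the value of [f0] is kept. *)
pose F x := if pselect (Y false x) then f0' x + ka else f0 x.
have FY x : Y false x -> F x = f0' x + ka by rewrite /F; case: pselect.
exists F; split=> s sY.
  have -> : path_diff F s = path_diff f0' s.
    by rewrite /path_diff !FY; [ring|exact: in_Y..].
  exact: h2'.
apply: eqz_trans (h2 s sY) _; rewrite -addrA; apply: eqzD; first exact: eqz_refl.
have key x : Y true x -> f0 x === F x + `|n|%N%:R * g x.
  move=> Yx; rewrite /F; case: pselect => [Yf|nYf]; last by rewrite g_core // mulr0 addr0;
    exact: eqz_refl.
  move: (hconn x (conj Yx Yf)); rewrite /eqz /h; clear; move: ka => k e.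
  have -> : f0 x - (f0' x + k + `|n|%:R * g x) = f0 x - f0' x - `|n|%:R * g x - k by ring.
  exact: e.
exact: (regroup_algebra (key _ (in_Y sY (vert R 1))) (key _ (in_Y sY (vert R 0)))).
Qed.

(** The core direction of the glued solid torus reads off n / p, since path differences vanish on
    loops. *)
Lemma normal_loop : exists s : simplex R 1 W, s (vert R 0) = s (vert R 1) /\
    forall a n f, normal a n f -> a s === n%:R / p%:~R.
Proof.
have i0 : (0 : R) \is a Num.int by exact: rpred0.
have i1 : (1 : R) \is a Num.int by exact: rpred1.
have [s [so s0 s1 df dt]] := torus_loop cpq i0 i1.
exists s; split; first by rewrite s0 s1.
move=> a n f [nf _]; have := nf s (@sub_Y false s so).
by rewrite df /path_diff s0 s1 subrr addr0 mulr1.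
Qed.

Lemma normal_unique a a' n n' f f' h : (n < `|p|)%N -> (n' < `|p|)%N ->
  normal a n f -> normal a' n' f' ->
  (forall s, a' s === a s + path_diff h s) -> n = n'.
Proof.
move=> np np' na na' aa'; have [s [s01 sl]] := normal_loop.
have e : eqz (n'%:R / p%:~R) (n%:R / p%:~R).
  apply: eqz_trans (eqz_sym (sl _ _ _ na')) _; apply: eqz_trans (aa' s) _.
  by rewrite /path_diff s01 subrr addr0; exact: sl na.
have pN : (`|p|%N)%:R = p%:~R :> R by rewrite pmulrn /= gez0_abs //; lia.
have pp : 0 < p%:~R :> R by rewrite ltr0z; lia.
have := int_lt1 e; rewrite -mulrBl => h0.
have : (n'%:R - n%:R) / p%:~R = 0 :> R.
  apply: h0; rewrite ltr_pdivlMr // ltr_pdivrMr // mulN1r mul1r -pN.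
  have h1 : n%:R < `|p|%N%:R :> R by rewrite ltr_nat.
  have h2 : n'%:R < `|p|%N%:R :> R by rewrite ltr_nat.
  have h3 : 0 <= n%:R :> R by [].
  have h4 : 0 <= n'%:R :> R by [].
  apply/andP; split; lra.
move/eqP; rewrite mulf_eq0 invr_eq0 (negbTE p0) orbF subr_eq0 eqr_nat => /eqP //.
Qed.

(** By [dlog_relation] the formulas prescribed on the two open sets agree modulo integers on the
    overlap. They define a cochain closed on small simplices, which [cocycle_extension]
    completes. *)
Lemma normal_surj n : exists2 a, (forall s, cob a s \is a Num.int) & normal a n (fun=> 0).
Proof.
pose aT (s : simplex R 1 W) := q%:~R * n%:R / p%:~R * dlog (ang true) s + n%:R * path_diff g s.
pose aF (s : simplex R 1 W) := n%:R / p%:~R * dlog (ang false) s.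
pose A (s : simplex R 1 W) := if pselect (range s `<=` Y false) then aF s else aT s.
have AF (s : simplex R 1 W) : range s `<=` Y false -> A s = aF s by move=> sY; rewrite /A;
  case: pselect.
have AT (s : simplex R 1 W) : range s `<=` Y true -> A s === aT s.
  move=> sY; rewrite /A; case: pselect => [sF|nF] /=; last exact: eqz_refl.
  have so : range s `<=` overlap (p := p) (q := q) by move=> x xs; split; [exact: sY|exact: sF].
  have e := eqzMz (intr_int R n) (dlog_disk so); rewrite -pmulrn in e.
  rewrite /aF (dlog_relation cpq so) /aT.
  have -> : n%:R / p%:~R * (p%:~R * dlog (disk true) s + q%:~R * dlog (ang true) s) =
     q%:~R * n%:R / p%:~R * dlog (ang true) s + n%:R * dlog (disk true) s.
    by rewrite mulrDr mulrA divfK //; ring.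
  by apply: eqzD; [exact: eqz_refl|exact: e].
have cobA (s : simplex R 2 W) : small (Y true) (Y false) s -> cob A s \is a Num.int.
  case=> sY; have fY i : range (face i s) `<=` range s by exact: within_range (within_face s i).
    have -> : cob A s = cob (fun t => A t - aT t) s + cob aT s by rewrite cob1B subrK.
    apply: rpredD; first by apply: cob_int => i; apply: AT; exact: subset_trans (fY i) sY.
    rewrite /aT cob1_lin cob_path_diff mulr0 addr0 cob_dlog ?mulr0 ?rpred0 //.
      exact: ang_continuous.
    by move=> x; apply: ang_neq0 => //; apply: sY; exists x.
  have -> : cob A s = cob aF s.
    by rewrite !cob1E !AF //; exact: subset_trans (fY _) sY.
  rewrite /aF cob1Z cob_dlog ?mulr0 ?rpred0 //; first exact: ang_continuous.
  by move=> x; apply: ang_neq0 => //; apply: sY; exists x.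
have [a [ca aA]] := cocycle_extension (@Y_open R p q true) (@Y_open R p q false) (Y_cover R p q)
  cobA.
exists a => //; split=> s sY.
  have := aA s (or_intror sY); rewrite AF // /aF.
  by rewrite /path_diff subrr addr0.
apply: eqz_trans (aA s (or_introl sY)) _; apply: eqz_trans (AT s sY) _.
by rewrite /aT {2}/path_diff subrr addr0; exact: eqz_refl.
Qed.

(** The difference of the two sides is closed modulo integers and integral on small simplices, hence
    integral everywhere. *)
Lemma normal_cohomologous a a' n f f' :
  (forall s, cob a s \is a Num.int) -> (forall s, cob a' s \is a Num.int) ->
  normal a n f -> normal a' n f' ->
  forall s, a' s === a s + path_diff (fun x => f' x - f x) s.
Proof.
move=> ca ca' [nF nT] [nF' nT'] s.
pose d s := a' s - a s - path_diff (fun x => f' x - f x) s.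
have : d s \is a Num.int; last by rewrite /d /eqz -addrA -opprD.
apply: (cocycle_int_small (@Y_open R p q true) (@Y_open R p q false) (Y_cover R p q)) =>
  [{}s|{}s [sY|sY]].
- have -> : cob d s = cob a' s - cob a s - cob (path_diff (fun x => f' x - f x)) s.
    by rewrite /d !cob1B.
  by rewrite cob_path_diff subr0 rpredB.
- by rewrite /d path_diffB; exact: cancel_algebra (nT s sY) (nT' s sY).
- by rewrite /d path_diffB; apply: (cancel_algebra (w := 0)); rewrite addr0;
  [exact: nF|exact: nF'].
Qed.

End NormalForm.

(** * The cochain a u da and its localization *)

Section Edges.
Variables (R : realType) (X : topologicalType).
Local Notation Delta := (std_simplex R).

(** Vertices are indexed by natural numbers, so that the face identities become computations with
    [bump]. *)
Definition ed n (i j : nat) (s : simplex R n X) : simplex R 1 X := edge (inord i) (inord j) s.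
Definition vx n (i : nat) (s : simplex R n X) : X := s (vert R (inord i)).

Lemma restrict_restrict k l n (f : 'I_k.+1 -> 'I_l.+1) (h : 'I_l.+1 ->
  'I_n.+1) (s : simplex R n X) :
  restrict f (restrict h s) = restrict (h \o f) s.
Proof. by rewrite (restrictE s h) restrict_sub restrictE. Qed.

Lemma lift_inord n (k i : nat) : (k < n.+2)%N -> (i < n.+1)%N ->
  fintype.lift (inord k : 'I_n.+2) (inord i : 'I_n.+1) = inord (bump k i).
Proof.
move=> hk hi; apply: val_inj; rewrite /= !inordK // /bump.
by case: (k <= i)%N => /=; lia.
Qed.

Lemma ed_face n (k i j : nat) (s : simplex R n.+1 X) :
  (k < n.+2)%N -> (i < n.+1)%N -> (j < n.+1)%N ->
  ed i j (face (inord k) s) = ed (bump k i) (bump k j) s.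
Proof.
move=> hk hi hj; rewrite /ed /edge /face restrict_restrict -!lift_inord //.
by congr restrict; apply/funext => l /=; case: (l == 0).
Qed.

Lemma vx_face n (k i : nat) (s : simplex R n.+1 X) :
  (k < n.+2)%N -> (i < n.+1)%N -> vx i (face (inord k) s) = vx (bump k i) s.
Proof. by move=> hk hi; rewrite /vx face_at comb_vert /= lift_inord. Qed.

Lemma face_ed (k : nat) (s : simplex R 2 X) : (k < 3)%N ->
  face (inord k) s = ed (bump k 0) (bump k 1) s.
Proof.
move=> hk; rewrite /ed /edge /face; congr restrict; apply/funext => l.
have [hl ->] : (val l < 2)%N /\ l = inord (val l) by rewrite inord_val ltn_ord.
rewrite lift_inord //= -val_eqE /= inordK //.
by case: l hl => [[|[|//]] ?].
Qed.

Lemma path_diff_ed n (f : X -> R) (i j : nat) (s : simplex R n X) :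
  path_diff f (ed i j s) = f (vx j s) - f (vx i s).
Proof. by rewrite /path_diff /ed /edge !restrictE /= !comb_vert. Qed.

Lemma cobE n (phi : simplex R n X -> R) (s : simplex R n.+1 X) :
  cob phi s = \sum_(i < n.+2) (-1) ^+ i * phi (face (inord i) s).
Proof. by apply: eq_bigr => i _; rewrite inord_val. Qed.

Definition tri (x : simplex R 1 X -> R) n i j k (s : simplex R n X) : R :=
  x (ed i j s) + x (ed j k s) - x (ed i k s).

Lemma cob_tri x (s : simplex R 2 X) : cob x s = tri x 0 1 2 s.
Proof.
rewrite cobE !big_ord_recl big_ord0 /= /bump /= !face_ed // /bump /= /tri.
move: (x _) (x _) (x _) => a b c; ring.
Qed.

Lemma tri_face x n k i j l (s : simplex R n.+1 X) : (k < n.+2)%N -> (i < n.+1)%N ->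
  (j < n.+1)%N -> (l < n.+1)%N ->
  tri x i j l (face (inord k) s) = tri x (bump k i) (bump k j) (bump k l) s.
Proof. by move=> *; rewrite /tri !ed_face. Qed.

Lemma cob2E (phi : simplex R 2 X -> R) (s : simplex R 3 X) :
  cob phi s = phi (face (inord 0) s) - phi (face (inord 1) s) + phi (face (inord 2) s) - phi
    (face (inord 3) s).
Proof.
rewrite cobE !big_ord_recl big_ord0 /= /bump /=.
move: (phi _) (phi _) (phi _) (phi _) => a b c d; ring.
Qed.

Lemma cob3E (phi : simplex R 3 X -> R) (s : simplex R 4 X) :
  cob phi s = phi (face (inord 0) s) - phi (face (inord 1) s) + phi (face (inord 2) s) -
     phi (face (inord 3) s) + phi (face (inord 4) s).
Proof.
rewrite cobE !big_ord_recl big_ord0 /= /bump /=.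
move: (phi _) (phi _) (phi _) (phi _) (phi _) => a b c d e; ring.
Qed.

(** The cup product a u da, front edge times back triangle. When [a] lifts a U(1)-cocycle, da
    represents its Bockstein. *)
Definition bockstein_cup (a : simplex R 1 X -> R) (s : simplex R 3 X) : R :=
  a (ed 0 1 s) * tri a 1 2 3 s.

Lemma tri_int a n i j k (s : simplex R n X) : (forall s, cob a s \is a Num.int) ->
  tri a i j k s \is a Num.int.
Proof.
move=> ca; pose f (l : 'I_3) : 'I_n.+1 := if l == inord 0 then inord i else if l ==
  inord 1 then inord j else inord k.
have := ca (restrict f s); rewrite cob_tri /tri /ed /edge !restrict_restrict.
have H (u v : 'I_3) : f \o (fun l : 'I_2 => if l == 0 then u else v) = fun l => if l ==
  0 then f u else f v.
  by apply/funext => l /=; case: (l == 0).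
have e01 : (inord 1 == inord 0 :> 'I_3) = false by rewrite -val_eqE /= !inordK.
have e02 : (inord 2 == inord 0 :> 'I_3) = false by rewrite -val_eqE /= !inordK.
have e12 : (inord 2 == inord 1 :> 'I_3) = false by rewrite -val_eqE /= !inordK.
by rewrite !H /f !eqxx e01 e02 e12.
Qed.

(** The coboundary is da u da, a product of integers. *)
Lemma cob_bockstein_cup a (s : simplex R 4 X) : (forall s, cob a s \is a Num.int) ->
  cob (bockstein_cup a) s \is a Num.int.
Proof.
move=> ca; have h1 := tri_int 0 1 2 s ca; have h2 := tri_int 2 3 4 s ca.
have := rpredM h1 h2; congr (_ \is a Num.int).
rewrite cob3E /bockstein_cup !tri_face // !ed_face // /bump /= /tri.
by move: (a _) (a _) (a _) (a _) (a _) (a _) (a _) (a _) => *; ring.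
Qed.

End Edges.

(** * Jumps of the argument along a path *)

Section Crossing.
Variables (R : realType) (X : topologicalType).
Local Notation Delta := (std_simplex R).
Local Notation cRe := (@complex.Re R).
Local Notation cIm := (@complex.Im R).

Lemma larg_bound (z : R[i]) : - (1 / 2) < larg z < 1 / 2.
Proof.
have pi0 : 0 < (pi : R) by exact: pi_gt0.
have h1 := atan_gtNpi2 (cIm z / (cabs z + cRe z));
  have h2 := atan_ltpi2 (cIm z / (cabs z + cRe z)).
rewrite /larg ltr_pdivlMr // ltr_pdivrMr //; apply/andP; split; lra.
Qed.

Lemma larg_gt0 (z : R[i]) : 0 < cRe z -> 0 < cIm z -> 0 < larg z.
Proof.
move=> r0 i0; apply: divr_gt0; last exact: pi_gt0.
rewrite -atan0; apply: lt_atan; apply: divr_gt0 => //.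
by have := cabs_ge0 z; lra.
Qed.

Lemma larg_lt0 (z : R[i]) : 0 < cRe z -> cIm z < 0 -> larg z < 0.
Proof.
move=> r0 i0; rewrite -oppr_gt0 /larg -mulNr; apply: divr_gt0; last exact: pi_gt0.
rewrite oppr_gt0 -atan0; apply: lt_atan; rewrite -oppr_gt0 -mulNr; apply: divr_gt0; first lra.
by have := cabs_ge0 z; lra.
Qed.

Lemma e2pi_half : e2pi (1 / 2 : R) = -1.
Proof.
rewrite /e2pi (_ : 2 * pi * (1 / 2) = pi); last by field.
by rewrite cospi sinpi; apply: complex_eq => /=; rewrite ?oppr0.
Qed.

Lemma has_arg_opp (z : R[i]) a : has_arg (- z) a -> has_arg z (1 / 2 + a).
Proof.
move=> h; have := has_argM (has_arg_e2pi (1 / 2)) h.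
by rewrite e2pi_half mulN1r opprK.
Qed.

Lemma slit_opp (z : R[i]) : z != 0 -> ~ (cIm z = 0 /\ 0 < cRe z) -> slit (- z).
Proof.
case: z => x y /= z0 h; apply: slitP => /=; rewrite oppr_eq0.
case: (eqVneq y 0) => //= y0; rewrite oppr_gt0 lt_def.
have -> : 0 != x.
  by apply: contraNneq z0 => <-; rewrite y0.
by rewrite leNgt; apply/negP => x0; case: h.
Qed.

(** Off the positive reals [argc z] is 1/2 + [larg (- z)], which is continuous there, so no jump
    occurs. *)
Lemma dlog_avoid (g : X -> R[i]) (s : simplex R 1 X) : ccontinuous g ->
  (forall x, g (s x) != 0) -> (forall x, ~ (cIm (g (s x)) = 0 /\ 0 < cRe (g (s x)))) ->
  dlog g s - path_diff (@argc R \o g) s = 0.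
Proof.
move=> cg g0 h.
have sl x := slit_opp (g0 x) (h x).
have ha x := has_arg_opp (has_arg_larg (sl x)).
pose F x := 1 / 2 + larg (- g (s x)).
have cF : continuous F.
  move=> x; apply: (@continuousD R R^o _ (fun=> 1 / 2) (fun x => larg (- g (s x))) x);
    first exact: cst_continuous.
  apply: (@larg_continuous R _ (fun x => - g (s x))); last exact: sl.
  have -> : (fun x => - g (s x)) = (fun x => (-1) * g (s x)) by apply/funext => y; rewrite mulN1r.
  apply: ccontM; first exact: ccont_cst.
  have cs : continuous s by exact: cts_fun.
  exact: (ccont_comp cs cg).
have e x : argc (g (s x)) = F x.
  by apply: (argc_eq (g0 x) (ha x)); have := larg_bound (- g (s x)); rewrite /F => /andP[??];
    apply/andP; split; lra.
by rewrite (dlogE g0 cF ha) /path_diff /= !e subrr.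
Qed.

(** In the right half plane [larg] is a continuous lift; [argc] coincides with it above the real
    axis and exceeds it by 1 below. *)
Lemma dlog_cross (g : X -> R[i]) (s : simplex R 1 X) : ccontinuous g ->
  (forall x, 0 < cRe (g (s x))) -> cIm (g (s (vert R 0))) < 0 -> 0 < cIm (g (s (vert R 1))) ->
  dlog g s - path_diff (@argc R \o g) s = 1.
Proof.
move=> cg g0 h0 h1.
have gn0 x : g (s x) != 0 by apply/eqP => e; have := g0 x; rewrite e /= ltxx.
have sl x : slit (g (s x)) by apply: slitP; rewrite g0 orbT.
have ha x := has_arg_larg (sl x).
have cF : continuous (fun x => larg (g (s x))).
  move=> x; apply: (@larg_continuous R _ (fun x => g (s x))); last exact: sl.
  have cs : continuous s by exact: cts_fun.
  exact: (ccont_comp cs cg).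
rewrite (dlogE gn0 cF ha) /path_diff /=.
have b0 := larg_bound (g (s (vert R 0))); have b1 := larg_bound (g (s (vert R 1))).
have n0 := larg_lt0 (g0 _) h0; have n1 := larg_gt0 (g0 _) h1.
have -> : argc (g (s (vert R 1))) = larg (g (s (vert R 1))).
  by apply: (argc_eq (gn0 _) (ha _)); apply/andP; split; lra.
have -> : argc (g (s (vert R 0))) = larg (g (s (vert R 0))) + 1.
  apply: (argc_eq (gn0 _)); last by apply/andP; split; lra.
  by apply: (has_arg_int _ (ha _)); rewrite addrAC subrr add0r.
by move: (larg _) (larg _) => l l'; ring.
Qed.

Lemma tri_dlog (g : X -> R[i]) n i j k (s : simplex R n X) : ccontinuous g ->
  (forall x, g (s x) != 0) -> tri (dlog g) i j k s = 0.
Proof.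
move=> cg g0; have [f cf hf] := simplex_lift cg g0.
rewrite /tri /ed /edge !restrictE !(dlog_sub _ g0 cf hf) /=.
by move: (f _) (f _) (f _) => ? ? ?; ring.
Qed.

Lemma tri_path_diff (f : X -> R) n i j k (s : simplex R n X) : tri (path_diff f) i j k s = 0.
Proof. by rewrite /tri !path_diff_ed; move: (f _) (f _) (f _) => ? ? ?; ring. Qed.

Lemma range_ed n i j (s : simplex R n X) (A : set X) : range s `<=` A -> range (ed i j s) `<=` A.
Proof. by move=> sA; apply: subset_trans sA; exact: within_range (within_restrict _ _). Qed.

Lemma range_face n i (s : simplex R n.+1 X) (A : set X) : range s `<=` A ->
  range (face i s) `<=` A.
Proof. by move=> sA; apply: subset_trans sA; exact: within_range (within_face _ _). Qed.

End Crossing.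

(** * Subtracting a coboundary to localize the cochain *)

Section Localize.
Variables (R : realType) (p q : int).
Hypotheses (p1 : 1 <= p) (cpq : coprimez p q).
Local Notation W := (lens (R := R) p q).
Variables (a : simplex R 1 W -> R) (n : nat) (f : W -> R).
Hypotheses (ca : forall s, cob a s \is a Num.int) (na : normal a n f).

Let g (x : W) : R := g_disk x.
Let th (x : W) : R := argc (ang true x).
Let N : R := n%:R.
Let lam : R := N ^+ 2 * q%:~R / p%:~R.

Let p0 : p%:~R != 0 :> R.
Proof. by rewrite intr_eq0; lia. Qed.

(* The integer by which the argument of [disk true] jumps along [s]. *)
Definition mu (s : simplex R 1 W) : R :=
  if pselect (range s `<=` Y false) then dlog (disk true) s - path_diff g s else 0.

(** An explicit real cochain agreeing with [a] minus the path difference of [f] modulo integers. On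
    simplices inside neither open set it is that difference itself, so that [defect] vanishes
    there. *)
Definition amodel (s : simplex R 1 W) : R :=
  if pselect (range s `<=` Y true) then
    N * q%:~R / p%:~R * dlog (ang true) s + N * path_diff g s + N * mu s
  else if pselect (range s `<=` Y false) then N / p%:~R * dlog (ang false) s
  else a s - path_diff f s.

Definition defect (s : simplex R 1 W) : R := a s - path_diff f s - amodel s.

(** On [Y true] this is the coboundary of the integral cochain [mu]. It vanishes on simplices
    missing the core of the exterior, so it is dual to that core. *)
Definition tau (s : simplex R 2 W) : R :=
  if pselect (range s `<=` Y true) then tri mu 0 1 2 s else 0.

(* The last term turns the winding number of the core angle into its number of
   jumps, which vanishes off [0 < ang true]. *)
Definition Theta (s : simplex R 2 W) : R :=
  f (vx 0 s) * tri a 0 1 2 s - amodel (ed 0 1 s) * defect (ed 1 2 s) +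
  (N ^+ 2 * g (vx 0 s) + lam * th (vx 0 s)) * tau s.

Definition localized (s : simplex R 3 W) : R := bockstein_cup a s - cob Theta s.

Lemma mu_false (s : simplex R 1 W) : range s `<=` Y false ->
  mu s = dlog (disk true) s - path_diff g s.
Proof. by rewrite /mu; case: pselect. Qed.

Lemma amodel_true (s : simplex R 1 W) : range s `<=` Y true -> amodel s =
  N * q%:~R / p%:~R * dlog (ang true) s + N * path_diff g s + N * mu s.
Proof. by rewrite /amodel; case: pselect. Qed.

Lemma model_algebra (n' Q P dT dK G : R) : P != 0 ->
  n' * Q / P * dT + n' * G + n' * (dK - G) = n' / P * (P * dK + Q * dT).
Proof.
move=> P0; have -> : n' / P * (P * dK + Q * dT) = n' * dK * (P / P) + n' * Q / P * dT by ring.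
by rewrite divff //; ring.
Qed.

(** On the overlap the two formulas agree exactly and not only modulo integers; the term in [mu] is
    there for this. *)
Lemma amodel_false (s : simplex R 1 W) : range s `<=` Y false ->
  amodel s = N / p%:~R * dlog (ang false) s.
Proof.
move=> sF; rewrite /amodel; case: pselect => [sT|nT] /=; last by case: pselect.
rewrite mu_false // (dlog_relation cpq) ; last by move=> x xs; split; [exact: sT|exact: sF].
exact: model_algebra.
Qed.

Lemma mu_int (s : simplex R 1 W) : range s `<=` Y true -> mu s \is a Num.int.
Proof.
move=> sT; rewrite /mu; case: pselect => [sF|nF] /=; last exact: rpred0.
by apply: (dlog_disk cpq) => x xs; split; [exact: sT|exact: sF].
Qed.

Lemma defect_algebra (x F w G m : R) : m \is a Num.int -> eqz x (w + F + G) ->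
  x - F - (w + G + m) \is a Num.int.
Proof.
move=> hm h; have := rpredB h hm; congr (_ \is a Num.int); ring.
Qed.

Lemma defect_int s : defect s \is a Num.int.
Proof.
have [nF nT] := na; rewrite /defect.
have [sT|nsT] := pselect (range s `<=` Y true).
  rewrite amodel_true //; apply: defect_algebra.
    by apply: rpredM; [rewrite /N pmulrn intr_int|exact: mu_int].
  by have := nT s sT; rewrite /N [q%:~R * _]mulrC.
have [sF|nsF] := pselect (range s `<=` Y false).
  rewrite amodel_false //; have := nF s sF; rewrite /eqz /N.
  by move: (a s) (path_diff f s) (_ * dlog _ _) => x y w; rewrite opprD addrA addrAC.
rewrite /amodel; case: pselect => // _ /=; case: pselect => // _ /=.
by rewrite subrr rpred0.
Qed.

Lemma cup_algebra (a01 a02 a03 a12 a13 a23 A01 A02 A03 A12 A13 A23 f0 f1 f2 f3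
    C0 C1 t012 t013 t023 t123 : R) :
  a01 * (a12 + a23 - a13) -
   ((f1 * (a12 + a23 - a13) - A12 * (a23 - (f3 - f2) - A23) + C1 * t123) - (f0 * (a02 + a23 -
     a03) - A02 * (a23 - (f3 - f2) - A23) + C0 * t023) +
    (f0 * (a01 + a13 - a03) - A01 * (a13 - (f3 - f1) - A13) + C0 * t013) - (f0 * (a01 + a12 -
      a02) - A01 * (a12 - (f2 - f1) - A12) + C0 * t012)) =
  A01 * (A12 + A23 - A13) + (a01 - (f1 - f0) - A01) * (a12 + a23 - a13) + (A01 + A12 - A02) *
    (a23 - (f3 - f2) - A23)
   - (C1 * t123 - C0 * (t023 - t013 + t012)).
Proof. ring. Qed.

(** With A the model and d the defect, the first two terms of [Theta] leave A u dA + d u da + dA u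
    d; the last term of [Theta] is expanded separately. *)
Lemma localizedE s : localized s =
  amodel (ed 0 1 s) * tri amodel 1 2 3 s + defect (ed 0 1 s) * tri a 1 2 3 s +
  tri amodel 0 1 2 s * defect (ed 2 3 s) -
  ((N ^+ 2 * g (vx 1 s) + lam * th (vx 1 s)) * tau (face (inord 0) s) -
   (N ^+ 2 * g (vx 0 s) + lam * th (vx 0 s)) *
     (tau (face (inord 1) s) - tau (face (inord 2) s) + tau (face (inord 3) s))).
Proof.
rewrite /localized cob2E /Theta /bockstein_cup !tri_face // !ed_face // !vx_face // /bump /=
  /tri /defect !path_diff_ed.
exact: cup_algebra.
Qed.

Lemma in_range k (s : simplex R k W) b : range s `<=` Y b -> forall x, Y b (s x).
Proof. by move=> sY x; apply: sY; exists x. Qed.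

Lemma tri_dlog_ang b k i j l (s : simplex R k W) : range s `<=` Y b ->
  tri (dlog (ang b)) i j l s = 0.
Proof.
move=> sY; apply: tri_dlog; first exact: ang_continuous.
by move=> x; apply: ang_neq0 => //; exact: in_range.
Qed.

Lemma tri_lin x y (k : R) m i j l (s : simplex R m W) : (forall i j, x (ed i j s) =
  k * y (ed i j s)) ->
  tri x i j l s = k * tri y i j l s.
Proof. by move=> h; rewrite /tri !h mulrBr mulrDr. Qed.

Lemma tri_sub x y z m i j l (s : simplex R m W) :
  (forall i j, x (ed i j s) = y (ed i j s) - z (ed i j s)) ->
    tri x i j l s = tri y i j l s - tri z i j l s.
Proof.
have e (u v w u' v' w' : R) : u - u' + (v - v') - (w - w') = u + v - w - (u' + v' - w') by ring.
by move=> h; rewrite /tri !h e.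
Qed.

(** Away from the core of the exterior [mu] is a difference of two closed cochains. *)
Lemma tau_false (s : simplex R 2 W) : range s `<=` Y false -> tau s = 0.
Proof.
move=> sF; rewrite /tau; case: pselect => [sT|//] /=.
have t1 : tri (dlog (disk true)) 0 1 2 s = 0.
  apply: tri_dlog; first exact: disk_continuous.
  by move=> x; apply: (disk_neq0 cpq); split; exact: in_range.
have t2 := tri_path_diff g 0 1 2 s.
rewrite (@tri_sub _ (dlog (disk true)) (path_diff g)) ?t1 ?t2 ?subrr // => i j.
by apply: mu_false; exact: range_ed.
Qed.

Lemma tau_true (s : simplex R 2 W) : range s `<=` Y true -> tau s = tri mu 0 1 2 s.
Proof. by rewrite /tau; case: pselect. Qed.

Lemma tri_lin3 x y z w (c k : R) m i j l (s : simplex R m W) :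
  (forall i j, x (ed i j s) = c * y (ed i j s) + k * z (ed i j s) + k * w (ed i j s)) ->
  tri x i j l s = c * tri y i j l s + k * tri z i j l s + k * tri w i j l s.
Proof.
have e (u v r u' v' r' u2 v2 r2 : R) :
    c * u + k * u' + k * u2 + (c * v + k * v' + k * v2) - (c * r + k * r' + k * r2) =
    c * (u + v - r) + k * (u' + v' - r') + k * (u2 + v2 - r2) by ring.
by move=> h; rewrite /tri !h e.
Qed.

Lemma zero_algebra (x d t e C D : R) : x * 0 + d * t + 0 * e - (C * 0 - D * (0 - 0 + 0)) = d * t.
Proof. by ring. Qed.

(** The model is closed here and [tau] vanishes, so only defect u da survives, a product of
    integers. *)
Lemma localized_false (s : simplex R 3 W) : range s `<=` Y false -> localized s \is a Num.int.
Proof.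
move=> sF; rewrite localizedE !tau_false; try exact: range_face.
have tA i j k : tri amodel i j k s = 0.
  rewrite (@tri_lin _ (dlog (ang false)) (N / p%:~R)) ?tri_dlog_ang ?mulr0 // => u v.
  by apply: amodel_false; exact: range_ed.
have tA1 := tA 1%N 2 3; have tA2 := tA 0%N 1%N 2.
rewrite tA1 tA2 zero_algebra.
by apply: rpredM; [exact: defect_int|exact: tri_int].
Qed.

Lemma tri_int_cochain x m i j k (s : simplex R m W) : (forall i j, x (ed i j s) \is a Num.int) ->
  tri x i j k s \is a Num.int.
Proof. by move=> h; rewrite /tri; apply: rpredB => //; exact: rpredD. Qed.

Lemma true_algebra (w x1 x0 th1 th0 m01 Q P NN t012 t013 t023 t123 d e : R) :
  t123 - t023 + t013 - t012 = 0 ->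
  (NN * Q / P * w + NN * (x1 - x0) + NN * m01) * (NN * t123) + d + e -
   ((NN ^+ 2 * x1 + NN ^+ 2 * Q / P * th1) * t123 - (NN ^+ 2 * x0 + NN ^+ 2 * Q / P * th0) *
     (t023 - t013 + t012))
   - NN ^+ 2 * Q / P * (w - (th1 - th0)) * t123 = NN * NN * m01 * t123 + (d + e).
Proof.
move=> h; have -> : t023 - t013 + t012 = t123 by apply/eqP; rewrite -subr_eq0; apply/eqP;
  rewrite -[RHS]oppr0 -h; ring.
ring.
Qed.

(** Here dA = N tau, so A u dA is lam dlog u tau + N^2 dg u tau modulo integers. The last term of
    [Theta] cancels the second summand and subtracts the path difference of [th] from dlog, which
    leaves lam times the jump cochain of [ang true] cupped with tau. *)
Lemma localized_true (s : simplex R 3 W) : range s `<=` Y true ->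
  localized s - lam * (dlog (ang true) (ed 0 1 s) - path_diff (@argc R \o ang true) (ed 0 1 s))
    * tri mu 1 2 3 s
   \is a Num.int.
Proof.
move=> sT; rewrite localizedE !tau_true; try exact: range_face.
rewrite !tri_face // /bump /=.
have eT i j : range (ed i j s) `<=` Y true by exact: range_ed.
have muI i j : mu (ed i j s) \is a Num.int by exact: mu_int.
have NI : N \is a Num.int by rewrite /N pmulrn intr_int.
have tA i j k : tri amodel i j k s = N * tri mu i j k s.
  have h0 := @tri_dlog_ang true _ i j k _ sT; have h1 := tri_path_diff g i j k s.
  rewrite (@tri_lin3 _ (dlog (ang true)) (path_diff g) mu (N * q%:~R / p%:~R) N) ?h0 ?h1 ?mulr0
    ?add0r //.
  by move=> u v; exact: amodel_true.
have tA1 := tA 1%N 2 3; have tA2 := tA 0%N 1%N 2.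
rewrite tA1 tA2 amodel_true //.
have dI : defect (ed 0 1 s) * tri a 1 2 3 s + N * tri mu 0 1 2 s * defect (ed 2 3 s) \is a
  Num.int.
  apply: rpredD; apply: rpredM; try exact: defect_int; first exact: tri_int.
  by apply: rpredM => //; exact: tri_int_cochain.
have := rpredD (rpredM (rpredM (rpredM NI NI) (muI 0%N 1%N)) (tri_int_cochain 1 2 3 muI)) dI.
have tt : tri mu 1 2 3 s - tri mu 0 2 3 s + tri mu 0 1 3 s - tri mu 0 1 2 s = 0.
  by rewrite /tri; move: (mu _) (mu _) (mu _) (mu _) (mu _) (mu _) => *; ring.
rewrite !path_diff_ed /= -/(th _) -/(th _) /lam => h.
by rewrite (true_algebra _ _ _ _ _ _ _ _ _ _ _ tt).
Qed.

Lemma cob_localized s : cob localized s \is a Num.int.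
Proof.
have -> : cob localized s = cob (bockstein_cup a) s - cob (cob Theta) s.
  rewrite !cob3E /localized; move: (bockstein_cup a _) (bockstein_cup a _) (bockstein_cup a _)
    (bockstein_cup a _) (bockstein_cup a _) => *.
  by move: (cob _ _) (cob _ _) (cob _ _) (cob _ _) (cob _ _) => *; ring.
by rewrite cob_cob subr0; exact: cob_bockstein_cup.
Qed.

Lemma ev_localized z : boundary z = 0 -> ev localized z = ev (bockstein_cup a) z.
Proof. by move=> z0; rewrite ev_cochainB -ev_boundary z0 raddf0 subr0. Qed.

End Localize.

(** * Evaluation on a prism around a core point *)

Section Prism.
Variable R : realType.
Local Notation Delta := (std_simplex R).
Local Notation cRe := (@complex.Re R).
Local Notation cIm := (@complex.Im R).

(* Vertices 0, 1, 2 span the bottom and 3, 4, 5 the top of the prism, whose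
   points have coordinates (z, w) = (px + i py, 4 + i ph) in C^2. *)
Definition px (k : nat) : R := match k with 0 | 3 => -1 | _ => 2 end.
Definition py (k : nat) : R := match k with 0 | 3 => 0 | 1 | 4 => -1 | _ => 1 end.
Definition ph (k : nat) : R := match k with 0 | 1 | 2 => -1 | _ => 1 end.

(** Affine interpolation of a function of the prism vertices over the simplex whose vertices are
    listed in [l]. *)
Definition bary_sum (F : nat -> R) m (l : seq nat) (t : Delta m) : R :=
  \sum_i val t 0 i * F (nth 0%N l i).

Lemma bary_sum_ge F lo m l (t : Delta m) : (forall k, lo <= F k) -> lo <= bary_sum F l t.
Proof.
move=> h; rewrite /bary_sum -[leLHS]mul1r -(simplex_sum1 t) mulr_suml; apply: ler_sum => i _.
by apply: ler_wpM2l; [exact: simplex_ge0|exact: h].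
Qed.

Lemma bary_sum_le F hi m l (t : Delta m) : (forall k, F k <= hi) -> bary_sum F l t <= hi.
Proof.
move=> h; rewrite /bary_sum -[leRHS]mul1r -(simplex_sum1 t) mulr_suml; apply: ler_sum => i _.
by apply: ler_wpM2l; [exact: simplex_ge0|exact: h].
Qed.

Lemma bary_sum_cst c m l (t : Delta m) : bary_sum (fun=> c) l t = c.
Proof. by rewrite /bary_sum -mulr_suml simplex_sum1 mul1r. Qed.

Lemma bary_sum_vert F m l i : bary_sum F l (vert R i : Delta m) = F (nth 0%N l i).
Proof.
rewrite /bary_sum (bigD1 i) //= val_vert eqxx mul1r big1 ?addr0 // => j ji.
by rewrite val_vert eq_sym (negbTE ji) mul0r.
Qed.

Lemma bary_sum_affine F m k l l' (f : 'I_k.+1 -> 'I_m.+1) (t : Delta k) :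
  (forall i : 'I_k.+1, nth 0%N l' i = nth 0%N l (f i)) ->
    bary_sum F l (affine_map f t) = bary_sum F l' t.
Proof.
move=> h; rewrite /bary_sum [RHS](partition_big f xpredT) //; apply: eq_bigr => j _.
by rewrite mxE mulr_suml; apply: eq_bigr => i /eqP <-; rewrite h.
Qed.

Lemma bary_sum_continuous F m l : continuous (fun t : Delta m => bary_sum F l t).
Proof.
apply: (@sum_continuous R _ _ _ (fun i (t : Delta m) => val t 0 i * F (nth 0%N l i))) => i t.
by apply: continuousM; [exact: (@coord_simplex_continuous R m i t)|exact: cst_continuous].
Qed.

Section Points.
Variables (m : nat) (l : seq nat).
Implicit Types t : Delta m.

Definition zc t : R[i] := bary_sum px l t +i* bary_sum py l t.
Definition wc t : R[i] := 4 +i* bary_sum ph l t.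

Lemma px_bound t : -1 <= bary_sum px l t <= 2.
Proof. by rewrite bary_sum_ge ?bary_sum_le // => -[|[|[|[|k]]]] /=; lra. Qed.

Lemma py_bound t : -1 <= bary_sum py l t <= 1.
Proof. by rewrite bary_sum_ge ?bary_sum_le // => -[|[|[|[|[|k]]]]] /=; lra. Qed.

(** The real part 4 of w keeps the prism inside |z| < |w|, so that its radial projection lies in the
    exterior. *)
Lemma zc_le_wc t : cabs (zc t) ^+ 2 <= 5 /\ 16 <= cabs (wc t) ^+ 2.
Proof.
rewrite !sqr_cabs /=; have := px_bound t; have := py_bound t.
move: (bary_sum px l t) (bary_sum py l t) (bary_sum ph l t) => x y h.
by move=> /andP[??] /andP[??]; split; nra.
Qed.

(** The factor of the radial projection to the sphere of radius sqrt 2. *)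
Definition proj_scale t : R := Num.sqrt (2 / (cabs (zc t) ^+ 2 + cabs (wc t) ^+ 2)).

Let den t : 0 < cabs (zc t) ^+ 2 + cabs (wc t) ^+ 2.
Proof. by have [_ h] := zc_le_wc t; have := sqr_ge0 (cabs (zc t)); lra. Qed.

Lemma proj_scale_gt0 t : 0 < proj_scale t.
Proof. by rewrite sqrtr_gt0 divr_gt0. Qed.

Lemma wc_neq0 t : wc t != 0.
Proof. by rewrite eq_complex /= pnatr_eq0. Qed.

Definition uc t : R[i] := (proj_scale t)%:C * zc t.

Lemma cabs_uc t : cabs (uc t) = proj_scale t * cabs (zc t).
Proof. by rewrite cabsM cabs_real gtr0_norm // proj_scale_gt0. Qed.

Lemma sqr_proj_scale t : proj_scale t ^+ 2 = 2 / (cabs (zc t) ^+ 2 + cabs (wc t) ^+ 2).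
Proof. by rewrite sqr_sqrtr // ltW // divr_gt0. Qed.

Lemma prism_valid t : valid (uc t) (phase (wc t)).
Proof.
split; last exact: cabs_phase.
have h0 : 0 <= cabs (uc t) by exact: cabs_ge0.
suff : cabs (uc t) ^+ 2 <= 1 by nra.
rewrite cabs_uc exprMn sqr_proj_scale mulrAC ler_pdivrMr // mul1r.
by have [h1 h2] := zc_le_wc t; lra.
Qed.

(** The coordinates [uc] and [phase (wc t)] do describe the radial projection of (z, w). *)
Lemma rad_uc t : (rad true (uc t))%:C * phase (wc t) = (proj_scale t)%:C * wc t.
Proof.
have -> : rad true (uc t) = proj_scale t * cabs (wc t).
  rewrite /rad cabs_uc exprMn.
  have -> : 2 - proj_scale t ^+ 2 * cabs (zc t) ^+ 2 = (proj_scale t * cabs (wc t)) ^+ 2.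
    rewrite exprMn sqr_proj_scale; have := den t.
    move: (_ ^+ 2) (_ ^+ 2) => A B AB; field; lra.
  by rewrite sqrtr_sqr ger0_norm // mulr_ge0 ?cabs_ge0 // ltW // proj_scale_gt0.
have w0 := wc_neq0 t; rewrite /phase (negbTE w0) rmorphM /=
  mulrA -(mulrA (proj_scale t)%:C) -[_%:C * _%:C]rmorphM /=.
by rewrite divff ?cabs_eq0 // mulr1.
Qed.

Lemma uc_continuous t : ccont uc t.
Proof.
have cz : ccont zc t by split => /=; exact: bary_sum_continuous.
have cw : ccont wc t by split => /=; [exact: cst_continuous|exact: bary_sum_continuous].
apply: ccontM => //; apply: ccont_real.
apply: (@continuous_comp _ _ _ (fun t => 2 / (cabs (zc t) ^+ 2 + cabs (wc t) ^+ 2)) (@Num.sqrt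
  R)); last exact: sqrt_continuous.
apply: continuousM; first exact: cst_continuous.
apply: continuousV; first by rewrite gt_eqF.
by apply: continuousD; apply: continuousM; exact: ccont_cabs.
Qed.

Lemma phase_wc_continuous t : ccont (fun t => phase (wc t)) t.
Proof.
apply: ccont_phase; last exact: wc_neq0.
by split => /=; [exact: cst_continuous|exact: bary_sum_continuous].
Qed.

End Points.

Lemma restrict_points k m l l' (f : 'I_k.+1 -> 'I_m.+1) t :
  (forall i : 'I_k.+1, nth 0%N l' i = nth 0%N l (f i)) ->
  uc l (affine_map f t) = uc l' t /\ wc l (affine_map f t) = wc l' t.
Proof.
move=> h; have e F := @bary_sum_affine F _ _ _ _ _ t h.
by rewrite /uc /proj_scale /zc /wc !e.
Qed.

End Prism.

Section PrismInLens.
Variables (R : realType) (p q : int).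
Hypothesis cpq : coprimez p q.
Local Notation W := (lens (R := R) p q).
Local Notation Delta := (std_simplex R).
Local Notation cRe := (@complex.Re R).
Local Notation cIm := (@complex.Im R).

Lemma prism_continuous m l :
  continuous (fun t : Delta m => lpt p q true (uc l t) (phase (wc l t))).
Proof.
move=> t; apply: (@lpt_continuous R p q true _ (uc l) (fun t => phase (wc l t)) t (@prism_valid
  R m l)).
  exact: uc_continuous.
exact: phase_wc_continuous.
Qed.

Definition prism m (l : seq nat) : simplex R m W := simplex_of (@prism_continuous m l).

Lemma prism_restrict k m l l' (f : 'I_k.+1 -> 'I_m.+1) :
  (forall i : 'I_k.+1, nth 0%N l' i = nth 0%N l (f i)) -> restrict f (prism m l) = prism k l'.
Proof.
move=> h; apply: simplexP => t; have [e1 e2] := restrict_points t h.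
rewrite -[LHS]/(lpt p q true (uc l (affine_map f t)) (phase (wc l (affine_map f t)))).
by rewrite e1 e2.
Qed.

Lemma prism_ed m l i j : (i < m.+1)%N -> (j < m.+1)%N ->
  ed i j (prism m l) = prism 1 [:: nth 0%N l i; nth 0%N l j].
Proof.
move=> hi hj; apply: prism_restrict; case=> [[|[|//]] h] /=.
  by rewrite inordK.
by rewrite inordK.
Qed.

Lemma prism_face m l l' (k : nat) : (k < m.+2)%N ->
  (forall i, (i < m.+1)%N -> nth 0%N l' i = nth 0%N l (bump k i)) ->
  face (inord k) (prism m.+1 l) = prism m l'.
Proof. by move=> hk h; apply: prism_restrict => i; rewrite /= inordK //; exact: h. Qed.

Lemma ang_prism m l t : ang true (prism m l t) = phase (wc l t).
Proof. by rewrite /= angE //; exact: prism_valid. Qed.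

Lemma disk_prism m l t : disk true (prism m l t) = uc l t.
Proof. by rewrite /= diskE //; exact: prism_valid. Qed.

Lemma prism_true m l : range (prism m l) `<=` Y true.
Proof.
move=> _ [t _ <-]; rewrite /Y /= depthE ?/depth_piece ?oner_eq0 //.
exact: prism_valid.
Qed.

Lemma uc_neq0 m l (t : Delta m) : zc l t != 0 -> uc l t != 0.
Proof.
move=> z0; apply: mulf_neq0 => //.
by rewrite eq_complex /= eqxx andbT gt_eqF // proj_scale_gt0.
Qed.

Lemma prism_false m l : (forall t : Delta m, zc l t != 0) -> range (prism m l) `<=` Y false.
Proof.
move=> z0 _ [t _ <-]; rewrite /Y /= depthE; last exact: prism_valid.
by rewrite /depth_piece /= eq_complex /= eqxx andbT cabs_eq0 uc_neq0.
Qed.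

Lemma real_scaleE (x : R) (z : R[i]) : cRe (x%:C * z) = x * cRe z /\ cIm (x%:C * z) = x * cIm z.
Proof. by rewrite cReM cImM /= !mul0r subr0 addr0. Qed.

Lemma phase_wcE m l (t : Delta m) : phase (wc l t) = ((cabs (wc l t))^-1)%:C * wc l t.
Proof. by rewrite /phase (negbTE (wc_neq0 _ _)). Qed.

Lemma ang_prism_re m l t : 0 < cRe (ang true (prism m l t)).
Proof.
rewrite ang_prism phase_wcE (real_scaleE _ _).1 mulr_gt0 //= invr_gt0 cabs_gt0; exact: wc_neq0.
Qed.

Lemma ang_prism_im m l t : exists2 k : R, 0 < k & cIm (ang true (prism m l t)) =
  k * bary_sum (@ph R) l t.
Proof.
exists (cabs (wc l t))^-1; first by rewrite invr_gt0 cabs_gt0; exact: wc_neq0.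
by rewrite ang_prism phase_wcE (real_scaleE _ _).2.
Qed.

Lemma disk_prism_im m l t : cIm (disk true (prism m l t)) = proj_scale l t * bary_sum (@py R) l t.
Proof. by rewrite disk_prism (real_scaleE _ _).2. Qed.

Lemma disk_prism_re m l t : cRe (disk true (prism m l t)) = proj_scale l t * bary_sum (@px R) l t.
Proof. by rewrite disk_prism (real_scaleE _ _).1. Qed.

(** The points of [Y true] where [ang true] avoids the positive reals, so that its branch [argc]
    does not jump. *)
Definition slit_set : set W := Y true `&` [set x | slit (- ang true x)].

Lemma slit_set_open : open slit_set.
Proof.
apply: openI; first exact: Y_open.
have c : continuous (fun x : W => cabs (- ang true x) + cRe (- ang true x)).
  have cn : ccontinuous (fun x : W => - ang true x).
    move=> x; have -> : (fun x => - ang true x) =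
      (fun x : W => (-1) * ang true x) by apply/funext => y; rewrite mulN1r.
    by apply: ccontM; [exact: ccont_cst|exact: ang_continuous].
  move=> x; apply: (@continuousD R R^o _ (fun x : W => cabs (- ang true x)) (fun x : W => cRe (-
    ang true x)) x).
    by apply: ccont_cabs; exact: cn.
  by apply: (ccont_re (g := fun x : W => - ang true x)); exact: cn.
apply: (@open_comp _ _ (fun x : W => cabs (- ang true x) + cRe (- ang true x)) [set y | 0 < y])
  => [x _|].
  exact: c.
exact: open_gt.
Qed.

Lemma slit_oppP (z : R[i]) : slit (- z) -> ~ (cIm z = 0 /\ 0 < cRe z).
Proof.
case: z => x y; rewrite /slit /= /cabs /= => h [y0 x0]; move: h.
by rewrite y0 oppr0 expr0n /= addr0 sqrrN sqrtr_sqr gtr0_norm // subrr ltxx.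
Qed.

Lemma prism_slit m l : (forall t : Delta m, bary_sum (@ph R) l t != 0) ->
  range (prism m l) `<=` slit_set.
Proof.
move=> h _ [t _ <-]; split; first by apply: (@prism_true m l); exists t.
apply: slit_opp; first by apply: (ang_neq0 cpq); apply: (@prism_true m l); exists t.
have [k k0 ->] := ang_prism_im l t; case=> /eqP.
by rewrite mulf_eq0 gt_eqF //= (negbTE (h t)).
Qed.

Lemma prism_boundary_algebra (V : zmodType) (a1 a2 a3 b1 b2 c1 c2 c3 u v : V) :
  (a1 - a2 + u - a3) - (b1 - v + u - b2) + (c1 - v + c2 - c3) =
    (a1 - a2 - a3) - (b1 - b2) + (c1 + c2 - c3).
Proof.
have -> : a1 - a2 + u - a3 = (a1 - a2 - a3) + u by rewrite addrAC.
have -> : b1 - v + u - b2 = (b1 - b2) + (u - v).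
  by rewrite [LHS]addrAC [b1 - v - b2]addrAC -addrA [- v + u]addrC.
have -> : c1 - v + c2 - c3 = (c1 + c2 - c3) - v by rewrite [c1 - v + c2]addrAC [LHS]addrAC.
move: (a1 - a2 - a3) (b1 - b2) (c1 + c2 - c3) => A B C.
by rewrite opprD opprB [A + u + _]addrACA [u + (v - u)]addrC subrK addrACA subrr addr0.
Qed.

End PrismInLens.

Section Support.
Variables (R : realType) (X : topologicalType).

Definition on_support n (P : simplex R n X -> Prop) (z : chain R n X) : Prop :=
  forall s, s \in dom z -> P s.

Lemma on_supportD n (P : simplex R n X -> Prop) z z' :
  on_support P z -> on_support P z' -> on_support P (z + z').
Proof. by move=> h h' s /domD_subset; rewrite mem_cat => /orP[/h|/h']. Qed.

Lemma on_supportN n (P : simplex R n X -> Prop) z : on_support P z -> on_support P (- z).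
Proof. by move=> h s; rewrite domN => /h. Qed.

Lemma on_supportU n (P : simplex R n X -> Prop) s : P s -> on_support P << s >>.
Proof. by move=> h t; rewrite domU1 inE => /eqP ->. Qed.

Lemma boundary3 (s : simplex R 3 X) :
  boundary << s >> = << face (inord 0) s >> - << face (inord 1) s >> + << face (inord 2) s >> -
    << face (inord 3) s >>.
Proof.
rewrite boundaryU (eq_bigr (fun i : 'I_4 => (-1) ^+ i *: << face (inord i) s >>)) => [|i _];
  last by rewrite inord_val.
rewrite !big_ord_recl big_ord0 addr0 /= /bump /= !addn0 !add1n.
by rewrite expr0 expr1 !exprS expr0 !mulN1r !opprK !scaleN1r !scale1r !addrA.
Qed.

End Support.

Section Evaluate.
Variables (R : realType) (p q : int).
Hypothesis cpq : coprimez p q.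
Local Notation W := (lens (R := R) p q).
Local Notation Delta := (std_simplex R).
Local Notation cRe := (@complex.Re R).
Local Notation cIm := (@complex.Im R).
Local Notation prism := (@prism R p q).
Local Notation px := (@px R).
Local Notation py := (@py R).
Local Notation ph := (@ph R).
Local Notation jump g s := (dlog g s - path_diff (@argc R \o g) s).

Lemma bary_sum1 F l (t : Delta 1) : bary_sum F l t =
  val t 0 0 * F (nth 0%N l 0) + val t 0 1 * F (nth 0%N l 1).
Proof.
rewrite /bary_sum !big_ord_recl big_ord0 addr0; congr (_ + val t 0 _ * F (nth _ _ _)).
exact: val_inj.
Qed.

Lemma simplex1 (t : Delta 1) : [/\ 0 <= val t 0 0, 0 <= val t 0 1 & val t 0 0 + val t 0 1 = 1].
Proof.
split; try exact: simplex_ge0.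
have := bary_sum_cst 1 [::] t; rewrite bary_sum1 !mulr1; exact.
Qed.

Lemma bary_sum2 F l (t : Delta 2) : bary_sum F l t = val t 0 (inord 0) * F (nth 0%N l 0) +
  val t 0 (inord 1) * F (nth 0%N l 1) + val t 0 (inord 2) * F (nth 0%N l 2).
Proof.
have e k (i : 'I_3) : val i = k -> val t 0 i * F (nth 0%N l i) =
  val t 0 (inord k) * F (nth 0%N l k).
  by move=> <-; rewrite inord_val.
by rewrite /bary_sum !big_ord_recl big_ord0 addr0 addrA (e 0%N) // (e 1%N) // (e 2%N).
Qed.

Lemma simplex2 (t : Delta 2) : [/\ 0 <= val t 0 (inord 0), 0 <= val t 0 (inord 1), 0 <=
  val t 0 (inord 2) &
  val t 0 (inord 0) + val t 0 (inord 1) + val t 0 (inord 2) = 1].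
Proof.
split; try exact: simplex_ge0.
have := bary_sum_cst 1 [::] t; rewrite bary_sum2 !mulr1; exact.
Qed.

Lemma bary_sum3 F l (t : Delta 3) : bary_sum F l t = val t 0 (inord 0) * F (nth 0%N l 0) +
  val t 0 (inord 1) * F (nth 0%N l 1) + val t 0 (inord 2) * F (nth 0%N l 2) + val t 0 (inord 3)
    * F (nth 0%N l 3).
Proof.
have e k (i : 'I_4) : val i = k -> val t 0 i * F (nth 0%N l i) =
  val t 0 (inord k) * F (nth 0%N l k).
  by move=> <-; rewrite inord_val.
by rewrite /bary_sum !big_ord_recl big_ord0 addr0 !addrA (e 0%N) // (e 1%N) // (e 2%N) // (e 3%N).
Qed.

Lemma simplex3 (t : Delta 3) : [/\ 0 <= val t 0 (inord 0), 0 <= val t 0 (inord 1), 0 <=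
  val t 0 (inord 2), 0 <= val t 0 (inord 3) &
  val t 0 (inord 0) + val t 0 (inord 1) + val t 0 (inord 2) + val t 0 (inord 3) = 1].
Proof.
split; try exact: simplex_ge0.
have := bary_sum_cst 1 [::] t; rewrite bary_sum3 !mulr1; exact.
Qed.

Lemma zc_eq0 m l (t : Delta m) : zc l t = 0 -> bary_sum px l t = 0 /\ bary_sum py l t = 0.
Proof. by move=> /eqP; rewrite eq_complex /= => /andP[/eqP ? /eqP ?]. Qed.

Lemma ang_prism_neq0 m l t : ang true (prism m l t) != 0.
Proof. by apply: (ang_neq0 cpq); apply: (@prism_true R p q m l); exists t. Qed.

Lemma jump_bottom l : nth 0%N l 0 \in [:: 0; 1; 2]%N -> nth 0%N l 1 \in [:: 0; 1; 2]%N ->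
  jump (ang true) (prism 1 l) = 0.
Proof.
move=> h0 h1; apply: dlog_avoid; first exact: ang_continuous.
  by move=> t; exact: ang_prism_neq0.
move=> t [+ _]; have [k k0 ->] := ang_prism_im cpq l t.
have ph1 i : i \in [:: 0; 1; 2]%N -> ph i = -1 by rewrite !inE => /or3P[] /eqP ->.
rewrite bary_sum1 !ph1 //; have [_ _ e] := simplex1 t.
by move: (val t 0 0) (val t 0 1) e => x y; nra.
Qed.

Lemma jump_up : jump (ang true) (prism 1 [:: 0; 3]%N) = 1.
Proof.
apply: dlog_cross; first exact: ang_continuous.
- by move=> t; exact: (ang_prism_re cpq).
- have [k k0 ->] := ang_prism_im cpq [:: 0; 3]%N (vert R 0 : Delta 1).
  by rewrite bary_sum_vert /= mulrN1 oppr_lt0.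
- have [k k0 ->] := ang_prism_im cpq [:: 0; 3]%N (vert R 1 : Delta 1).
  by rewrite bary_sum_vert /= mulr1.
Qed.

Lemma mu_prism l : (forall t : Delta 1, zc l t != 0) ->
  mu (prism 1 l) = jump (disk true) (prism 1 l).
Proof. by move=> h; rewrite mu_false //; exact: prism_false. Qed.

Lemma mu_avoid l : (forall t : Delta 1, ~ (bary_sum py l t = 0 /\ 0 <= bary_sum px l t)) ->
  mu (prism 1 l) = 0.
Proof.
move=> h; have z0 (t : Delta 1) : zc l t != 0.
  by apply/eqP => /zc_eq0[e1 e2]; apply: (h t); rewrite e1.
rewrite mu_prism //; apply: dlog_avoid; first exact: disk_continuous.
  by move=> t; rewrite (disk_prism cpq) uc_neq0.
move=> t [/eqP]; rewrite (disk_prism_im cpq) (disk_prism_re cpq).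
have k0 := proj_scale_gt0 l t.
rewrite mulf_eq0 gt_eqF //= => /eqP e; rewrite pmulr_rgt0 // => x0.
by apply: (h t); split => //; exact: ltW.
Qed.

(** Together with the next two values: only the edge from 4 to 5 crosses the ray where py = 0 and px
    >= 0, upwards at px = 2. Hence the top triangle winds once around the core. *)
Lemma mu34 : mu (prism 1 [:: 3; 4]%N) = 0.
Proof.
apply: mu_avoid => t; rewrite !bary_sum1 /=; have [? ? e] := simplex1 t => -[]; lra.
Qed.

Lemma mu35 : mu (prism 1 [:: 3; 5]%N) = 0.
Proof.
apply: mu_avoid => t; rewrite !bary_sum1 /=; have [? ? e] := simplex1 t => -[]; lra.
Qed.

Lemma mu45 : mu (prism 1 [:: 4; 5]%N) = 1.
Proof.
have x2 (t : Delta 1) : bary_sum px [:: 4; 5]%N t = 2.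
  by rewrite bary_sum1 /= -mulrDl; have [_ _ ->] := simplex1 t; rewrite mul1r.
rewrite mu_prism; last first.
  by move=> t; apply/eqP => /zc_eq0[]; rewrite x2 => /eqP; rewrite pnatr_eq0.
apply: dlog_cross; first exact: disk_continuous.
- by move=> t; rewrite (disk_prism_re cpq) x2 mulr_gt0 // proj_scale_gt0.
- by rewrite (disk_prism_im cpq) bary_sum_vert /= mulrN1 oppr_lt0 proj_scale_gt0.
- by rewrite (disk_prism_im cpq) bary_sum_vert /= mulr1 proj_scale_gt0.
Qed.

End Evaluate.

Section PositiveSimplex.
Variables (R : realType) (p q : int).
Local Notation W := (lens (R := R) p q).
Local Notation Delta := (std_simplex R).
Local Notation l := [:: 0; 3; 4; 5]%N.

Lemma center_simplex_continuous :
  continuous (fun t : Delta 3 => in_piece true (@prism_valid R 3 l t)).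
Proof.
move=> t; apply: (@piece_continuous R true _ (uc l) (fun t => phase (wc l t)) t).
  exact: uc_continuous.
exact: phase_wc_continuous.
Qed.

Definition center_simplex : simplex R 3 (piece (R := R) true) :=
  simplex_of center_simplex_continuous.

Lemma center_simplexE : (of_exterior p q \o center_simplex : simplex R 3 W) = @prism R p q 3 l.
Proof.
apply: simplexP => t; rewrite -[RHS]/(lpt p q true (uc l t) (phase (wc l t))).
by rewrite (lptE _ _ _ (prism_valid l t)).
Qed.

Definition center_matrix : 'M[R]_4 :=
  \matrix_(i < 4, j < 4) [:: @px R (nth 0%N l i); @py R (nth 0%N l i); 4; @ph R (nth 0%N l i)]`_j.

Lemma det_center_matrix : \det center_matrix = 48.
Proof.
rewrite (expand_det_row _ ord0) !big_ord_recl big_ord0 /cofactor.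
rewrite !(expand_det_row _ ord0) !big_ord_recl !big_ord0 /cofactor.
rewrite !(expand_det_row _ ord0) !big_ord_recl !big_ord0 /cofactor !det_mx11.
rewrite !mxE /=.
rewrite /bump /= !expr0 !expr1 !addn0.
ring.
Qed.

(** The rows of the matrix are the four vertices in R^4. Its positive determinant settles the sign
    with which the central simplex represents the class. *)
Lemma center_simplex_positive : positive_simplex center_simplex.
Proof.
exists center_matrix; first by rewrite det_center_matrix.
move=> t; exists (proj_scale l t); first exact: proj_scale_gt0.
have pointE : val (center_simplex t) = (uc l t, (proj_scale l t)%:C * wc l t) by rewrite -rad_uc.
have [e1 e2] := real_scaleE (proj_scale l t) (zc l t).
have [e3 e4] := real_scaleE (proj_scale l t) (wc l t).
apply/rowP => j; rewrite pointE mxE [RHS]mxE [in RHS]mxE.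
have -> : [:: complex.Re (uc l t, (proj_scale l t)%:C * wc l t).1;
  complex.Im (uc l t, (proj_scale l t)%:C * wc l t).1;
    complex.Re (uc l t, (proj_scale l t)%:C * wc l t).2;
      complex.Im (uc l t, (proj_scale l t)%:C * wc l t).2] =
    [:: proj_scale l t * bary_sum (@px R) l t; proj_scale l t * bary_sum (@py R) l t;
      proj_scale l t * 4;
        proj_scale l t * bary_sum (@ph R) l t].
  by rewrite /uc e1 e2 e3 e4.
have -> : \sum_i val t 0 i * center_matrix i j =
   [:: bary_sum (@px R) l t; bary_sum (@py R) l t; 4; bary_sum (@ph R) l t]`_j.
  rewrite -[4](bary_sum_cst 4 l t) /bary_sum.
  by case: j => [[|[|[|[|//]]]] hj] /=; apply: eq_bigr => i _; rewrite mxE.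
by case: j => [[|[|[|[|//]]]] hj].
Qed.

(** Weight 1/2 on vertex 0 balances 1/2 spread evenly over the top triangle: the resulting point has
    z = 0 and w = 4, so it is [core_point], interior to the simplex. *)
Definition center_weights : Delta 3 :=
  insubd (vert R (ord0 : 'I_4)) (\row_(i < 4) if i == 0 then 1 / 2 else 1 / 6).

Lemma val_center_weights i : val center_weights 0 i = if i == 0 then 1 / 2 else 1 / 6.
Proof.
rewrite insubdK ?mxE //; apply/mem_set; split=> [j|]; first by rewrite mxE; case: ifP; lra.
by rewrite !big_ord_recl big_ord0 !mxE /=; field.
Qed.

Lemma center_weights_gt0 i : 0 < val center_weights 0 i.
Proof. by rewrite val_center_weights; case: ifP; lra. Qed.

Definition core_point : W := lpt p q true 0 1.

Lemma center_sum F : bary_sum F l center_weights =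
  1 / 2 * F 0%N + 1 / 6 * (F 3%N + F 4%N + F 5%N) :> R.
Proof.
rewrite bary_sum3 !val_center_weights -!val_eqE /= !inordK //=.
by move: (F _) (F _) (F _) (F _) => x y z w; ring.
Qed.

Lemma center_pointE : of_exterior p q (center_simplex center_weights) = core_point.
Proof.
have -> : of_exterior p q (center_simplex center_weights) =
  @prism R p q 3 l center_weights by rewrite -center_simplexE.
rewrite -[LHS]/(lpt p q true (uc l center_weights) (phase (wc l center_weights))) /core_point.
rewrite /uc /zc /wc !center_sum /=.
have -> : (1 / 2 * -1 + 1 / 6 * (-1 + 2 + 2) : R) = 0 by field.
have -> : (1 / 2 * 0 + 1 / 6 * (0 + -1 + 1) : R) = 0 by field.
have -> : (1 / 2 * -1 + 1 / 6 * (1 + 1 + 1) : R) = 0 by field.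
have -> : (0 +i* 0 : R[i]) = 0 by [].
rewrite mulr0; congr (lpt p q true 0 _).
have -> : (4 +i* 0 : R[i]) = (4 : R)%:C * 1 by rewrite mulr1.
by rewrite phase_scale // phase_unit ?cabs1.
Qed.

End PositiveSimplex.

(** * Evaluation of the localized cochain on the fundamental class *)

Section EvaluateBockstein.
Variables (R : realType) (p q : int).
Hypotheses (p1 : 1 <= p) (cpq : coprimez p q).
Local Notation W := (lens (R := R) p q).
Local Notation Delta := (std_simplex R).
Local Notation prism := (@prism R p q).
Local Notation slit_set := (@slit_set R p q).
Local Notation core_point := (@core_point R p q).
Local Notation px := (@px R).
Local Notation py := (@py R).
Local Notation ph := (@ph R).

(** A point outside [Y false] has u = 0; among these only w = 1 lies on the positive reals. *)
Lemma off_core x : x != core_point -> (Y false `|` slit_set) x.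
Proof.
have [b [u [w [h ->]]]] := lpt_cases x; move=> xc.
have [Yf|nY] := pselect (Y false (lpt p q b u w)); [by left|right].
have uw := h; case: uw => u1 w1.
move: nY; rewrite /Y /= depthE // /depth_piece.
case: b h xc => /= h xc; last by rewrite oner_eq0.
move=> /negP; rewrite negbK eq_complex /= eqxx andbT cabs_eq0 => /eqP u0.
have aE : ang true (lpt p q true u w) = w by rewrite angE.
split; first by rewrite /Y /= depthE // /depth_piece /= oner_eq0.
rewrite /= aE; apply: slit_opp; first by rewrite -cabs_gt0 w1.
case=> w2 w3; move: xc; rewrite u0 /core_point.
suff -> : w = 1 by rewrite eqxx.
have := sqr_cabs w; rewrite w1 w2 expr0n /= addr0 expr1n => e.
by apply: complex_eq => //=; nra.
Qed.

Lemma core_facts : disk true core_point = 0 /\ ang true core_point = 1.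
Proof.
have h : valid (0 : R[i]) 1 by exact: valid01.
by rewrite /core_point diskE // angE.
Qed.

Lemma prism_off_core m l : (forall t : Delta m, ~ (bary_sum px l t = 0 /\ bary_sum py l t =
  0 /\ bary_sum ph l t = 0)) ->
  range (prism m l) `<=` ~` [set core_point].
Proof.
move=> h _ [t _ <-] e0; apply: (h t).
have {e0}e : prism m l t = core_point := e0.
have [d a] := core_facts.
have := disk_prism cpq l t; have [k k0 ak] := ang_prism_im cpq l t.
move: ak; rewrite e a d => /esym/eqP; rewrite mulf_eq0 gt_eqF //= => /eqP hz u0.
have /zc_eq0[? ?] : zc l t = 0 by apply/eqP; apply: contraTT isT => /uc_neq0; rewrite -u0 eqxx.
by [].
Qed.

(** The standard triangulation of triangle times interval. Only its last simplex contains the core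
    point. *)
Let e : chain R 3 W :=
  << prism 3 [:: 0; 1; 2; 5]%N >> - << prism 3 [:: 0; 1; 4; 5]%N >> + << prism 3 [:: 0; 3; 4;
    5]%N >>.

Lemma prism_face_list (l l' : seq nat) (i : nat) : (i < 4)%N ->
  l' = [:: nth 0%N l (bump i 0); nth 0%N l (bump i 1); nth 0%N l (bump i 2)] ->
  face (inord i) (prism 3 l) = prism 2 l'.
Proof. by move=> hi ->; apply: prism_face => // -[|[|[|]]]. Qed.

Lemma zc2_neq0 l : (forall t : Delta 2, ~ (bary_sum px l t = 0 /\ bary_sum py l t = 0)) ->
  small (Y false) slit_set (prism 2 l).
Proof.
move=> h; left; apply: prism_false => t; apply/eqP => /zc_eq0; exact: h.
Qed.

(** The inner faces cancel. Side faces miss z = 0 and so lie in [Y false]; on the top and the bottom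
    [ph] has constant sign, which places them in [slit_set]. *)
Lemma boundary_prism : on_support (small (Y false) slit_set) (boundary e).
Proof.
rewrite /e raddfD raddfB /= !boundary3.
rewrite (@prism_face_list _ [:: 1; 2; 5]%N 0) // (@prism_face_list _ [:: 0; 2; 5]%N 1) //
  (@prism_face_list _ [:: 0; 1; 5]%N 2) // (@prism_face_list _ [:: 0; 1; 2]%N 3) //.
rewrite (@prism_face_list _ [:: 1; 4; 5]%N 0) // (@prism_face_list _ [:: 0; 4; 5]%N 1) //
  (@prism_face_list _ [:: 0; 1; 5]%N 2) // (@prism_face_list _ [:: 0; 1; 4]%N 3) //.
rewrite (@prism_face_list _ [:: 3; 4; 5]%N 0) // (@prism_face_list _ [:: 0; 4; 5]%N 1) //
  (@prism_face_list _ [:: 0; 3; 5]%N 2) // (@prism_face_list _ [:: 0; 3; 4]%N 3) //.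
rewrite prism_boundary_algebra.
have z2 l : (forall t : Delta 2, ~ (bary_sum px l t = 0 /\ bary_sum py l t = 0)) ->
   on_support (small (Y false) slit_set) << prism 2 l >>.
  by move=> h; apply: on_supportU; exact: zc2_neq0.
have h2 l : (forall t : Delta 2, bary_sum ph l t != 0) ->
   on_support (small (Y false) slit_set) << prism 2 l >>.
  by move=> h; apply: on_supportU; right; exact: (prism_slit cpq).
repeat first [apply: on_supportD | apply: on_supportN].
- by apply: z2 => t; rewrite !bary_sum2 /=; have [????] := simplex2 t; lra.
- by apply: z2 => t; rewrite !bary_sum2 /=; have [????] := simplex2 t; lra.
- by apply: h2 => t; rewrite !bary_sum2 /=; have [????] := simplex2 t; apply/eqP; lra.
- by apply: z2 => t; rewrite !bary_sum2 /=; have [????] := simplex2 t; lra.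
- by apply: z2 => t; rewrite !bary_sum2 /=; have [????] := simplex2 t; lra.
- by apply: h2 => t; rewrite !bary_sum2 /=; have [????] := simplex2 t; apply/eqP; lra.
- by apply: z2 => t; rewrite !bary_sum2 /=; have [????] := simplex2 t; lra.
- by apply: z2 => t; rewrite !bary_sum2 /=; have [????] := simplex2 t; lra.
Qed.

Lemma prism_sum_algebra (V : zmodType) (x y u v : V) : x - y + u + (v - x + y) = u + v.
Proof.
have -> : v - x + y = v - (x - y) by rewrite opprB [y - x]addrC addrA.
by rewrite [x - y + u]addrC addrACA subrr addr0.
Qed.

Variables (a : simplex R 1 W -> R) (n : nat) (f : W -> R).
Hypotheses (ca : forall s, cob a s \is a Num.int) (na : normal a n f).
Let phi := localized a n f.
Let lam : R := n%:R ^+ 2 * q%:~R / p%:~R.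

Lemma localized_slit (s : simplex R 3 W) : range s `<=` slit_set -> phi s \is a Num.int.
Proof.
move=> sS; have sT : range s `<=` Y true by move=> x /sS[].
have := localized_true p1 cpq ca na sT; rewrite dlog_avoid ?mulr0 ?mul0r ?subr0 //.
- exact: ang_continuous.
- move=> x. have hx : Y true (ed 0 1 s x) by apply: (@range_ed R W 3 0 1 s _ sT (ed 0 1 s x));
  exists x.
  by apply: (ang_neq0 cpq).
- move=> x; have [|_] := @range_ed R W 3 0 1 s _ sS (ed 0 1 s x); first by exists x.
  exact: slit_oppP.
Qed.

Lemma localized_bottom l : nth 0%N l 0 \in [:: 0; 1; 2]%N -> nth 0%N l 1 \in [:: 0; 1; 2]%N ->
  phi (prism 3 l) \is a Num.int.
Proof.
move=> h0 h1; have := localized_true p1 cpq ca na (@prism_true R p q 3 l).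
by rewrite prism_ed // jump_bottom // mulr0 mul0r subr0.
Qed.

(** The front edge 0 3 crosses the positive reals once and the back triangle 3 4 5 winds once around
    the core, so the coefficient of [lam] is 1. *)
Lemma localized_center : phi (prism 3 [:: 0; 3; 4; 5]%N) - lam \is a Num.int.
Proof.
have := localized_true p1 cpq ca na (@prism_true R p q 3 [:: 0; 3; 4; 5]%N).
rewrite /tri !prism_ed //= jump_up // mu34 // mu35 // mu45 //.
by rewrite add0r subr0 !mulr1.
Qed.

Lemma ev_bockstein_cup (z : chain R 3 W) : lens_fundamental_cycle z ->
  ev (bockstein_cup a) z - lam \is a Num.int.
Proof.
case=> [[z0 _]] /(_ (@center_simplex R) (@center_weights R) (@center_simplex_positive R)
  (@center_weights_gt0 R)).
rewrite center_pointE center_simplexE => -[a0 sa0 [b eb]].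
pose s1 := prism 3 [:: 0; 1; 2; 5]%N; pose s2 := prism 3 [:: 0; 1; 4; 5]%N;
  pose s3 := prism 3 [:: 0; 3; 4; 5]%N.
(* Local homology compares [z] with the central simplex alone. The other two simplices of the prism
   miss the core point and are moved into the error chain. *)
have sa : on_support (fun s : simplex R 3 W => range s `<=` Y false `|` slit_set) (a0 - << s1 >>
  + << s2 >>).
  have sub (s : simplex R 3 W) : range s `<=` ~` [set core_point] ->
    range s `<=` Y false `|` slit_set.
    by move=> h x /h /= /eqP; exact: off_core.
  apply: on_supportD; last first.
    apply: on_supportU; apply: sub; apply: prism_off_core => t.
    by rewrite !bary_sum3 /=; have [?????] := simplex3 t; lra.
  apply: on_supportD; first by move=> s /sa0 /sub.
  apply: on_supportN; apply: on_supportU; apply: sub; apply: prism_off_core => t.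
  by rewrite !bary_sum3 /=; have [?????] := simplex3 t; lra.
have eE : z - (e + (a0 - << s1 >> + << s2 >>)) = boundary b.
  rewrite -eb; congr (z - _); rewrite /e -/s1 -/s2 -/s3.
  exact: prism_sum_algebra.
have H : ev phi z - ev phi e \is a Num.int.
  apply: (excision (@Y_open R p q false) (@slit_set_open R p q cpq) (cob_localized n f ca) _ z0
    eE sa boundary_prism).
  by move=> s [sF|sS]; [exact: (localized_false p1 cpq ca na)|exact: localized_slit].
have eve : ev phi e = phi s1 - phi s2 + phi s3 by rewrite /e raddfD raddfB /= !evU.
have i1 : phi s1 \is a Num.int by exact: localized_bottom.
have i2 : phi s2 \is a Num.int by exact: localized_bottom.
rewrite -(ev_localized a n f z0) -/phi.
have := rpredD H (rpredD (rpredB i1 i2) localized_center); rewrite eve.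
by congr (_ \is a Num.int); rewrite -/s3; move: (phi s1) (phi s2) (phi s3) (ev phi z) => x y w
  v; ring.
Qed.

End EvaluateBockstein.

(** * The invariant as a Gauss sum *)

Section CocycleAngles.
Variables (R : realType) (X : topologicalType).
Implicit Types (c : @cocycle1 R X) (a : simplex R 1 X -> R).

Definition angles c (s : simplex R 1 X) : R := turn (val c s).

Lemma cabs_norm (z : R[i]) : `|z| = 1 <-> cabs z = 1.
Proof. by rewrite cabsE; split=> [/complexI //|->]. Qed.

Lemma e2pi_angles c s : e2pi (angles c s) = val c s.
Proof.
have [c1 _] := set_mem (valP c).
by have [] := turnP ((cabs_norm _).1 (c1 s)).
Qed.

Lemma angles01 c s : 0 <= angles c s < 1.
Proof.
have [c1 _] := set_mem (valP c).
by have [] := turnP ((cabs_norm _).1 (c1 s)).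
Qed.

Lemma edge01 n (s : simplex R n.+1 X) : edge 0 1 s = ed 0 1 s.
Proof. by rewrite /ed; congr (edge _ _ s); apply: val_inj; rewrite /= inordK. Qed.

Lemma edge0i n k (s : simplex R n.+1 X) : edge 0 (inord k) s = ed 0 k s.
Proof. by rewrite /ed; congr (edge _ _ s); apply: val_inj; rewrite /= inordK. Qed.

Lemma edge1i n k (s : simplex R n.+1 X) : edge 1 (inord k) s = ed 1 k s.
Proof. by rewrite /ed; congr (edge _ _ s); apply: val_inj; rewrite /= inordK. Qed.

Lemma angles_cocycle c s : cob (angles c) s \is a Num.int.
Proof.
have [_ c2] := set_mem (valP c); rewrite cob_tri /tri.
have := c2 s; rewrite edge01 edge0i edge1i -!e2pi_angles -e2piD => /e2pi_eq; exact.
Qed.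

Lemma cocycle_of_subproof a : (forall s, cob a s \is a Num.int) ->
  (fun s => e2pi (a s)) \in @cocycle1 R X.
Proof.
move=> ca; apply/mem_set; split=> s; first by rewrite normr_e2pi.
rewrite edge01 edge0i edge1i -e2piD; apply/e2pi_eq.
by have := ca s; rewrite cob_tri.
Qed.

Definition cocycle_of a (ca : forall s, cob a s \is a Num.int) : @cocycle1 R X :=
  exist (fun y => y \in @cocycle1 R X) _ (cocycle_of_subproof ca).

Lemma angles_cocycle_of a ca s : eqz (angles (@cocycle_of a ca) s) (a s).
Proof. by apply/e2pi_eq; rewrite e2pi_angles. Qed.

Lemma vertexE n (i : 'I_n.+1) (s : simplex R n X) : vertex i s = const_simplex R 0 (s (vert R i)).
Proof.
rewrite /vertex restrictE; apply: simplexP => t /=; congr (s _).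
apply: simplex_eq => j; rewrite val_comb /= !val_vert big_ord1.
by have := simplex_sum1 t; rewrite big_ord1 => ->; rewrite mul1r.
Qed.

Lemma cohomologousP c c' : reflect (exists h : X ->
  R, forall s, eqz (angles c' s) (angles c s + path_diff h s))
  (cohomologous c c').
Proof.
apply: (iffP (asboolP _)) => [[b b1 e]|[h e]].
  exists (fun x => turn (b (const_simplex R 0 x))) => s.
  have hb v : e2pi (turn (b v)) = b v by have [] := turnP ((cabs_norm _).1 (b1 v)).
  apply/e2pi_eq; rewrite e2piD e2piB !hb !e2pi_angles e !vertexE mulrA; exact: erefl.
exists (fun v => e2pi (h (v (vert R ord0)))) => [v|s]; first exact: normr_e2pi.
rewrite -!e2pi_angles; have /e2pi_eq -> := e s.
by rewrite e2piD e2piB mulrA !vertexE.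
Qed.

Lemma frac_uniq (x y : R) : 0 <= y < 1 -> x - y \is a Num.int -> frac x = y.
Proof.
move=> y01 h; have := frac01 x; have := frac_int x => hx x01.
apply/eqP; rewrite -subr_eq0; apply/eqP/int_lt1; last lra.
have := rpredB h hx; congr (_ \is a Num.int); ring.
Qed.

(** By the cocycle condition the reduced sum [b + c] is the angle on the edge 1 3, so b + c -
    [b + c] is the coboundary of the angles on the triangle 1 2 3. *)
Lemma pull_omegaE (k : nat) c (s : simplex R 3 X) :
  pull_omega k%:Z c s = e2pi (k%:R * bockstein_cup (angles c) s).
Proof.
rewrite /pull_omega /omega edge01 edge1i -/(angles c _) -/(angles c _) -/(ed 2 3 s) -/(angles c
  _).
have -> : frac (angles c (ed 1 2 s) + angles c (ed 2 3 s)) = angles c (ed 1 3 s).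
  apply: frac_uniq; first exact: angles01.
  exact: (tri_int 1 2 3 s (angles_cocycle c)).
by rewrite /bockstein_cup /tri -mulrA.
Qed.

Lemma evaluateE n (U : simplex R n X -> R) z : evaluate (fun s => e2pi (U s)) z = e2pi (ev U z).
Proof.
rewrite /evaluate evE; elim: (dom z : seq _) => [|s r IH]; first by rewrite !big_nil e2pi0.
by rewrite !big_cons IH e2piD e2piMz.
Qed.

Lemma evZ n (U : simplex R n X -> R) (k : R) z : ev (fun s => k * U s) z = k * ev U z.
Proof. by rewrite !evE mulr_sumr; apply: eq_bigr => s _; rewrite mulrzAr. Qed.

Lemma evaluate_pull (k : nat) c (z : chain R 3 X) :
  evaluate (pull_omega k%:Z c) z = e2pi (k%:R * ev (bockstein_cup (angles c)) z).
Proof.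
have -> : pull_omega k%:Z c = fun s => e2pi (k%:R * bockstein_cup (angles c) s).
  by apply/funext => s; exact: pull_omegaE.
by rewrite evaluateE evZ.
Qed.

End CocycleAngles.

Section Invariant.
Variables (R : realType) (p q : int).
Hypotheses (p1 : 1 <= p) (cpq : coprimez p q).
Local Notation W := (lens (R := R) p q).

Lemma normal_shift (a a' : simplex R 1 W -> R) n f h : normal a n f ->
  (forall s, eqz (a' s) (a s + path_diff h s)) -> normal a' n (fun x => f x + h x).
Proof.
move=> [nF nT] e; split=> s sY; apply: eqz_trans (e s) _; rewrite path_diffD.
  have := eqzD (nF s sY) (eqz_refl (path_diff h s)).
  by rewrite -(addrA _ (path_diff f s) (path_diff h s)).
have := eqzD (nT s sY) (eqz_refl (path_diff h s)).
by rewrite (addrAC _ _ (path_diff h s)) -(addrA _ (path_diff f s) (path_diff h s)).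
Qed.

Lemma normal_eqz (a a' : simplex R 1 W -> R) n f : normal a n f ->
  (forall s, eqz (a' s) (a s)) -> normal a' n f.
Proof. by move=> [nF nT] e; split=> s sY; apply: eqz_trans (e s) _; [exact: nF|exact: nT]. Qed.

Definition model_angles (n : nat) := s2val (cid2 (normal_surj R p1 cpq n)).

Lemma model_cocycle n s : cob (model_angles n) s \is a Num.int.
Proof. exact: (s2valP (cid2 (normal_surj R p1 cpq n))). Qed.

Lemma model_normal n : normal (model_angles n) n (fun=> 0).
Proof. exact: (s2valP' (cid2 (normal_surj R p1 cpq n))). Qed.

Definition model (n : nat) : @cocycle1 R W := cocycle_of (@model_cocycle n).

Lemma normal_model n : normal (angles (model n)) n (fun=> 0).
Proof. by apply: normal_eqz (model_normal n) _ => s; exact: angles_cocycle_of. Qed.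

Definition model_class (i : 'I_`|p|) : @H1_U1 R W := \pi_(@H1_U1 R W) (model i).

Lemma model_class_inj : injective model_class.
Proof.
move=> i j /eqmodP /cohomologousP[h e]; apply: val_inj.
exact: (normal_unique p1 cpq (ltn_ord i) (ltn_ord j) (normal_model i) (normal_model j) e).
Qed.

Lemma model_class_surj nu : exists i, model_class i = nu.
Proof.
have [n np [f nf]] := normal_exists p1 cpq (angles_cocycle (repr nu)).
exists (Ordinal np); rewrite -[RHS]reprK; apply/eqmodP/cohomologousP.
exists (fun x => f x - 0) => s.
exact: (normal_cohomologous (angles_cocycle _) (angles_cocycle _) (normal_model n) nf).
Qed.

(** The representative chosen by the quotient is only cohomologous to the model; its normal form has
    the same n and a different primitive, which does not affect the value. *)
Lemma evaluate_model_class (z : chain R 3 W) (k : nat) i : lens_fundamental_cycle z ->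
  evaluate (pull_omega k%:Z (repr (model_class i))) z =
  e2pi (k%:R * (i%:R ^+ 2 * q%:~R / p%:~R)).
Proof.
move=> hz; rewrite evaluate_pull.
have /eqmodP/cohomologousP[h e] : \pi_(@H1_U1 R W) (model i) =
  \pi_(@H1_U1 R W) (repr (model_class i)) by rewrite reprK.
have nc := normal_shift (normal_model i) e.
have := ev_bockstein_cup p1 cpq (angles_cocycle _) nc hz; move=> H.
by apply/e2pi_eq; rewrite -mulrBr; apply: rpredM => //; rewrite pmulrn intr_int.
Qed.

Lemma model_class_bij : set_bij [set: 'I_`|p|] [set: @H1_U1 R W] model_class.
Proof.
split=> // [i j _ _|nu _]; first exact: model_class_inj.
by have [i <-] := model_class_surj nu; exists i.
Qed.

Lemma card_H1 : #|` fset_set [set: @H1_U1 R W]| = `|p|%N.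
Proof.
apply: card_fset_set; rewrite (card_eqr card_II).
have -> : [set: @H1_U1 R W] = model_class @` setT.
  by apply/seteqP; split => // nu _; have [i <-] := model_class_surj nu; exists i.
by apply: inj_card_eq => i j _ _; exact: model_class_inj.
Qed.

Lemma ZdwE (z : chain R 3 W) (k : nat) : lens_fundamental_cycle z ->
  Zdw k%:Z z = (`|p|%N%:R)^-1 * \sum_(i < `|p|%N) e2pi (k%:R * (i%:R ^+ 2 * q%:~R / p%:~R) : R).
Proof.
move=> hz; rewrite /Zdw card_H1; congr (_ * _).
rewrite (reindex_fsbig model_class [set: 'I_`|p|]); last exact: model_class_bij.
have -> : [set: 'I_`|p|] = [set` index_enum 'I_`|p|].
  by apply/seteqP; split => // i _ /=; exact: mem_index_enum.
rewrite -fsbig_seq ?index_enum_uniq //.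
by apply: eq_bigr => i _; exact: evaluate_model_class.
Qed.

End Invariant.

(** * Recovering p and the square class of q *)

Section Spectrum.
Variable R : realType.
Implicit Types x y : R.

Lemma e2pi_geometric (N : nat) x : (N%:R * x) \is a Num.int ->
  \sum_(k < N) e2pi (k%:R * x) = if x \is a Num.int then N%:R else 0.
Proof.
move=> Nx; have eX (k : nat) : e2pi (k%:R * x) = e2pi x ^+ k by rewrite mulr_natl e2piMn.
under eq_bigr do rewrite eX.
case: ifPn => xi.
  by rewrite (e2pi_int xi); under eq_bigr do rewrite expr1n; rewrite sumr_const card_ord.
have w1 : e2pi x - 1 != 0.
  by rewrite subr_eq0; apply: contraNneq xi => /e2pi_eq1.
by apply: (mulfI w1); rewrite -subrX1 -eX (e2pi_int Nx) subrr mulr0.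
Qed.

(** Fourier inversion on Z/N with N a common denominator. The coefficient at [x i0] is positive on
    the left, so it cannot vanish on the right. *)
Lemma spectrum (N P P' : nat) (x : 'I_P -> R) (x' : 'I_P' -> R) (i0 : 'I_P) : (0 < N)%N ->
  (forall i, N%:R * x i \is a Num.int) -> (forall i, N%:R * x' i \is a Num.int) ->
  (forall k : nat, (P%:R)^-1 * \sum_i e2pi (k%:R * x i) =
    (P'%:R)^-1 * \sum_i e2pi (k%:R * x' i) :> R[i]) ->
  exists j, x' j - x i0 \is a Num.int.
Proof.
move=> N0 xi xi' H; apply: contrapT => nex.
(* Averaging against the character of [x i0] counts the indices whose value agrees with it modulo
   integers. *)
have shift M (u : 'I_M -> R) : (forall i, N%:R * u i \is a Num.int) ->
    \sum_(k < N) e2pi (- (k%:R * x i0)) * ((M%:R)^-1 * \sum_i e2pi (k%:R * u i)) =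
    (M%:R)^-1 * \sum_i (if u i - x i0 \is a Num.int then N%:R else 0) :> R[i].
  move=> ui; under eq_bigr do rewrite mulrCA mulr_sumr.
  rewrite -mulr_sumr exchange_big /=; congr (_ * _); apply: eq_bigr => i _.
  rewrite -e2pi_geometric; last by rewrite mulrBr rpredB.
  by apply: eq_bigr => k _; rewrite -e2piD mulrBr addrC.
have := shift _ _ xi; under eq_bigr do rewrite H.
rewrite (shift _ _ xi') [X in _^-1 * X]big1 => [|j _]; last first.
  by case: ifP => // h; case: nex; exists j.
rewrite mulr0 => /esym/eqP; rewrite mulf_eq0 invr_eq0 pnatr_eq0 -leqn0 leqNgt (leq_ltn_trans _
  (ltn_ord i0)) //=.
rewrite (bigD1 i0) //= subrr rpred0 gt_eqF // ltr_pwDl //; first by rewrite ltr0n.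
by apply: sumr_ge0 => i _; case: ifP.
Qed.

Lemma sum_periodic (P : nat) (c : int) (G : int -> R[i]) : coprimez P c ->
  (forall m n : int, (m = n %[mod P])%Z -> G m = G n) ->
  \sum_(n < P) G (c * n%:Z) = \sum_(n < P) G n%:Z.
Proof.
case: P => [|P] cP per; first by rewrite !big_ord0.
have h (n : 'I_P.+1) : (`|((c * n%:Z) %% P.+1%:Z)%Z| < P.+1)%N.
  by rewrite -ltz_nat gez0_abs ?modz_ge0 // ltz_pmod.
pose s n := Ordinal (h n).
have sE n : (s n : nat)%:Z = ((c * n%:Z) %% P.+1%:Z)%Z by rewrite /s /= gez0_abs // modz_ge0.
have inj : injective s.
  move=> m n /(congr1 (fun i : 'I_P.+1 => (i : nat)%:Z)); rewrite !sE => /eqP.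
  rewrite eqz_mod_dvd -mulrBr Gauss_dvdzr // -eqz_mod_dvd => /eqP.
  by rewrite !modz_small ?ltz_nat ?ltn_ord //= => -[] /val_inj.
rewrite [RHS](reindex_inj inj) /=; apply: eq_bigr => n _; apply: per.
by rewrite -/(nat_of_ord (s n)) sE modz_mod.
Qed.

End Spectrum.

Section LensArithmetic.
Variable R : realType.
Implicit Types p q : int.

Definition gauss_mean p q (k : nat) : R[i] :=
  (`|p|%N%:R)^-1 * \sum_(i < `|p|%N) e2pi (k%:R * (i%:R ^+ 2 * q%:~R / p%:~R) : R).

Let abs_pos p : 1 <= p -> `|p|%N%:Z = p. Proof. by move=> p1; rewrite gez0_abs //; lia. Qed.
Let neq0 p : 1 <= p -> p%:~R != 0 :> R. Proof. by move=> p1; rewrite intr_eq0; lia. Qed.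

Lemma gauss_mean_square p q q' (a : int) (k : nat) : 1 <= p -> coprimez p q -> coprimez p q' ->
  (q * q' = a ^+ 2 %[mod p])%Z -> gauss_mean p q k = gauss_mean p q' k.
Proof.
move=> p1 cq cq' e; have p0 := neq0 p1; have pP := abs_pos p1.
have ca : coprimez p a.
  have : coprimez p (a ^+ 2).
    by rewrite /coprimez -gcdz_modr -e gcdz_modr -/(coprimez _ _) coprimezMr cq cq'.
  by rewrite expr2 coprimezMr => /andP[].
pose G (r n : int) : R[i] := e2pi (k%:R * (n%:~R ^+ 2 * r%:~R / p%:~R)).
have per r r' m n : (m ^+ 2 * r = n ^+ 2 * r' %[mod p])%Z -> G r m = G r' n.
  move=> /eqP; rewrite eqz_mod_dvd => /dvdzP[d hd].
  apply/e2pi_eq; rewrite -mulrBr -mulrBl; apply: rpredM; first by rewrite pmulrn intr_int.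
  have -> : m%:~R ^+ 2 * r%:~R - n%:~R ^+ 2 * r'%:~R = (d * p)%:~R :> R.
    by rewrite -hd rmorphB !rmorphM.
  by rewrite rmorphM /= mulfK // intr_int.
have sq r c : coprimez p c -> \sum_(i < `|p|%N) G r (c * i%:Z) = \sum_(i < `|p|%N) G r i%:Z.
  move=> cc; apply: sum_periodic => [|m n mn]; first by rewrite pP.
  by apply: per; rewrite -modzMml -modzXm -pP mn modzXm modzMml.
rewrite /gauss_mean; congr (_ * _).
rewrite -[LHS]/(\sum_(i < `|p|%N) G q i%:Z) -[RHS]/(\sum_(i < `|p|%N) G q' i%:Z).
(* After both substitutions the exponents match: (q i)^2 q' = (q q') i^2 q, which is congruent to (a
   i)^2 q. *)
rewrite -(sq q' q cq) -(sq q a ca); apply: eq_bigr => i _; apply: per.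
have -> : (q * i%:Z) ^+ 2 * q' = (q * q') * (i%:Z ^+ 2 * q) by ring.
have -> : (a * i%:Z) ^+ 2 * q = a ^+ 2 * (i%:Z ^+ 2 * q) by ring.
by rewrite -modzMml -e modzMml.
Qed.

Lemma gauss_mean_witness p q p' q' : 1 <= p -> 1 <= p' -> coprimez p q ->
  (forall k : nat, gauss_mean p q k = gauss_mean p' q' k) ->
  (p %| p')%Z /\ exists n m : int, n ^+ 2 * q' * p - q * p' = m * p * p'.
Proof.
move=> p1 p1' cq H; have p0 := neq0 p1; have p0' := neq0 p1'.
have pP := abs_pos p1; have pP' := abs_pos p1'.
have P0 : (0 < `|p|)%N by lia. have P0' : (0 < `|p'|)%N by lia.
have pN : `|p|%N%:R = p%:~R :> R by rewrite -{2}pP.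
have pN' : `|p'|%N%:R = p'%:~R :> R by rewrite -{2}pP'.
have ltmod : (1 %% `|p| < `|p|)%N by rewrite ltn_mod.
(* The index 1, reduced modulo p because for p = 1 the only index is 0; its square is still 1 modulo
   p. *)
pose i0 := Ordinal ltmod.
have fracI (i : int) (n : nat) r s : 1 <= s -> (`|s|%N)%:R = s%:~R :> R ->
    ((n * `|s|)%N%:R * (i%:~R ^+ 2 * r%:~R / s%:~R) : R) \is a Num.int.
  move=> s1 sN; rewrite natrM sN -mulrA [s%:~R * _]mulrC divfK ?neq0 //.
  by rewrite !rpredM ?rpredX ?intr_int // pmulrn intr_int.
(* The product p p' is a common denominator of both families of fractions. *)
have [|i|i|j] := @spectrum R (`|p| * `|p'|)%N _ _
    (fun i : 'I_`|p| => i%:R ^+ 2 * q%:~R / p%:~R) (fun i : 'I_`|p'| => i%:R ^+ 2 * q'%:~R /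
      p'%:~R) i0 _ _ _ H.
- by rewrite muln_gt0 P0.
- by rewrite mulnC; exact: (fracI i%:Z _ q p).
- exact: (fracI i%:Z _ q' p').
move=> /intrP[d hd].
have [c hc] : exists c : int, (i0%:Z) ^+ 2 = 1 + c * p.
  have /dvdzP[c hc] : (p %| (i0%:Z) ^+ 2 - 1)%Z.
    rewrite -eqz_mod_dvd -modzXm /= -pP -modz_nat modz_mod modzXm expr1n //.
  by exists c; rewrite -hc addrC subrK.
have e : (j%:Z) ^+ 2 * q' * p - q * p' = (d + c * q) * p * p'.
  apply: (@intr_inj R).
  have -> : ((j%:Z) ^+ 2 * q' * p - q * p')%:~R =
    j%:R ^+ 2 * q'%:~R * p%:~R - q%:~R * p'%:~R :> R.
    by rewrite rmorphB !rmorphM.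
  have -> : ((d + c * q) * p * p')%:~R = (d%:~R + c%:~R * q%:~R) * p%:~R * p'%:~R :> R.
    by rewrite !rmorphM rmorphD rmorphM.
  have hc' : i0%:R ^+ 2 = 1 + c%:~R * p%:~R :> R.
    by have := congr1 (fun z : int => z%:~R : R) hc; rewrite rmorphD !rmorphM.
  move: hd; rewrite hc' => /(congr1 (fun z => z * (p%:~R * p'%:~R))).
  move: (j%:R : R) (q%:~R : R) (q'%:~R : R) (c%:~R : R) (d%:~R : R) (p%:~R : R) (p'%:~R : R) p0
    p0'.
  move=> J Q Q' C D A B A0 B0 h.
  have {}h : J ^+ 2 * Q' * A - (1 + C * A) * Q * B = D * (A * B) by rewrite -h; field;
    rewrite A0 B0.
  have -> : (D + C * Q) * A * B = D * (A * B) + C * Q * A * B by ring.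
  by rewrite -h; ring.
split; last by exists j%:Z, (d + c * q).
(* The relation exhibits q p' as a multiple of p, and q is coprime to p. *)
rewrite -(Gauss_dvdzr _ cq).
have -> : q * p' = ((j%:Z) ^+ 2 * q' - (d + c * q) * p') * p.
  by rewrite mulrBl [_ * p' * p]mulrAC -e; ring.
exact: dvdz_mull.
Qed.

Lemma gauss_mean_eq p q p' q' : 1 <= p -> 1 <= p' -> coprimez p q -> coprimez p' q' ->
  (p = p' /\ exists a : int, (q * q' = a ^+ 2 %[mod p])%Z) <->
  (forall k : nat, gauss_mean p q k = gauss_mean p' q' k).
Proof.
move=> p1 p1' cq cq'; split=> [[e [a ha]] k|H].
  by rewrite -e in cq' *; exact: gauss_mean_square ha.
have [pp' [n [m e]]] := gauss_mean_witness p1 p1' cq H.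
have [p'p _] := gauss_mean_witness p1' p1 cq' (fun k => esym (H k)).
have ep : p = p'.
  have e0 : `|p|%N = `|p'|%N by apply/eqP; rewrite eqn_dvd -!dvdzE pp' p'p.
  by rewrite -(abs_pos p1) -(abs_pos p1') e0.
split=> //; exists (n * q'); apply/eqP; rewrite eqz_mod_dvd.
move: e; rewrite -ep => e.
have {}e : n ^+ 2 * q' - q = m * p.
  by apply: (@mulIf _ p); [lia|rewrite mulrBl e].
have -> : q * q' - (n * q') ^+ 2 = - (m * q') * p.
  have -> : q = n ^+ 2 * q' - m * p by rewrite -e; ring.
  ring.
exact: dvdz_mull.
Qed.

End LensArithmetic.

Theorem theorem5p3 (R : realType) (whitehead : Whitehead_classification R)
    (p q p' q' : int) (hp : 1 <= p) (hp' : 1 <= p')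
    (hpq : coprimez p q) (hpq' : coprimez p' q')
    (z : chain R 3 (lens p q)) (hz : lens_fundamental_cycle z)
    (z' : chain R 3 (lens p' q')) (hz' : lens_fundamental_cycle z') :
  oriented_homotopy_equivalent z z' <->
  (forall k : nat, Zdw k%:Z z = Zdw k%:Z z').
Proof.
rewrite (whitehead _ _ _ _ z z' hp hp' hpq hpq' hz hz') (gauss_mean_eq R hp hp' hpq hpq').
have e k := ZdwE hp hpq k hz; have e' k := ZdwE hp' hpq' k hz'.
split=> H k; first exact: etrans (e k) (etrans (H k) (esym (e' k))).
exact: etrans (esym (e k)) (etrans (H k) (e' k)).
Qed.
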